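(* Let $\zeta=\zeta_{\varphi}$ be a Sturmian continued fraction with corresponding value $\sigma=\sigma_{\varphi}$ (as defined in the context), and let $\epsilon>0$. (1) The inequality $|Q(\zeta)|\leq H(Q)^{-3-\epsilon}$ has only finitely many irreducible solutions $Q\in\mathbb{Z}[T]$ of degree precisely three. In particular, $|\zeta-\alpha|\leq H(\alpha)^{-4-\epsilon}$ has only finitely many algebraic solutions $\alpha$ of degree precisely three. (2) On the other hand, the inequalities $$|Q(\zeta)|\leq H(Q)^{-3+\epsilon},\qquad |\zeta-\alpha|\leq H(\alpha)^{-4+\epsilon}$$ have solutions in irreducible polynomials $Q\in\mathbb{Z}[T]$ and in algebraic numbers $\alpha$ of degree precisely three, respectively, for arbitrarily large $H(Q)$ and $H(\alpha)$. (3) There exist arbitrarily large values of $X$ such that $$H(Q)\leq X,\qquad |Q(\zeta)|\leq X^{-2\sigma-1-\epsilon}$$ has no irreducible solution $Q\in\mathbb{Z}[T]$ of degree precisely three. Consequently, for arbitrarily large values of $X$ the system $$H(\alpha)\leq X,\qquad |\zeta-\alpha|\leq H(\alpha)^{-1}X^{-2\sigma-1-\epsilon}$$ admits no solution in an algebraic number $\alpha$ of degree precisely three. (4) Conversely, for any (sufficiently) large $X$ the estimates $$|Q(\zeta)|\leq X^{-2\sigma-1+\epsilon},\qquad |\zeta-\alpha|\leq H(\alpha)^{-1}X^{-2\sigma-1+\epsilon}$$ have solutions in irreducible cubic polynomials $Q\in\mathbb{Z}[T]$ with $H(Q)\leq X$ and in cubic algebraic numbers $\alpha$ with $H(\alpha)\leq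 X$, respectively.
   Context: Sturmian continued fractions. Let $a,b$ be fixed distinct positive integers and $(s_{k})_{k\geq 1}$ a sequence of positive integers. Define finite words over $\{a,b\}$ by $m_{0}=b$, $m_{1}=b^{s_{1}-1}a$, and $m_{k+1}=m_{k}^{s_{k+1}}m_{k-1}$ for $k\geq 1$ (concatenation and powers of words). Put $\varphi=[0;s_{1},s_{2},s_{3},\ldots]$, let $m_{\varphi}=\lim_{k\to\infty}m_{k}=b^{s_{1}-1}a\cdots$ be the infinite limit word, and let $\zeta_{\varphi}=[0;m_{\varphi}]$ be the real number whose continued fraction expansion has integer part $0$ followed by the letters of $m_{\varphi}$ as partial quotients. Put $$\sigma_{\varphi}=\liminf_{k\to\infty}[0;s_{k},s_{k-1},\ldots,s_{1}]=\frac{1}{\limsup_{k\to\infty}[s_{k};s_{k-1},\ldots,s_{1}]}.$$ Heights. $H(P)$ denotes the maximum of the absolute values of the coefficients of a polynomial $P$. For an algebraic number $\alpha$, $H(\alpha)=H(P)$ where $P\in\mathbb{Z}[T]$ is its (up to sign unique) minimal polynomial with coprime coefficients. *)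

(* Defs.v *)
From HB Require Import structures.
From mathcomp Require Import all_boot all_order all_algebra.
From mathcomp Require Import complex.
From mathcomp Require Import all_classical all_reals all_analysis.
Set Implicit Arguments.
Unset Strict Implicit.
Unset Printing Implicit Defensive.
Import Order.TTheory GRing.Theory Num.Theory.
Import numFieldNormedType.Exports.
Local Open Scope classical_set_scope.
Local Open Scope ring_scope.

(* [a_0; a_1, ..., a_n].  Since 0^-1 = 0, the innermost term a_n + 0^-1 is
   just a_n; every other inverse is taken at a positive number as soon as
   a_1, ..., a_n > 0. *)
Definition cfrac (R : realType) (l : seq nat) : R :=
  foldr (fun a x => a%:R + x^-1) 0 l.

Definition inf_cfrac (R : realType) (w : nat -> nat) : R :=
  limn (fun n => cfrac R (mkseq w n)).

(* The words m_k; only the values s 1, s 2, ... of s are used. *)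
Fixpoint sturm_word (a b : nat) (s : nat -> nat) (k : nat) : seq nat :=
  match k with
  | 0%N => [:: b]
  | k1.+1 =>
    match k1 with
    | 0%N => nseq (s 1%N).-1 b ++ [:: a]
    | k2.+1 => flatten (nseq (s k) (sturm_word a b s k1)) ++ sturm_word a b s k2
    end
  end.

(* The infinite word lim_k m_k, as the sequence of its letters: the limit is
   taken in the discrete space nat, and the default value 0 of nth only occurs
   for the finitely many k such that m_k has at most i letters. *)
Definition sturm_limit (a b : nat) (s : nat -> nat) (i : nat) : nat :=
  limn (fun k => nth 0%N (sturm_word a b s k) i).

Definition sturm_zeta (R : realType) (a b : nat) (s : nat -> nat) : R :=
  inf_cfrac R (fun i => if i is j.+1 then sturm_limit a b s j else 0%N).

Definition sturm_sigma (R : realType) (s : nat -> nat) : R :=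
  limn_inf (fun k => cfrac R (0%N :: rev [seq s i | i <- iota 1 k])).

Definition poly_height (P : {poly int}) : nat :=
  \max_(i < size P) `|(P`_i)%R|%N.

(* Irreducible element of the ring Z[T].  The library's irreducible_poly refers
   to divisibility up to nonzero constants, i.e. to irreducibility in Q[T]. *)
Definition irreducibleZ (Q : {poly int}) : Prop :=
  [/\ Q != 0, Q \isn't a GRing.unit &
      forall A B : {poly int}, Q = A * B ->
        A \is a GRing.unit \/ B \is a GRing.unit].

(* Minimal polynomial in Z[T] with coprime coefficients; the content zcontents
   has the sign of the leading coefficient, so that asking for the value 1 also
   fixes the sign of P. *)
Definition is_minpolyZ (F : fieldType) (x : F) (P : {poly int}) : Prop :=
  [/\ zcontents P = 1,
      root (map_poly intr P) x &
      forall Q : {poly int}, Q != 0 -> root (map_poly intr Q) x ->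
        (size P <= size Q)%N].

(* Equal to 0 when x is transcendental. *)
Definition minpolyZ (F : fieldType) (x : F) : {poly int} :=
  xget 0 [set P | is_minpolyZ x P].

Definition alg_height (F : fieldType) (x : F) : nat := poly_height (minpolyZ x).

Definition cubic (F : fieldType) (x : F) : Prop :=
  exists2 P : {poly int}, is_minpolyZ x P & size P = 4%N.

Definition irreducible_cubic (Q : {poly int}) : Prop :=
  irreducibleZ Q /\ size Q = 4%N.

Definition evalZ (R : realType) (Q : {poly int}) (x : R) : R :=
  (map_poly intr Q).[x].

(* The norm of R[i] is R[i]-valued; it is a nonnegative real element. *)
Definition dist (R : realType) (x : R) (z : R[i]) : R :=
  complex.Re `|real_complex R x - z|.

(* Main.v *)
Require Import Defs.
From mathcomp Require Import all_boot all_order all_algebra.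
From mathcomp Require Import complex.
From mathcomp Require Import all_classical all_reals all_analysis.
From mathcomp Require Import ring lra zify.
Import Order.TTheory GRing.Theory Num.Theory.
Import numFieldNormedType.Exports.
Local Open Scope classical_set_scope.
Local Open Scope ring_scope.
Set Implicit Arguments.
Unset Strict Implicit.
Unset Printing Implicit Defensive.

(** Let M_k be the product of the matrices (w 1; 1 0) over the letters w of m_k,
    let X_k be its upper left entry, which is comparable to its norm, and let
    W_k(T) = (-T, 1) M_k (1, T)^t be the quadratic polynomial whose roots T give
    the eigendirections (1, T) of M_k.  Everything rests on one fact about words: m_{k+1} m_k
    and m_k m_{k+1} differ only in the order of their last two letters
    (sturm_word_swap).  It has two consequences.
    - The commutator of M_k and M_{k+1} is the product of a matrix of determinant
      1 or -1 and of (a - b) times a rotation by a right angle.  The resultant of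
      two quadratic polynomials W_M, W_N is, up to sign, the determinant of the
      commutator of M and N, so Res(W_k, W_{k+1}) = (a - b)^2 up to sign
      (sturm_res): it is nonzero and bounded.
    - The expansion of zeta starts with m_{k+1} m_k, and with m_k m_{k+1} but for
      its last two letters, so M_k almost preserves the direction (1, zeta), and
      |W_k(zeta)| << 1/(X_k X_{k+1}^2) (sturm_small).

    Consequently W_k, T W_k, W_{k+1}, T W_{k+1} span a sublattice of bounded index
    of the integer polynomials of degree at most 3.  Write
    (a - b)^2 Q = A W_k + B W_{k+1} up to sign, with A and B integral and linear.
    If Q is an irreducible cubic then A and B do not vanish, while Cramer's rule
    bounds them in terms of H(Q) and |Q(zeta)| (chain_cofactors).  From B != 0 one
    gets that H(Q) >> X_{k+1} or |Q(zeta)| >> 1/(X_{k+1} X_k^2), for every k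
    (chain_lower_uniform): this yields the bound for the uniform exponent.  Choosing
    k such that |Q(zeta)|/H(Q) lies between (X_{k+1} X_{k+2})^-2 and
    (X_k X_{k+1})^-2, and using A != 0 and the fact that zeta is badly
    approximable, one gets |Q(zeta)| >> H(Q)^-3 (chain_lower_cubic).

    For the existence statements take Q = (u L_0 + v L_1) W_k + B W_{k+1}, where
    L_0, L_1 are the linear forms of two consecutive convergents of zeta of size
    about Z X_{k+1}/X_k.  Modulo a prime p that does not divide a - b every cubic
    is of this form, so residues of u, v, B can be chosen for which Q is congruent
    to a multiple of a cubic T^3 - T - e without roots modulo p; then Q is
    irreducible.  Adding to B a multiple of p of size about Z makes |Q'(zeta)|
    comparable to H(Q), which produces a root of Q close to zeta (chain_cubics).

    The number sigma enters through the growth of X_k: as X_{k+1} is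
    X_k^{s_{k+1}} X_{k-1} up to a factor 2^{s_{k+1}}, the difference between
    ln X_k / ln X_{k+1} and [0; s_{k+1}, ..., s_1] tends to 0 (sturm_ratio).  So
    X_k >= X_{k+1}^{sigma - e} for all large k, and X_k <= X_{k+1}^{sigma + e} for
    infinitely many k. *)

(** * Matrices of finite words *)

Definition letter_mx (w : nat) : 'M[int]_2 :=
  \matrix_(i, j) (if i == 0 then (if j == 0 then w%:Z else 1)
                  else (if j == 0 then 1 else 0)).

Definition word_mx (u : seq nat) : 'M[int]_2 := \prod_(w <- u) letter_mx w.

Lemma mx22E (S : pzRingType) (A B : 'M[S]_2) i j :
  (A * B) i j = A i 0 * B 0 j + A i 1 * B 1 j.
Proof.
rewrite mxE big_ord_recl big_ord1; congr (_ + A i _ * B _ j); exact: val_inj.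
Qed.

Lemma word_mx_cat u v : word_mx (u ++ v) = word_mx u * word_mx v.
Proof. exact: big_cat. Qed.

Lemma word_mx_cons w u : word_mx (w :: u) = letter_mx w * word_mx u.
Proof. exact: big_cons. Qed.

Lemma word_mx_rcons u w : word_mx (rcons u w) = word_mx u * letter_mx w.
Proof. by rewrite -cats1 word_mx_cat /word_mx big_seq1. Qed.

Section WordEntries.
Variable R : realType.

(** The entries are natural numbers, but all estimates on them are made in R. *)
Definition ent (u : seq nat) (i j : 'I_2) : R := (word_mx u i j)%:~R.

Lemma ent_cat u v i j :
  ent (u ++ v) i j = ent u i 0 * ent v 0 j + ent u i 1 * ent v 1 j.
Proof. by rewrite /ent word_mx_cat mx22E rmorphD !rmorphM. Qed.

Lemma ent_nil : ((ent [::] 0 0 = 1) * (ent [::] 0 1 = 0) *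
                 (ent [::] 1 0 = 0) * (ent [::] 1 1 = 1))%type.
Proof. by rewrite /ent /word_mx big_nil !mxE. Qed.

Lemma ent_cons w u j : (ent (w :: u) 0 j = w%:R * ent u 0 j + ent u 1 j) *
                       (ent (w :: u) 1 j = ent u 0 j).
Proof.
by rewrite /ent word_mx_cons !mx22E !mxE /= mul1r mul0r addr0 rmorphD rmorphM mul1r.
Qed.

Lemma ent_rcons u w i : (ent (rcons u w) i 0 = ent u i 0 * w%:R + ent u i 1) *
                        (ent (rcons u w) i 1 = ent u i 0).
Proof.
by rewrite /ent word_mx_rcons !mx22E !mxE /= mulr1 mulr0 addr0 rmorphD rmorphM mulr1.
Qed.

Lemma ent_bounds u : all (leq 1) u ->
  [/\ 1 <= ent u 0 0, 0 <= ent u 0 1 <= ent u 0 0, 0 <= ent u 1 0 <= ent u 0 0,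
      0 <= ent u 1 1 <= ent u 0 0 &
      ent u 1 0 + ent u 1 1 <= ent u 0 0 + ent u 0 1 /\
      ent u 0 1 + ent u 1 1 <= ent u 0 0 + ent u 1 0].
Proof.
elim: u => [|w u IH] /=; first by rewrite !ent_nil => _; split; try split; lra.
case/andP => w1 /IH [h1 /andP[? ?] /andP[? ?] /andP[? ?] [? ?]]; rewrite !ent_cons.
have {}w1 : 1 <= w%:R :> R by rewrite ler1n.
by split; try (apply/andP; split); try split; nra.
Qed.

Lemma ent_det u :
  ent u 0 0 * ent u 1 1 - ent u 0 1 * ent u 1 0 = (-1) ^+ size u.
Proof.
elim: u => [|w u IH]; first by rewrite !ent_nil; ring.
by rewrite !ent_cons /= exprS -IH; ring.
Qed.

Lemma ent_det_norm u : `|ent u 0 0 * ent u 1 1 - ent u 0 1 * ent u 1 0| = 1.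
Proof. by rewrite ent_det normrX normrN1 expr1n. Qed.

Lemma ent_cat00 u v : all (leq 1) u -> all (leq 1) v ->
  ent u 0 0 * ent v 0 0 <= ent (u ++ v) 0 0 <= 2 * (ent u 0 0 * ent v 0 0).
Proof.
move=> /ent_bounds [a1 /andP[a2 a3] /andP[a4 a5] /andP[a6 a7] [a8 a9]] /ent_bounds [b1 /andP[b2 b3] /andP[b4 b5] /andP[b6 b7] [b8 b9]].
by rewrite ent_cat; apply/andP; split; nra.
Qed.

(** The upper right entry is the upper left entry of the word without its last
    letter, so it is smaller only by a bounded factor. *)
Lemma ent_last (K : nat) u : all (leq 1) u -> all (geq K) u -> u != [::] ->
  ent u 0 0 <= (K.+1)%:R * ent u 0 1.
Proof.
case/lastP: u => // u w; rewrite !all_rcons !ent_rcons.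
move=> /andP[_ /ent_bounds [h1 /andP[? ?] /andP[? ?] /andP[? ?] [? ?]]] /andP[/= wK _] _.
have {}wK : w%:R <= K%:R :> R by rewrite ler_nat.
by rewrite -(natr1 K); nra.
Qed.

(** The tail xi ranges over a closed interval, so that the condition on z is closed
    and passes to the limit. *)
Definition cf_prefix (z : R) (u : seq nat) : Prop :=
  exists2 xi : R, 0 <= xi <= 1 &
    (ent u 0 0 + ent u 0 1 * xi) * z = ent u 1 0 + ent u 1 1 * xi.

(** eta is the tail of z behind u: it starts with v and continues with xi. *)
Lemma cf_prefix_split z u v : all (leq 1) u -> all (leq 1) v ->
  cf_prefix z (u ++ v) -> exists xi eta : R,
  [/\ 0 <= xi <= 1, 0 <= eta <= 1,
      (ent (u ++ v) 0 0 + ent (u ++ v) 0 1 * xi) * z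
        = ent (u ++ v) 1 0 + ent (u ++ v) 1 1 * xi,
      (ent v 0 0 + ent v 0 1 * xi) * eta = ent v 1 0 + ent v 1 1 * xi &
      (ent u 0 0 + ent u 0 1 * eta) * z = ent u 1 0 + ent u 1 1 * eta].
Proof.
move=> /ent_bounds [a1 /andP[a2 a3] /andP[a4 a5] /andP[a6 a7] [a8 a9]] /ent_bounds [b1 /andP[b2 b3] /andP[b4 b5] /andP[b6 b7] [b8 b9]].
case=> xi /andP[x0 x1] E.
have D0 : 0 < ent v 0 0 + ent v 0 1 * xi by nra.
exists xi, ((ent v 1 0 + ent v 1 1 * xi) / (ent v 0 0 + ent v 0 1 * xi)).
have E2 : (ent v 0 0 + ent v 0 1 * xi) *
  ((ent v 1 0 + ent v 1 1 * xi) / (ent v 0 0 + ent v 0 1 * xi))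
   = ent v 1 0 + ent v 1 1 * xi by field; lra.
split => //.
- by rewrite x0 x1.
- rewrite divr_ge0 /=; [|nra|nra].
  by rewrite ler_pdivrMr //; nra.
- move: E2; set eta := _ / _ => E2.
  move: E; rewrite !ent_cat => E.
  apply: (mulfI (lt0r_neq0 D0)).
  transitivity (ent u 1 0 * (ent v 0 0 + ent v 0 1 * xi) +
                ent u 1 1 * ((ent v 0 0 + ent v 0 1 * xi) * eta)); last by ring.
  rewrite E2.
  transitivity ((ent u 0 0 * (ent v 0 0 + ent v 0 1 * xi) +
                ent u 0 1 * ((ent v 0 0 + ent v 0 1 * xi) * eta)) * z); first by ring.
  rewrite E2; nra.
Qed.

Lemma cf_prefix_catl z u v : all (leq 1) u -> all (leq 1) v ->
  cf_prefix z (u ++ v) -> cf_prefix z u.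
Proof.
by move=> hu hv /(cf_prefix_split hu hv)[xi [eta [_ ? _ _ ?]]]; exists eta.
Qed.

Lemma cf_prefix_cfrac u v : all (leq 1) u -> all (leq 1) v ->
  cf_prefix (cfrac R (u ++ v))^-1 u.
Proof.
move=> hu hv.
have vP (w : seq nat) : all (leq 1) w -> 0 <= (cfrac R w)^-1 <= 1 .
  case: w => [|w w'] /=; first by rewrite invr0 lexx ler01.
  case/andP=> w1 hw.
  suff h : 1 <= w%:R + (cfrac R w')^-1.
    by rewrite invr_ge0 invf_le1; [rewrite h andbT|]; lra.
  have w1' : 1 <= w%:R :> R by rewrite ler1n.
  suff : 0 <= cfrac R w' by rewrite -invr_ge0; lra.
  elim: w' hw => //= x l IH /andP[_ /IH h]; rewrite addr_ge0 ?invr_ge0 //.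
exists (cfrac R v)^-1; first exact: vP.
elim: u hu => [|w u IH] /=; first by rewrite !ent_nil; lra.
case/andP=> w1 hu; have {IH} := IH hu; rewrite !ent_cons.
have /vP/andP[] : all (leq 1) (u ++ v) by rewrite all_cat hu.
have {}w1 : 1 <= w%:R :> R by rewrite ler1n.
set c := (cfrac R (u ++ v))^-1; set d := (cfrac R v)^-1 => c0 c1 E.
have D0 : w%:R + c != 0 by apply/lt0r_neq0; lra.
apply: (mulIf D0); rewrite -mulrA mulVf // mulr1 mulrDr.
transitivity (w%:R * (ent u 0 0 + ent u 0 1 * d) + (ent u 1 0 + ent u 1 1 * d)).
  by ring.
by rewrite -E; ring.
Qed.

End WordEntries.

(** * Infinite continued fractions *)

Section InfiniteFraction.
Variable R : realType.

Lemma cf_prefix_le (z : R) u : all (leq 1) u -> cf_prefix z u ->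
  `|ent R u 0 0 * z - ent R u 1 0| <= (ent R u 0 0)^-1 /\
  `|ent R u 0 1 * z - ent R u 1 1| <= (ent R u 0 0)^-1.
Proof.
move=> /(@ent_bounds R) [h1 /andP[h2 h3] /andP[h4 h5] /andP[h6 h7] [h8 h9]].
case=> xi /andP[x0 x1] E; have := ent_det_norm R u.
move: h1 h2 h3 h4 h5 h6 h7 h8 h9 E.
set x := ent R u 0 0; set y := ent R u 0 1; set p := ent R u 1 0; set t := ent R u 1 1.
move=> h1 h2 h3 h4 h5 h6 h7 h8 h9 E D.
have D0 : 0 < x + y * xi by nra.
have D1 : x <= x + y * xi by nra.
have x_gt0 : 0 < x by lra.
have F1 : `|x * z - p| * (x + y * xi) = xi.
  rewrite -[in LHS](gtr0_norm D0) -normrM.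
  have -> : (x * z - p) * (x + y * xi) = xi * (x * t - y * p).
    transitivity (x * ((x + y * xi) * z) - p * (x + y * xi)); first by ring.
    by rewrite E; ring.
  by rewrite normrM D mulr1 ger0_norm.
have F2 : `|y * z - t| * (x + y * xi) = 1.
  rewrite -[in LHS](gtr0_norm D0) -normrM.
  have -> : (y * z - t) * (x + y * xi) = - (x * t - y * p).
    transitivity (y * ((x + y * xi) * z) - t * (x + y * xi)); first by ring.
    by rewrite E; ring.
  by rewrite normrN D.
have n1 := normr_ge0 (x * z - p); have n2 := normr_ge0 (y * z - t).
by split; rewrite -[leRHS]mul1r ler_pdivlMr //; nra.
Qed.

(** The tail is recovered by inverting the matrix of u; what remains are two
    inequalities that are affine in z. *)
Lemma cf_prefixP (z : R) u (d := (-1) ^+ size u) : all (leq 1) u ->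
  cf_prefix z u <->
  0 <= d * (ent R u 0 0 * z - ent R u 1 0) <= d * (ent R u 1 1 - ent R u 0 1 * z).
Proof.
move=> /(@ent_bounds R) [h1 /andP[h2 h3] /andP[h4 h5] /andP[h6 h7] [h8 h9]].
have dd : d * d = 1 by rewrite /d -expr2 sqrr_sign.
have := ent_det R u; rewrite -/d.
move: h1 h2 h3 h4 h5 h6 h7 h8 h9; rewrite /cf_prefix.
set x := ent R u 0 0; set y := ent R u 0 1; set p := ent R u 1 0; set t := ent R u 1 1.
move=> h1 h2 h3 h4 h5 h6 h7 h8 h9 D; split.
  case=> xi /andP[x0 x1] E.
  have D0 : 0 < x + y * xi by nra.
  have F1 : d * (x * z - p) * (x + y * xi) = xi.
    transitivity (d * (x * ((x + y * xi) * z) - p * (x + y * xi))); first by ring.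
    rewrite E; transitivity (d * (x * t - y * p) * xi); first by ring.
    by rewrite D dd mul1r.
  have F2 : d * (t - y * z) * (x + y * xi) = 1.
    transitivity (d * (t * (x + y * xi) - y * ((x + y * xi) * z))); first by ring.
    by rewrite E -dd -D; ring.
  by rewrite -(pmulr_lge0 _ D0) F1 x0 -(ler_pM2r D0) F1 F2.
move=> /andP[]; set al := d * (x * z - p); set be := d * (t - y * z) => a0 ab.
have E1 : x * be + y * al = 1.
  transitivity (d * (x * t - y * p)); last by rewrite D dd.
  by rewrite /al /be; ring.
have b0 : 0 < be.
  rewrite lt0r (le_trans a0 ab) andbT; apply/eqP => b0.
  have a0' : al = 0 by apply/le_anti; rewrite a0 -{1}b0 ab.
  by move: E1; rewrite b0 a0'; lra.
exists (al / be); first by rewrite divr_ge0 ?(ltW b0) //= ler_pdivrMr // mul1r.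
apply: (mulIf (lt0r_neq0 b0)).
transitivity ((x * be + y * al) * z); first by field; rewrite lt0r_neq0.
rewrite E1; transitivity (p * be + t * al); last by field; rewrite lt0r_neq0.
transitivity ((x * t - y * p) * d * z); first by rewrite D dd.
by rewrite /al /be; ring.
Qed.

Variable w : nat -> nat.
Hypothesis w_gt0 : forall i, (0 < w i)%N.

Lemma all_mkseq (P : pred nat) n : (forall i, P (w i)) -> all P (mkseq w n).
Proof. by move=> h; apply/allP => x /mapP [i _ ->]. Qed.

Lemma mkseq_catl (m n : nat) : (m <= n)%N ->
  exists2 v, mkseq w n = mkseq w m ++ v & all (leq 1) v.
Proof.
move=> mn; exists (drop m (mkseq w n)).
  by rewrite -{1}(cat_take_drop m (mkseq w n)) -map_take take_iota (minn_idPl mn).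
apply/allP => x /mem_drop /mapP [i _ ->]; exact: w_gt0.
Qed.

Lemma ent_mkseqS n : (ent R (mkseq w n.+1) 0 0 =
                       ent R (mkseq w n) 0 0 * (w n)%:R + ent R (mkseq w n) 0 1) *
                      (ent R (mkseq w n.+1) 0 1 = ent R (mkseq w n) 0 0).
Proof.
have -> : mkseq w n.+1 = rcons (mkseq w n) (w n).
  by rewrite /mkseq -addn1 iotaD map_cat cats1.
by rewrite !ent_rcons.
Qed.

Lemma ent_mkseq_ge n : n%:R <= ent R (mkseq w n) 0 0.
Proof.
have B m : 1 <= ent R (mkseq w m) 0 0.
  by case: (@ent_bounds R (mkseq w m) (all_mkseq _ w_gt0)).
have W m : 1 <= (w m)%:R :> R by rewrite ler1n.
case: n => [|n]; first by apply: le_trans (B 0%N); rewrite ler01.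
elim: n => [|n IH]; first exact: B.
rewrite !(ent_mkseqS n.+1) (ent_mkseqS n).2 -natr1.
by have := W n.+1; have := B n; have := B n.+1; nra.
Qed.

Let z_ n := cfrac R (0%N :: mkseq w n).

Let z_prefix m n : (m <= n)%N -> cf_prefix (z_ n) (mkseq w m).
Proof.
move=> /mkseq_catl [v E hv]; rewrite /z_ /= add0r E.
exact: cf_prefix_cfrac (all_mkseq _ w_gt0) hv.
Qed.

(** All truncations beyond the n-th lie within 1/n of the n-th convergent. *)
Lemma inf_cfrac_cvg :
  (fun n => cfrac R (0%N :: mkseq w n)) n @[n --> \oo] -->
  inf_cfrac R (fun i => if i is j.+1 then w j else 0%N).
Proof.
have zc : cvgn z_.
  apply/cauchy_cvgP/cauchy_exP => _/posnumP[e].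
  pose N := (Num.truncn (2 / e%:num)).+1.
  have Ne : 2 / e%:num < N%:R by rewrite /N; exact: truncnS_gt.
  have N1 : 1 <= N%:R :> R by rewrite ler1n.
  clearbody N.
  have B n : (N <= n)%N -> `|z_ n - ent R (mkseq w N) 1 0 / ent R (mkseq w N) 0 0| <= N%:R^-1.
    move=> /z_prefix/(cf_prefix_le (all_mkseq _ w_gt0))[h _].
    have xN := ent_mkseq_ge N.
    have x0 : 0 < ent R (mkseq w N) 0 0 by lra.
    rewrite (_ : z_ n - _ = (ent R (mkseq w N) 0 0 * z_ n - ent R (mkseq w N) 1 0) /  ent R (mkseq w N) 0 0);
      last by field; rewrite lt0r_neq0.
    rewrite normrM normfV (gtr0_norm x0) ler_pdivrMr //.
    apply: le_trans h _; apply: (@le_trans _ _ 1).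
      by rewrite invf_le1 //; lra.
    rewrite mulrC ler_pdivlMr ?mul1r //; lra.
  exists (ent R (mkseq w N) 1 0 / ent R (mkseq w N) 0 0).
  exists N => // n /= /B Bn; rewrite -ball_normE /ball_ /= distrC.
  apply: le_lt_trans Bn _; rewrite invf_plt ?posrE //; last by lra.
  by apply: lt_trans Ne; rewrite -[ltLHS]mul1r ltr_pM2r ?invr_gt0 //; lra.
have E : (fun n => cfrac R (mkseq (fun i => if i is j.+1 then w j else 0%N) n.+1)) = z_.
  apply/funext => n; rewrite /z_; congr cfrac; rewrite /mkseq /= (iotaDl 1 0) -map_comp.
  by [].
suff -> : inf_cfrac R (fun i => if i is j.+1 then w j else 0%N) = limn z_ by [].
apply/cvg_lim => //; rewrite -cvg_shiftS E; exact: zc.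
Qed.

Let zeta := inf_cfrac R (fun i => if i is j.+1 then w j else 0%N).

Lemma inf_cfrac_prefix n : cf_prefix zeta (mkseq w n).
Proof.
have H := all_mkseq n w_gt0.
apply/cf_prefixP => //; set d := (-1) ^+ _.
have zc : z_ @ \oo --> zeta := inf_cfrac_cvg.
set x := ent R _ 0 0; set y := ent R _ 0 1; set p := ent R _ 1 0; set t := ent R _ 1 1.
have c1 : (d * (x * z_ k - p)) @[k --> \oo] --> d * (x * zeta - p).
  by apply: cvgMr; apply: cvgB; [apply: cvgMr|exact: cvg_cst].
have c2 : (d * (t - y * z_ k)) @[k --> \oo] --> d * (t - y * zeta).
  by apply: cvgMr; apply: cvgB; [exact: cvg_cst|apply: cvgMr].
have B k : (n <= k)%N -> 0 <= d * (x * z_ k - p) <= d * (t - y * z_ k).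
  by move=> /z_prefix/(cf_prefixP _ H).
apply/andP; split.
  rewrite -(cvg_lim _ c1) //; apply: limr_ge; first by apply/cvg_ex; eexists; exact: c1.
  by exists n => // k /= /B /andP[].
rewrite -(cvg_lim _ c1) // -[leRHS](cvg_lim _ c2) //.
apply: ler_lim; [by apply/cvg_ex; eexists; exact: c1|by apply/cvg_ex; eexists; exact: c2|].
by exists n => // k /= /B /andP[].
Qed.

Lemma inf_cfrac_prefix_of u v N : u ++ v = mkseq w N -> cf_prefix zeta u.
Proof.
move=> E; apply: (@cf_prefix_catl _ _ _ v); last by rewrite E; exact: inf_cfrac_prefix.
  by have := all_mkseq N w_gt0; rewrite -E all_cat => /andP[].
by have := all_mkseq N w_gt0; rewrite -E all_cat => /andP[].
Qed.

End InfiniteFraction.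

(** * Linear forms with bounded partial quotients *)

Section LinearForms.
Variables (R : realType) (w : nat -> nat) (K : nat) (z : R).
Hypothesis w_gt0 : forall i, (0 < w i)%N.
Hypothesis w_le : forall i, (w i <= K)%N.
Hypothesis z_prefix : forall n, cf_prefix z (mkseq w n).

Let x n := ent R (mkseq w n) 0 0.

Lemma norm_int_ge1 (n : int) : n != 0 -> 1 <= `|n%:~R : R|.
Proof. by move=> n0; rewrite -intr_norm ler1z -gtz0_ge1 normr_gt0. Qed.

Lemma cf_prefix_bounds : K.+1%:R^-1 <= z <= 1.
Proof.
have [xi /andP[x0 x1]] := z_prefix 1.
rewrite /mkseq /= !ent_cons !ent_nil.
have w1 : 1 <= (w 0)%:R :> R by rewrite ler1n.
have w2 : (w 0)%:R <= K%:R :> R by rewrite ler_nat.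
rewrite !mulr1 !mulr0 !addr0 !add0r !mul1r => E.
have z0 : 0 < z by nra.
apply/andP; split; last by nra.
by rewrite -[leLHS]mul1r ler_pdivrMr ?ltr0Sn // -natr1; nra.
Qed.

Let x_ge1 n : 1 <= x n.
Proof. by case: (@ent_bounds R (mkseq w n) (all_mkseq _ w_gt0)). Qed.

Let xS n : x n.+1 <= K.+1%:R * x n.
Proof.
case: (@ent_bounds R (mkseq w n) (all_mkseq _ w_gt0)) => h1 /andP[h2 h3] _ _ _.
have w2 : (w n)%:R <= K%:R :> R by rewrite ler_nat.
by move: h1 h2 h3; rewrite /x ent_mkseqS -natr1; nra.
Qed.

Let x_first (Y : R) : 1 <= Y -> exists n, x n <= Y < x n.+1.
Proof.
move=> Y1; have ex : exists n, Y < x n.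
  exists (Num.truncn Y).+1; apply: lt_le_trans (truncnS_gt Y) _; exact: ent_mkseq_ge.
case: (ex_minnP ex) => -[|n] Yn nmin.
  by move: Yn; rewrite /x /mkseq /= ent_nil; lra.
by exists n; rewrite Yn andbT leNgt; apply/negP => /nmin; rewrite ltnn.
Qed.

(** These are the forms of the last convergent with denominator at most Y and of
    its predecessor; the next denominator exceeds Y and is larger only by a
    bounded factor. *)
Lemma good_forms (Y : R) : 1 <= Y -> exists p0 q0 p1 q1 : int,
  [/\ (p0 * q1 - p1 * q0) ^+ 2 = 1,
      `|p0%:~R| <= Y /\ `|q0%:~R| <= Y, `|p1%:~R| <= Y /\ `|q1%:~R| <= Y,
      `|p0%:~R + q0%:~R * z| <= K.+1%:R / Y &
      `|p1%:~R + q1%:~R * z| <= K.+1%:R / Y].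
Proof.
move=> /[dup] Y1 /x_first [n /andP[xY Yx]].
have U := all_mkseq n w_gt0.
case: (@ent_bounds R _ U) => h1 /andP[h2 h3] /andP[h4 h5] /andP[h6 h7] _.
have [e1 e2] := cf_prefix_le U (z_prefix n).
have invY : (x n)^-1 <= K.+1%:R / Y.
  have := xS n; have := x_ge1 n => a1 a2.
  rewrite ler_pdivlMr; last by lra.
  by rewrite mulrC ler_pdivrMr; lra.
set M := word_mx (mkseq w n).
exists (- M 1 0), (M 0 0), (- M 1 1), (M 0 1); split.
- have : (M 0 0 * M 1 1 - M 0 1 * M 1 0) ^+ 2 = 1.
    apply: (@intr_inj R).
    rewrite rmorphXn rmorphB !rmorphM /= -!/(ent R _ _ _) ent_det -exprM mulnC exprM.
    by rewrite sqrrN expr1n expr1n.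
  by move=> <-; ring.
- rewrite rmorphN normrN -!/(ent R _ _ _) !ger0_norm //; last lra.
  by split; apply: le_trans xY; rewrite /x.
- rewrite rmorphN normrN -!/(ent R _ _ _) !ger0_norm //.
  by split; apply: le_trans xY; rewrite /x.
- by rewrite rmorphN addrC -!/(ent R _ _ _); exact: le_trans e1 invY.
- by rewrite rmorphN addrC -!/(ent R _ _ _); exact: le_trans e2 invY.
Qed.

(** Let x >= 2 H be the denominator of a convergent.  The value of p + qT there, times
    x, is an integer, which is less than 1 in absolute value if p + qz is small, and
    then is 0.  But p + qT cannot vanish at two consecutive convergents. *)
Lemma badly_approximable : exists2 c : R, 0 < c &
  forall (p q : int) (H : R), (p != 0) || (q != 0) ->
    `|p%:~R| <= H -> `|q%:~R| <= H -> c <= H * `|p%:~R + q%:~R * z|.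
Proof.
pose k : R := K.+1%:R; have k1 : 1 <= k by rewrite ler1n.
exists (4 * k ^+ 2)^-1; first by rewrite invr_gt0; nra.
move=> p q H pq pH qH.
have H1 : 1 <= H.
  by case/orP: pq => /norm_int_ge1 h; apply: le_trans h _.
have /x_first [n /andP[xH Hx]] : 1 <= 2 * H by lra.
pose u m : int := p * word_mx (mkseq w m) 0 0 + q * word_mx (mkseq w m) 1 0.
have uE m : (u m)%:~R = x m * (p%:~R + q%:~R * z)
       - q%:~R * (ent R (mkseq w m) 0 0 * z - ent R (mkseq w m) 1 0).
  by rewrite /u rmorphD !rmorphM /= -!/(ent R _ _ _) /x; ring.
have step m : 2 * H <= x m -> x m <= 2 * k ^+ 2 * H -> u m != 0 ->
    (4 * k ^+ 2)^-1 <= H * `|p%:~R + q%:~R * z|.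
  move=> h1 h2 /norm_int_ge1; rewrite uE.
  set D := _ * z - _; set A := _ + _ * z => h3.
  have [e1 _] := cf_prefix_le (all_mkseq m w_gt0) (z_prefix m).
  have x0 : 0 < x m by lra.
  have : `|x m * A - q%:~R * D| <= x m * `|A| + H * (x m)^-1.
    apply: le_trans (ler_normB _ _) _; rewrite !normrM (gtr0_norm x0) lerD2l.
    by apply: ler_pM.
  have : H * (x m)^-1 <= 2^-1 by rewrite ler_pdivrMr // ; lra.
  move=> h4 h5; have h6 : 2^-1 <= x m * `|A| by lra.
  rewrite -[leLHS]mul1r ler_pdivrMr; last by nra.
  have := normr_ge0 A; nra.
(* x n.+1 is the first denominator beyond 2 H; the next one does if p + qT vanishes there *)
have [un0|/step] := eqVneq (u n.+1) 0; last first.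
  apply; first exact: ltW.
  have := xS n; rewrite -/k => h.
  have : 0 <= (k - 1) * (k * H) by rewrite mulr_ge0; nra.
  by rewrite expr2; nra.
apply: (step n.+2).
- have := x_ge1 n.+1.
  have : x n.+1 <= x n.+2.
    rewrite /x (ent_mkseqS _ w n.+1).1.
    case: (@ent_bounds R (mkseq w n.+1) (all_mkseq _ w_gt0)) => h1 /andP[h2 h3] _ _ _.
    have : 1 <= (w n.+1)%:R :> R by rewrite ler1n.
    nra.
  by lra.
- have := xS n; have := xS n.+1; rewrite -/k => h h'.
  have : k * x n.+1 <= k * (k * (2 * H)) by apply: ler_wpM2l; nra.
  by rewrite expr2; nra.
apply/eqP => un1; have := ent_det_norm R (mkseq w n.+2).
suff E : p%:~R * (ent R (mkseq w n.+2) 0 0 * ent R (mkseq w n.+2) 1 1 -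
         ent R (mkseq w n.+2) 0 1 * ent R (mkseq w n.+2) 1 0) = 0 /\
   q%:~R * (ent R (mkseq w n.+2) 0 0 * ent R (mkseq w n.+2) 1 1 -
         ent R (mkseq w n.+2) 0 1 * ent R (mkseq w n.+2) 1 0) = 0.
  case: E => E1 E2 Dt.
  have D0 : ent R (mkseq w n.+2) 0 0 * ent R (mkseq w n.+2) 1 1 -
         ent R (mkseq w n.+2) 0 1 * ent R (mkseq w n.+2) 1 0 != 0.
    by rewrite -normr_gt0 Dt.
  move/eqP: E1; move/eqP: E2; rewrite !mulf_eq0 (negbTE D0) !orbF !intr_eq0.
  by move=> q0 p0; move: pq; rewrite p0 q0.
have col : p%:~R * ent R (mkseq w n.+2) 0 1 + q%:~R * ent R (mkseq w n.+2) 1 1 = 0.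
  have -> : mkseq w n.+2 = rcons (mkseq w n.+1) (w n.+1).
    by rewrite /mkseq -(addn1 n.+1) iotaD map_cat cats1.
  rewrite !ent_rcons.
  have : (u n.+1)%:~R = 0 :> R by rewrite un0.
  by rewrite /u rmorphD !rmorphM.
have col' : p%:~R * ent R (mkseq w n.+2) 0 0 + q%:~R * ent R (mkseq w n.+2) 1 0 = 0.
  have : (u n.+2)%:~R = 0 :> R by rewrite un1.
  by rewrite /u rmorphD !rmorphM.
move: col col'; set a := ent _ _ 0 1; set b := ent _ _ 1 1; set c := ent _ _ 0 0.
set d := ent _ _ 1 0 => col col'; split.
  transitivity ((p%:~R * c + q%:~R * d) * b - (p%:~R * a + q%:~R * b) * d); first by ring.
  by rewrite col col'; ring.
transitivity ((p%:~R * a + q%:~R * b) * c - (p%:~R * c + q%:~R * d) * a); first by ring.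
by rewrite col col'; ring.
Qed.

End LinearForms.

(** * Combinatorics of the Sturmian words *)

Section SturmianWords.
Variables (a b : nat) (s : nat -> nat).
Hypothesis s_gt0 : forall k : nat, (0 < k)%N -> (0 < s k)%N.

Let m := sturm_word a b s.

Lemma sturm_wordSS k : m k.+2 = flatten (nseq (s k.+2) (m k.+1)) ++ m k.
Proof. by []. Qed.

Lemma all_flatten_nseq (P : pred nat) n u : all P u -> all P (flatten (nseq n u)).
Proof. by move=> h; elim: n => //= n IH; rewrite all_cat h. Qed.

Lemma all_sturm_word (P : pred nat) k : P a -> P b -> all P (m k).
Proof.
move=> Pa Pb; suff : all P (m k) && all P (m k.+1) by case/andP.
elim: k => [|k /andP[h1 h2]].
  rewrite /m /= Pb /= all_cat /= Pa /= andbT.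
  by rewrite all_nseq Pb orbT.
by rewrite h2 sturm_wordSS all_cat h1 andbT all_flatten_nseq.
Qed.

Lemma flatten_nseq_comm n (u : seq nat) :
  flatten (nseq n u) ++ u = u ++ flatten (nseq n u).
Proof. by elim: n => [|n IH] /=; rewrite ?cats0 // -catA IH. Qed.

(** By induction: m_{k+2} m_{k+1} and m_{k+1} m_{k+2} are m_{k+1}^s followed by
    m_k m_{k+1} and by m_{k+1} m_k. *)
Lemma sturm_word_swap k : exists v e f,
  [/\ m k.+1 ++ m k = v ++ [:: e; f], m k ++ m k.+1 = v ++ [:: f; e] &
      (e = a /\ f = b) \/ (e = b /\ f = a)].
Proof.
elim: k => [|k [v [e [f [E1 E2 ef]]]]].
  exists (nseq (s 1%N).-1 b), a, b; split; last by left.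
    by rewrite /m /= -catA.
  rewrite /m /= -cat1s; elim: (s 1%N).-1 => //= n IH; congr cons; exact: IH.
exists (flatten (nseq (s k.+2) (m k.+1)) ++ v), f, e; split; last by intuition.
- by rewrite sturm_wordSS -!catA E2.
- by rewrite sturm_wordSS catA -flatten_nseq_comm -!catA E1.
Qed.

Lemma sturm_word_prefix k l : (0 < k)%N -> (k <= l)%N -> prefix (m k) (m l).
Proof.
move=> k0 /subnK <-; elim: (l - k)%N => [|d IH]; first exact: prefix_refl.
apply: prefix_trans IH _; case: k k0 => // k _; rewrite !addnS addSn sturm_wordSS.
case: (s _) (@s_gt0 (d + k).+2 isT) => //= n _.
by rewrite -catA; exact: prefix_prefix.
Qed.

(** For m_1 m_0 and m_2 this can fail, which is why the sequences below start at m_1. *)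
Lemma sturm_word_prefix2 k : prefix (m k.+2 ++ m k.+1) (m k.+3).
Proof.
rewrite (sturm_wordSS k.+1).
have /prefixP [v] := @sturm_word_prefix k.+1 k.+2 isT (leqnSn _).
move: (m k.+2) (m k.+1) => x y xyv.
case: (s _) (@s_gt0 k.+3 isT) => // -[|n] _ /=; first by rewrite cats0 prefix_refl.
by rewrite {3}xyv -!catA; apply/prefixP; eexists; rewrite -!catA.
Qed.

Lemma size_sturm_word k : (k <= size (m k))%N.
Proof.
suff : (k < size (m k.+1))%N && (k <= size (m k))%N by case/andP.
elim: k => [|k /andP[h1 h2]]; first by rewrite /m /= size_cat addn1.
rewrite h1 andbT sturm_wordSS size_cat.
case: (s _) (@s_gt0 k.+2 isT) => //= n _; rewrite size_cat.
have : (0 < size (m k))%N.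
  by case: (k) h2 => [|k'] h2; [rewrite /m|apply: leq_trans h2].
by lia.
Qed.

Lemma nth_sturm_word k l i : (0 < k)%N -> (k <= l)%N -> (i < size (m k))%N ->
  nth 0%N (m l) i = nth 0%N (m k) i.
Proof.
by move=> k0 kl ik; have /prefixP [v ->] := sturm_word_prefix k0 kl;
  rewrite nth_cat ik.
Qed.

Lemma sturm_limitE k i : (0 < k)%N -> (i < size (m k))%N ->
  sturm_limit a b s i = nth 0%N (m k) i.
Proof.
move=> k0 ik; rewrite /sturm_limit; apply: lim_near_cst; first exact: discrete_hausdorff.
by exists k => // l /= kl; exact: nth_sturm_word.
Qed.

Lemma mkseq_sturm_limit k : (0 < k)%N ->
  mkseq (sturm_limit a b s) (size (m k)) = m k.
Proof.
move=> k0; apply: (@eq_from_nth _ 0%N); first by rewrite size_mkseq.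
by move=> i; rewrite size_mkseq => ik; rewrite nth_mkseq // (sturm_limitE k0).
Qed.

Lemma sturm_limit_letter (P : pred nat) i : P a -> P b -> P (sturm_limit a b s i).
Proof.
move=> Pa Pb; have hi := size_sturm_word i.+1; rewrite (@sturm_limitE i.+1) //.
by apply: all_nthP => //; exact: all_sturm_word.
Qed.

End SturmianWords.

(** * Integer polynomials *)

Section IntegerPolynomials.
Implicit Types Q A B W : {poly int}.

Lemma coef_height Q i : (`|(Q`_i)%R|%N <= poly_height Q)%N.
Proof.
case: (ltnP i (size Q)) => iQ; last by rewrite nth_default.
exact: (@leq_bigmax _ (fun j : 'I_(size Q) => `|(Q`_j)%R|%N) (Ordinal iQ)).
Qed.

Lemma height_gt0 Q : Q != 0 -> (0 < poly_height Q)%N.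
Proof.
move=> Q0; apply: leq_trans (coef_height Q (size Q).-1).
by rewrite absz_gt0 -lead_coefE lead_coef_eq0.
Qed.

Lemma cubic_neq0 Q : size Q = 4%N -> Q != 0.
Proof. by move=> sQ; rewrite -size_poly_gt0 sQ. Qed.

Definition quad (c0 c1 c2 : int) : {poly int} := c0%:P + c1%:P * 'X + c2%:P * 'X^2.

Lemma size_quad c0 c1 c2 : c2 != 0 -> size (quad c0 c1 c2) = 3%N.
Proof.
move=> c20; rewrite /quad addrC size_polyDl size_Cmul // size_polyXn //.
apply: (leq_ltn_trans (size_polyD _ _)); rewrite gtn_max ltnS.
rewrite (leq_trans (size_polyC_leq1 _)) //=.
apply: (leq_ltn_trans (size_polyMleq _ _)).
by rewrite size_polyX addn2 /= ltnS ltnS size_polyC_leq1.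
Qed.

Lemma cubicE Q : size Q = 4%N ->
  Q = (Q`_0)%:P + (Q`_1)%:P * 'X + (Q`_2)%:P * 'X^2 + (Q`_3)%:P * 'X^3.
Proof.
move=> sQ; apply/polyP => i; rewrite !coefD !coefCM !coefXn coefC coefX.
by case: i => [|[|[|[|i]]]] /=; rewrite ?mulr0 ?mulr1 ?addr0 ?add0r // nth_default ?sQ.
Qed.

(** Gauss' lemma: primitive parts are multiplicative, so an integer multiple of Q
    factors only if Q does. *)
Lemma irreducible_cubic_factor (Q A W : {poly int}) (d : int) : irreducible_cubic Q ->
  (1 < size W < 4)%N -> d != 0 -> d *: Q <> A * W.
Proof.
move=> [[Q0 _ irr] sQ] /andP[sW1 sW4] d0 E.
have sA : (1 < size A)%N.
  have W0 : W != 0 by rewrite -size_poly_gt0 (leq_trans _ sW1).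
  have A0 : A != 0.
    apply/eqP => A0; move/eqP: E; rewrite A0 mul0r scale_poly_eq0 (negbTE d0) /=.
    exact/negP.
  have : size (d *: Q) = size (A * W) by rewrite E.
  rewrite size_scale // sQ size_mul //; move: (size A) (size W) sW1 sW4 => m n; lia.
have E2 : Q = (zcontents Q *: zprimitive A) * zprimitive W.
  by rewrite -scalerAl -zprimitiveM -E zprimitiveZ // -zpolyEprim.
have [] := irr _ _ E2; rewrite poly_unitE => /andP[/eqP s1 _]; move: s1.
  by rewrite size_scale ?zcontents_eq0 // size_zprimitive => s1; rewrite s1 in sA.
by rewrite size_zprimitive => s1; rewrite s1 in sW1.
Qed.

End IntegerPolynomials.

Section Evaluation.
Variable R : realType.
Implicit Types (Q : {poly int}) (z : R).

Definition evalZ' Q z : R := evalZ Q^`() z.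

Lemma evalZ_cubic Q z : size Q = 4%N -> evalZ Q z =
  (Q`_0)%:~R + (Q`_1)%:~R * z + (Q`_2)%:~R * z ^+ 2 + (Q`_3)%:~R * z ^+ 3.
Proof.
move=> sQ; rewrite /evalZ {1}(cubicE sQ) !rmorphD !rmorphM /= ?map_polyXn ?map_polyX.
by rewrite !map_polyC !hornerE; ring.
Qed.

Lemma coef_height_real Q i : `|(Q`_i)%:~R : R| <= (poly_height Q)%:R.
Proof. by rewrite -intr_norm -abszE -pmulrn ler_nat coef_height. Qed.

End Evaluation.

(** * Cramer's rule for two quadratic polynomials *)

Section Determinants.

Definition det3 (S : comPzRingType) (a1 a2 a3 b1 b2 b3 c1 c2 c3 : S) : S :=
  a1 * (b2 * c3 - b3 * c2) - a2 * (b1 * c3 - b3 * c1) + a3 * (b1 * c2 - b2 * c1).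

Definition det4 (S : comPzRingType) (a0 a1 a2 a3 b0 b1 b2 b3 c0 c1 c2 c3 d0 d1 d2 d3 : S) : S :=
  a0 * det3 b1 b2 b3 c1 c2 c3 d1 d2 d3 - b0 * det3 a1 a2 a3 c1 c2 c3 d1 d2 d3 +
  c0 * det3 a1 a2 a3 b1 b2 b3 d1 d2 d3 - d0 * det3 a1 a2 a3 b1 b2 b3 c1 c2 c3.

(** The Sylvester determinant of w0 + w1 T + w2 T^2 and v0 + v1 T + v2 T^2. *)
Definition quad_res (S : comPzRingType) (w0 w1 w2 v0 v1 v2 : S) : S :=
  det4 w0 w1 w2 0 0 w0 w1 w2 v0 v1 v2 0 0 v0 v1 v2.

Lemma det3_norm (R : realType) (a1 a2 a3 b1 b2 b3 c1 c2 c3 p q r : R) :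
  `|a1| <= p -> `|a2| <= p -> `|a3| <= p ->
  `|b1| <= q -> `|b2| <= q -> `|b3| <= q ->
  `|c1| <= r -> `|c2| <= r -> `|c3| <= r ->
  `|det3 a1 a2 a3 b1 b2 b3 c1 c2 c3| <= 6 * (p * q * r).
Proof.
move=> A1 A2 A3 B1 B2 B3 C1 C2 C3.
have T (x y z : R) : `|x| <= p -> `|y| <= q -> `|z| <= r ->
    - (p * q * r) <= x * y * z <= p * q * r.
  by move=> X Y Z; rewrite -ler_norml !normrM !ler_pM // mulr_ge0.
have := T _ _ _ A1 B2 C3; have := T _ _ _ A1 B3 C2; have := T _ _ _ A2 B1 C3.
have := T _ _ _ A2 B3 C1; have := T _ _ _ A3 B1 C2; have := T _ _ _ A3 B2 C1.
move=> /andP[? ?] /andP[? ?] /andP[? ?] /andP[? ?] /andP[? ?] /andP[? ?].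
by rewrite /det3 ler_norml; apply/andP; split; lra.
Qed.

Lemma det4_norm (R : realType) (a0 a1 a2 a3 b0 b1 b2 b3 c0 c1 c2 c3 d0 d1 d2 d3
    p q r s : R) :
  [&& `|a1| <= p, `|a2| <= p & `|a3| <= p] ->
  [&& `|b1| <= q, `|b2| <= q & `|b3| <= q] ->
  [&& `|c1| <= r, `|c2| <= r & `|c3| <= r] ->
  [&& `|d1| <= s, `|d2| <= s & `|d3| <= s] ->
  `|det4 a0 a1 a2 a3 b0 b1 b2 b3 c0 c1 c2 c3 d0 d1 d2 d3| <=
  6 * (`|a0| * (q * r * s) + `|b0| * (p * r * s) + `|c0| * (p * q * s) +
       `|d0| * (p * q * r)).
Proof.
move=> /and3P[A1 A2 A3] /and3P[B1 B2 B3] /and3P[C1 C2 C3] /and3P[D1 D2 D3].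
have T (x y e : R) : `|y| <= 6 * e -> `|x * y| <= 6 * (`|x| * e).
  by move=> h; rewrite normrM mulrCA; apply: ler_wpM2l.
have h1 := T a0 _ _ (det3_norm B1 B2 B3 C1 C2 C3 D1 D2 D3).
have h2 := T b0 _ _ (det3_norm A1 A2 A3 C1 C2 C3 D1 D2 D3).
have h3 := T c0 _ _ (det3_norm A1 A2 A3 B1 B2 B3 D1 D2 D3).
have h4 := T d0 _ _ (det3_norm A1 A2 A3 B1 B2 B3 C1 C2 C3).
rewrite /det4; move: h1 h2 h3 h4; set x1 := a0 * _; set x2 := b0 * _.
set x3 := c0 * _; set x4 := d0 * _ => h1 h2 h3 h4.
have n1 := ler_normB (x1 - x2 + x3) x4; have n2 := ler_normD (x1 - x2) x3.
have n3 := ler_normB x1 x2; lra.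
Qed.

Variables (w0 w1 w2 v0 v1 v2 q0 q1 q2 q3 : int).

(** The unknowns of res * Q = (cA0 + cA1 T) W + (cB0 + cB1 T) V, obtained by
    putting Q in place of one row of the Sylvester matrix. *)
Definition cA0 := det4 q0 q1 q2 q3 0 w0 w1 w2 v0 v1 v2 0 0 v0 v1 v2.
Definition cA1 := det4 w0 w1 w2 0 q0 q1 q2 q3 v0 v1 v2 0 0 v0 v1 v2.
Definition cB0 := det4 w0 w1 w2 0 0 w0 w1 w2 q0 q1 q2 q3 0 v0 v1 v2.
Definition cB1 := det4 w0 w1 w2 0 0 w0 w1 w2 v0 v1 v2 0 q0 q1 q2 q3.

Lemma cramer_quad :
  (quad_res w0 w1 w2 v0 v1 v2)%:P *
    (q0%:P + q1%:P * 'X + q2%:P * 'X^2 + q3%:P * 'X^3) =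
  (cA0%:P + cA1%:P * 'X) * quad w0 w1 w2 + (cB0%:P + cB1%:P * 'X) * quad v0 v1 v2.
Proof. by rewrite /quad_res /cA0 /cA1 /cB0 /cB1 /det4 /det3 /quad; ring. Qed.

Section Taylor.
Variables (R : realType) (z : R).

Let w := w0%:~R + w1%:~R * z + w2%:~R * z ^+ 2.
Let w' := w1%:~R + 2 * w2%:~R * z.
Let v := v0%:~R + v1%:~R * z + v2%:~R * z ^+ 2.
Let v' := v1%:~R + 2 * v2%:~R * z.
Let q := q0%:~R + q1%:~R * z + q2%:~R * z ^+ 2 + q3%:~R * z ^+ 3.
Let q' := q1%:~R + 2 * q2%:~R * z + 3 * q3%:~R * z ^+ 2.
Let q'' := q2%:~R + 3 * q3%:~R * z.
Let w'' : R := w2%:~R.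
Let v'' : R := v2%:~R.
Let q''' : R := q3%:~R.

(** Replacing T by T - z is unimodular, so the minors may be computed from the
    Taylor coefficients at z.  There the first column consists of the small
    values of the polynomials at z. *)
Lemma cB1_taylor : cB1%:~R = det4 w w' w'' 0 0 w w' w'' v v' v'' 0 q q' q'' q'''.
Proof. by rewrite /cB1 /det4 /det3 /w /w' /v /v' /q /q' /q'' /w'' /v'' /q'''; ring. Qed.

Lemma cB0_taylor : cB0%:~R + z * cB1%:~R =
  det4 w w' w'' 0 0 w w' w'' q q' q'' q''' 0 v v' v''.
Proof. by rewrite /cB0 /cB1 /det4 /det3 /w /w' /v /v' /q /q' /q'' /w'' /v'' /q'''; ring. Qed.

Lemma cA1_taylor : cA1%:~R = det4 w w' w'' 0 q q' q'' q''' v v' v'' 0 0 v v' v''.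
Proof. by rewrite /cA1 /det4 /det3 /w /w' /v /v' /q /q' /q'' /w'' /v'' /q'''; ring. Qed.

Lemma cA0_taylor : cA0%:~R + z * cA1%:~R =
  det4 q q' q'' q''' 0 w w' w'' v v' v'' 0 0 v v' v''.
Proof. by rewrite /cA0 /cA1 /det4 /det3 /w /w' /v /v' /q /q' /q'' /w'' /v'' /q'''; ring. Qed.

End Taylor.
End Determinants.

(** * Cubics in the lattices spanned by consecutive quadratics *)

(** Abstracts from the Sturmian origin of the quadratics W_n = w0 n + w1 n T + w2 n T^2:
    X n measures the size of W_n and rho is, up to sign, the resultant of two
    consecutive ones. *)
Record quad_chain (R : realType) (z C : R) (X : nat -> R) (w0 w1 w2 : nat -> int)
    (rho : int) : Prop := QuadChain {
  qc_z : 0 <= z <= 1;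
  qc_C : 1 <= C;
  qc_X1 : forall n, 1 <= X n;
  qc_Xmono : forall n, X n <= X n.+1;
  qc_Xgap : forall B : R, exists N, forall n, (N <= n)%N -> B * X n <= X n.+1;
  qc_coef : forall n, [/\ `|(w0 n)%:~R| <= C * X n, `|(w1 n)%:~R| <= C * X n &
                        `|(w2 n)%:~R| <= C * X n];
  qc_lead : forall n, w2 n != 0;
  qc_small : forall n, X n * X n.+1 ^+ 2 *
     `|(w0 n)%:~R + (w1 n)%:~R * z + (w2 n)%:~R * z ^+ 2| <= C;
  qc_deriv : forall n, X n <= C * `|(w1 n)%:~R + 2 * (w2 n)%:~R * z|;
  qc_rho : rho != 0;
  qc_res : forall n,
     quad_res (w0 n) (w1 n) (w2 n) (w0 n.+1) (w1 n.+1) (w2 n.+1) ^+ 2 = rho ^+ 2 }.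

Section Chain.
Variables (R : realType) (z C : R) (X : nat -> R) (w0 w1 w2 : nat -> int) (rho : int).
Hypothesis chain : quad_chain z C X w0 w1 w2 rho.

Let X0 n : 0 < X n. Proof. exact: lt_le_trans ltr01 (qc_X1 chain n). Qed.
Let C0 : 0 < C. Proof. exact: lt_le_trans ltr01 (qc_C chain). Qed.

Let W n : R := (w0 n)%:~R + (w1 n)%:~R * z + (w2 n)%:~R * z ^+ 2.
Let W' n : R := (w1 n)%:~R + 2 * (w2 n)%:~R * z.

Lemma chain_X_unbounded (B : R) : exists N, forall n, (N <= n)%N -> B <= X n.
Proof.
have [N hN] := qc_Xgap chain `|B|; exists N.+1 => -[//|n] /hN h.
apply: le_trans (ler_norm B) (le_trans _ h).
by rewrite ler_peMr // (qc_X1 chain).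
Qed.

Let row_le n : [&& `|W n| <= 3 * C * X n, `|W' n| <= 3 * C * X n &
                `|(w2 n)%:~R : R| <= 3 * C * X n].
Proof.
case: (qc_coef chain n) => h0 h1 h2; case/andP: (qc_z chain) => z0 z1.
have CX : 0 <= C * X n by rewrite mulr_ge0 // ltW.
have zz : `|z| <= 1 by rewrite ger0_norm.
have zz2 : `|z ^+ 2| <= 1 by rewrite normrX expr_le1.
have B (x : R) : `|x * z| <= `|x| by rewrite normrM ler_piMr.
have B2 (x : R) : `|x * z ^+ 2| <= `|x| by rewrite normrM ler_piMr.
apply/and3P; split; last by lra.
  have := ler_normD ((w0 n)%:~R + (w1 n)%:~R * z) ((w2 n)%:~R * z ^+ 2).
  have := ler_normD (w0 n)%:~R ((w1 n)%:~R * z).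
  by rewrite -/(W n); have := B (w1 n)%:~R; have := B2 (w2 n)%:~R; lra.
have := ler_normD (w1 n)%:~R (2 * (w2 n)%:~R * z); rewrite -/(W' n).
by have := B (2 * (w2 n)%:~R); rewrite [`|2 * _| in leRHS]normrM normr_nat; lra.
Qed.

Section OneCubic.
Variable Q : {poly int}.
Hypothesis sQ : size Q = 4%N.
Let H : R := (poly_height Q)%:R.
Let q : R := evalZ Q z.
Let q' : R := (Q`_1)%:~R + 2 * (Q`_2)%:~R * z + 3 * (Q`_3)%:~R * z ^+ 2.
Let q'' : R := (Q`_2)%:~R + 3 * (Q`_3)%:~R * z.

Let rowQ_le : [&& `|q'| <= 6 * H, `|q''| <= 6 * H & `|(Q`_3)%:~R : R| <= 6 * H].
Proof.
case/andP: (qc_z chain) => z0 z1.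
have h1 := coef_height_real R Q 1; have h2 := coef_height_real R Q 2.
have h3 := coef_height_real R Q 3; rewrite -/H in h1 h2 h3.
have n1 := normr_ge0 ((Q`_1)%:~R : R); have n2 := normr_ge0 ((Q`_2)%:~R : R).
have n3 := normr_ge0 ((Q`_3)%:~R : R).
have zz : `|z| <= 1 by rewrite ger0_norm.
have zz2 : `|z ^+ 2| <= 1 by rewrite normrX expr_le1.
have B (x : R) : `|x * z| <= `|x| by rewrite normrM ler_piMr.
have B2 (x : R) : `|x * z ^+ 2| <= `|x| by rewrite normrM ler_piMr.
apply/and3P; split; last by lra.
  have := ler_normD ((Q`_1)%:~R + 2 * (Q`_2)%:~R * z) (3 * (Q`_3)%:~R * z ^+ 2).
  have := ler_normD (Q`_1)%:~R (2 * (Q`_2)%:~R * z); rewrite -/q'.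
  have := B (2 * (Q`_2)%:~R); rewrite [`|2 * _| in leRHS]normrM normr_nat.
  by have := B2 (3 * (Q`_3)%:~R); rewrite [`|3 * _| in leRHS]normrM normr_nat; lra.
have := ler_normD (Q`_2)%:~R (3 * (Q`_3)%:~R * z); rewrite -/q''.
by have := B (3 * (Q`_3)%:~R); rewrite [`|3 * _| in leRHS]normrM normr_nat; lra.
Qed.

Variable n : nat.
Let a0 := cA0 (w0 n) (w1 n) (w2 n) (w0 n.+1) (w1 n.+1) (w2 n.+1) Q`_0 Q`_1 Q`_2 Q`_3.
Let a1 := cA1 (w0 n) (w1 n) (w2 n) (w0 n.+1) (w1 n.+1) (w2 n.+1) Q`_0 Q`_1 Q`_2 Q`_3.
Let b0 := cB0 (w0 n) (w1 n) (w2 n) (w0 n.+1) (w1 n.+1) (w2 n.+1) Q`_0 Q`_1 Q`_2 Q`_3.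
Let b1 := cB1 (w0 n) (w1 n) (w2 n) (w0 n.+1) (w1 n.+1) (w2 n.+1) Q`_0 Q`_1 Q`_2 Q`_3.
(** 648 = 6 * (54 + 54): six terms of a determinant of order 3, and 54 = 3 * 3 * 6
    from the bounds of two rows by 3 C X and of one row by 6 H. *)
Let E := 648 * C ^+ 3.

Let D n := `|q| * X n ^+ 2 * X n.+1 ^+ 2.

(** Expansion along the first column of the Taylor determinants: W_n(z) and
    W_{n+1}(z) contribute the multiples of H, and Q(z) those of D. *)
Lemma chain_cofactors :
  [/\ X n.+1 * `|b1%:~R| <= E * (H + D n),
      X n.+1 * `|b0%:~R + z * b1%:~R| <= E * (H + D n),
      X n * `|a1%:~R| <= E * (H + D n) &
      X n.+2 ^+ 2 * `|a0%:~R + z * a1%:~R| <= E * X n * (H + D n.+1)].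
Proof.
have H0 : 0 <= H by rewrite ler0n.
have [x0 y0 u0] : [/\ 0 < X n, 0 < X n.+1 & 0 < X n.+2] by split.
have xy := qc_Xmono chain n; have yu := qc_Xmono chain n.+1.
have /and3P[r1 r2 r3] := row_le n; have /and3P[s1 s2 s3] := row_le n.+1.
have /and3P[t1 t2 t3] := rowQ_le.
have := qc_small chain n; have := qc_small chain n.+1; rewrite -!/(W _).
rewrite /D /E; move: x0 y0 u0 xy yu r1 r2 r3 s1 s2 s3.
rewrite cB0_taylor cA0_taylor (@cB1_taylor _ _ _ _ _ _ _ _ _ _ R z)
  (@cA1_taylor _ _ _ _ _ _ _ _ _ _ R z) -(evalZ_cubic _ sQ) -/q -/q' -/q''
  -!/(W _) -!/(W' _).
set x := X n; set y := X n.+1; set u := X n.+2; set o := W n; set o' := W n.+1.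
move=> x0 y0 u0 xy yu r1 r2 r3 s1 s2 s3 S2 S1.
have rP : 0 <= 3 * C * x by rewrite !mulr_ge0 // ltW.
have sP : 0 <= 3 * C * y by rewrite !mulr_ge0 // ltW.
have o0 := normr_ge0 o; have o'0 := normr_ge0 o'; have q0 := normr_ge0 q.
have C2 : 0 <= C ^+ 2 * H by rewrite mulr_ge0 // exprn_ge0 // ltW.
have S2' : x ^+ 2 * y * `|o'| <= C.
  apply: le_trans S2; apply: ler_wpM2r => //; rewrite mulrC; apply: ler_wpM2l; first exact: ltW.
  by rewrite !expr2; apply: ler_pM; rewrite ?(ltW x0) // (le_trans xy).
have T1 : 0 <= C ^+ 2 * H * (C - x * y ^+ 2 * `|o|) by rewrite mulr_ge0 // subr_ge0.
have T2 : 0 <= C ^+ 2 * H * (C - x ^+ 2 * y * `|o'|) by rewrite mulr_ge0 // subr_ge0.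
have T3 : 0 <= C ^+ 2 * H * (C - y * u ^+ 2 * `|o'|) by rewrite mulr_ge0 // subr_ge0.
have T4 : 0 <= C ^+ 3 * (`|q| * x ^+ 2 * y ^+ 2).
  by rewrite !mulr_ge0 // ?exprn_ge0 // ltW.
have T5 : 0 <= x * (C ^+ 3 * (`|q| * y ^+ 2 * u ^+ 2)).
  by rewrite !mulr_ge0 // ?exprn_ge0 // ltW.
have T6 : 0 <= x * (C ^+ 2 * H * (C - y * u ^+ 2 * `|o'|)) by rewrite mulr_ge0 // ltW.
have T7 : 0 <= C ^+ 2 * H * C by rewrite mulr_ge0 // ltW.
have T8 : 0 <= x * (C ^+ 2 * H * C) by rewrite mulr_ge0 // ltW.
split.
- rewrite mulrC -ler_pdivlMr //.
  apply: (le_trans (det4_norm (p := 3 * C * x) (q := 3 * C * x) (r := 3 * C * y) (s := 6 * H) _ _ _ _ _ _ _ _)).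
  all: rewrite ?normr0 ?r1 ?r2 ?r3 ?s1 ?s2 ?s3 ?t1 ?t2 ?t3 ?rP ?sP //.
  rewrite ler_pdivlMr //; lra.
- rewrite mulrC -ler_pdivlMr //.
  apply: (le_trans (det4_norm (p := 3 * C * x) (q := 3 * C * x) (r := 6 * H) (s := 3 * C * y) _ _ _ _ _ _ _ _)).
  all: rewrite ?normr0 ?r1 ?r2 ?r3 ?s1 ?s2 ?s3 ?t1 ?t2 ?t3 ?rP ?sP //.
  rewrite ler_pdivlMr //; lra.
- rewrite mulrC -ler_pdivlMr //.
  apply: (le_trans (det4_norm (p := 3 * C * x) (q := 6 * H) (r := 3 * C * y) (s := 3 * C * y) _ _ _ _ _ _ _ _)).
  all: rewrite ?normr0 ?r1 ?r2 ?r3 ?s1 ?s2 ?s3 ?t1 ?t2 ?t3 ?rP ?sP //.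
  rewrite ler_pdivlMr //; lra.
- rewrite mulrC -ler_pdivlMr ?exprn_gt0 //.
  apply: (le_trans (det4_norm (p := 6 * H) (q := 3 * C * x) (r := 3 * C * y) (s := 3 * C * y) _ _ _ _ _ _ _ _)).
  all: rewrite ?normr0 ?r1 ?r2 ?r3 ?s1 ?s2 ?s3 ?t1 ?t2 ?t3 ?rP ?sP //.
  rewrite ler_pdivlMr ?exprn_gt0 //; lra.
Qed.

Hypothesis irrQ : irreducible_cubic Q.

(** Otherwise a multiple of Q would be divisible by one of the two quadratics. *)
Lemma chain_cofactors_neq0 :
  ((a0 != 0) || (a1 != 0)) /\ ((b0 != 0) || (b1 != 0)).
Proof.
have := cramer_quad (w0 n) (w1 n) (w2 n) (w0 n.+1) (w1 n.+1) (w2 n.+1) Q`_0 Q`_1 Q`_2 Q`_3.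
rewrite -(cubicE sQ) -/a0 -/a1 -/b0 -/b1 mul_polyC.
have rn0 : quad_res (w0 n) (w1 n) (w2 n) (w0 n.+1) (w1 n.+1) (w2 n.+1) != 0.
  by rewrite -sqrf_eq0 (qc_res chain) sqrf_eq0 (qc_rho chain).
move=> Eq; split; rewrite -negb_and; apply/negP => /andP[/eqP e0 /eqP e1]; move: Eq;
  rewrite e0 e1 mul0r addr0 mul0r ?addr0 ?add0r;
  by apply: irreducible_cubic_factor => //; rewrite size_quad // (qc_lead chain).
Qed.

End OneCubic.

(** B is a nonzero pair of integers, so one of its two bounds is at least 1. *)
Lemma chain_dichotomy Q n E : irreducible_cubic Q -> E = 648 * C ^+ 3 ->
  X n.+1 <= E * ((poly_height Q)%:R + `|evalZ Q z| * X n ^+ 2 * X n.+1 ^+ 2).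
Proof.
move=> /[dup] irr [_ sQ] ->.
have [h1 h2 _ _] := chain_cofactors sQ n.
have [_] := chain_cofactors_neq0 sQ n irr.
have [b10|/(norm_int_ge1 R) b1 _] := eqVneq (cB1 _ _ _ _ _ _ _ _ _ _) 0.
  rewrite orbF => /(norm_int_ge1 R) b0; apply: le_trans h2.
  by rewrite b10 mulr0 addr0 ler_peMr // ltW.
by apply: le_trans h1; rewrite ler_peMr // ltW.
Qed.

End Chain.

(** * Lower bounds for irreducible cubics *)

Section ChainLower.
Variables (R : realType) (z C : R) (X : nat -> R) (w0 w1 w2 : nat -> int) (rho : int).
Hypothesis chain : quad_chain z C X w0 w1 w2 rho.

Let X0 n : 0 < X n. Proof. exact: lt_le_trans ltr01 (qc_X1 chain n). Qed.

Lemma chain_lower_uniform : exists2 c : R, 0 < c &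
  forall Q n, irreducible_cubic Q -> (poly_height Q)%:R < c * X n.+1 ->
    c <= `|evalZ Q z| * X n ^+ 2 * X n.+1.
Proof.
have [E [ED E0]] : exists E : R, E = 648 * C ^+ 3 /\ 0 < E.
  exists (648 * C ^+ 3); split; first by [].
  by rewrite mulr_gt0 ?ltr0n // exprn_gt0 // (lt_le_trans ltr01 (qc_C chain)).
exists (2 * E)^-1; first by rewrite invr_gt0 mulr_gt0.
move=> Q n /(chain_dichotomy chain n)/(_ ED); set H : R := (poly_height Q)%:R; set d := `|_| => h.
rewrite mulrC ltr_pdivlMr ?mulr_gt0 // => h2.
rewrite -[leLHS]mul1r ler_pdivrMr ?mulr_gt0 //.
have y0 := X0 n.+1; rewrite -(ler_pM2r y0); lra.
Qed.

Variables (c0 : R).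
Hypothesis c0_gt0 : 0 < c0.
Hypothesis z_bad : forall (p q : int) (H : R), (p != 0) || (q != 0) ->
    `|p%:~R| <= H -> `|q%:~R| <= H -> c0 <= H * `|p%:~R + q%:~R * z|.

(** Take n such that D n <= H < D n.+1.  Then B != 0 forces X n.+1 << H, and
    |A(z)| is at most a multiple of |Q(z)| X n X n.+1 ^ 2, while it is at least a
    multiple of X n / H because z is badly approximable. *)
Lemma chain_lower_cubic : exists2 c : R, 0 < c &
  forall Q, irreducible_cubic Q -> c <= `|evalZ Q z| * (poly_height Q)%:R ^+ 3.
Proof.
have [E [ED E0]] : exists E : R, E = 648 * C ^+ 3 /\ 0 < E.
  exists (648 * C ^+ 3); split; first by [].
  by rewrite mulr_gt0 ?ltr0n // exprn_gt0 // (lt_le_trans ltr01 (qc_C chain)).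
(* the first term serves for D 0 > H, when |Q(z)| is not even small *)
exists (Num.min (X 0 ^+ 2 * X 1 ^+ 2)^-1 (c0 / (32 * E ^+ 4))).
  by rewrite lt_min invr_gt0 divr_gt0 ?mulr_gt0 ?exprn_gt0.
move=> Q /[dup] irr [_ sQ]; set H : R := (poly_height Q)%:R; set d := `|_|.
have H1 : 1 <= H by rewrite /H (ler1n R); exact/height_gt0/cubic_neq0.
pose D n := d * X n ^+ 2 * X n.+1 ^+ 2.
have d0 : 0 < d.
  rewrite lt0r normr_ge0 andbT; apply/eqP => d0.
  have [N hN] := chain_X_unbounded chain (2 * E * H).
  have := chain_dichotomy chain N irr ED; rewrite -/d -/H d0 !mul0r addr0.
  have := hN N.+1 (leqnSn _); have : 0 < E * H by rewrite mulr_gt0 //; lra.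
  lra.
rewrite ge_min; have [D0|D0] := leP (D 0%N) H; last first.
  apply/orP; left; rewrite -[leLHS]mul1r ler_pdivrMr ?mulr_gt0 ?exprn_gt0 //.
  have h : 1 <= H * H ^+ 2 * H.
    by rewrite expr2 -!mulrA !mulr_ege1.
  rewrite (_ : d * H ^+ 3 * _ = H ^+ 3 * D 0%N); last by rewrite /D; ring.
  apply: le_trans h _; rewrite (_ : H * H ^+ 2 * H = H ^+ 3 * H); last by ring.
  by apply: ler_wpM2l; [rewrite exprn_ge0 //; lra|exact: ltW].
apply/orP; right.
have [n [Dn Dn1]] : exists n, D n <= H /\ H < D n.+1.
  have ex : exists n, H < D n.
    have [N hN] := chain_X_unbounded chain (1 + H / d); exists N.
    have hN1 := hN N (leqnn _); have hN2 := qc_X1 chain N.+1; have := X0 N.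
    rewrite /D -mulrA => hN0.
    have : 1 + H / d <= X N ^+ 2 * X N.+1 ^+ 2.
      apply: le_trans hN1 _; rewrite !expr2 -!mulrA ler_peMr //; first exact: ltW.
      by rewrite !mulr_ege1 // (qc_X1 chain).
    rewrite -(ler_pM2l d0) mulrDr mulrCA divff ?lt0r_neq0 //; lra.
  case: (ex_minnP ex) => -[|n] hn nmin; first by move: hn; rewrite ltNge D0.
  by exists n; split => //; rewrite leNgt; apply/negP => /nmin; rewrite ltnn.
have XH : X n.+1 <= 2 * E * H.
  apply: le_trans (chain_dichotomy chain n irr ED) _; rewrite -/d -/H -/(D n).
  have : E * D n <= E * H by rewrite ler_pM2l.
  lra.
have [_ _ h1 h0] := chain_cofactors chain sQ n; have [a01 _] := chain_cofactors_neq0 chain sQ n irr.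
move: h1 h0 a01; rewrite -/d -/H -/(D n) -/(D n.+1) -ED.
set a1 := cA1 _ _ _ _ _ _ _ _ _ _; set a0 := cA0 _ _ _ _ _ _ _ _ _ _ => h1 h0 a01.
have [x0 y0 u0] : [/\ 0 < X n, 0 < X n.+1 & 0 < X n.+2] by split.
have g1 : `|a1%:~R| <= 2 * E * H / X n.
  rewrite ler_pdivlMr // mulrC; apply: le_trans h1 _.
  have : E * D n <= E * H by rewrite ler_pM2l.
  lra.
have g0 : `|a0%:~R + z * a1%:~R| <= 2 * E * (d * X n * X n.+1 ^+ 2).
  have u20 : 0 < X n.+2 ^+ 2 by rewrite exprn_gt0.
  rewrite -(ler_pM2l u20); apply: le_trans h0 _.
  rewrite (_ : X n.+2 ^+ 2 * _ = 2 * (E * X n * D n.+1)); last by rewrite /D; ring.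
  have : E * X n * H <= E * X n * D n.+1 by rewrite ler_pM2l ?mulr_gt0 // ltW.
  lra.
have g0' : `|a0%:~R + z * a1%:~R| <= 2 * E * H / X n.
  apply: le_trans g0 _; rewrite ler_pdivlMr //.
  rewrite (_ : _ * X n = 2 * E * D n); last by rewrite /D; ring.
  by rewrite ler_pM2l // mulr_gt0.
case/andP: (qc_z chain) => z0 z1.
have k0 : `|a0%:~R : R| <= 4 * E * H / X n.
  have -> : a0%:~R = a0%:~R + z * a1%:~R - z * a1%:~R :> R by ring.
  have := ler_normB (a0%:~R + z * a1%:~R) (z * a1%:~R).
  have : `|z * a1%:~R| <= `|a1%:~R : R| by rewrite normrM ger0_norm // ler_piMl.
  lra.
have k1 : `|a1%:~R : R| <= 4 * E * H / X n.
  apply: le_trans g1 _; rewrite ler_pM2r ?invr_gt0 // ler_pM2r ?ler_pM2r //; lra.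
have := z_bad a01 k0 k1; rewrite [a1%:~R * z]mulrC => hbad.
rewrite ler_pdivrMr; last by rewrite mulr_gt0 // exprn_gt0.
apply: le_trans hbad _.
have : 4 * E * H / X n * `|a0%:~R + z * a1%:~R| <=
       4 * E * H / X n * (2 * E * (d * X n * X n.+1 ^+ 2)).
  by apply: ler_wpM2l => //; rewrite !mulr_ge0 ?invr_ge0 ?ltW //; lra.
move=> h; apply: le_trans h _.
rewrite (_ : _ / _ * _ = 8 * E ^+ 2 * H * d * X n.+1 ^+ 2); last first.
  by field; rewrite lt0r_neq0.
have : 8 * E ^+ 2 * H * d * X n.+1 ^+ 2 <= 8 * E ^+ 2 * H * d * (2 * E * H) ^+ 2.
  apply: ler_wpM2l; first by rewrite !mulr_ge0 ?exprn_ge0 ?ltW //; lra.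
  by rewrite ler_pXn2r ?nnegrE ?mulr_ge0 // ?ltW //; lra.
move=> h; apply: le_trans h _.
by rewrite le_eqVlt; apply/orP; left; apply/eqP; ring.
Qed.

End ChainLower.

(** * Cubics that are irreducible modulo a prime *)

Section CubicsModp.

(** x^3 - x takes the value 0 twice, hence misses some residue modulo p. *)
Lemma exists_rootless_cubic (p : nat) : prime p ->
  exists e : int, forall n : int, ~~ (p %| n ^+ 3 - n - e)%Z.
Proof.
move=> pr_p; have chp := pchar_Fp pr_p.
pose f (x : 'F_p) : 'F_p := x ^+ 3 - x.
have [y yf] : exists y, y \notin codom f.
  apply/existsP; rewrite -negb_forall; apply/negP => /forallP onto.
  have card_f : #|codom f| = #|'F_p| by apply: eq_card => y; rewrite onto.
  have /image_injP inj : #|fintype.image f 'F_p| == #|'F_p| by rewrite -[X in _ == X]card_f.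
  have := inj 0 1 isT isT; rewrite /f expr1n expr0n !subrr => /(_ erefl) /eqP.
  by rewrite eq_sym oner_eq0.
exists (val y)%:Z => n; apply/negP; rewrite (dvdz_pcharf chp) !rmorphB rmorphXn /=.
rewrite -[Posz _]/((y : nat)%:Z) -pmulrn natr_Zp subr_eq0 => /eqP E.
by move/negP: yf; apply; rewrite -E; exact: codom_f.
Qed.

Lemma dvdz_root_linear (p : nat) (a0 a1 : int) : prime p -> ~~ (p %| a1)%Z ->
  exists n : int, (p %| a0 + a1 * n)%Z.
Proof.
move=> pr_p a1p; have cop : coprimez a1 p.
  by rewrite coprimez_sym /coprimez /gcdz /= -prime_coprime in a1p *.
case/coprimezP: cop => -[u v] /= E.
exists (- a0 * u); rewrite (_ : _ + _ = p%:Z * (a0 * v)) ?dvdz_mulr //.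
transitivity (a0 * (u * a1 + v * p%:Z) - a0 * u * a1); last by ring.
by rewrite E; ring.
Qed.

Lemma unit_contents1 (A : {poly int}) : size A = 1%N -> zcontents A \is a GRing.unit ->
  A \is a GRing.unit.
Proof.
move=> /eqP/size_poly1P [c c0 ->].
rewrite -[c%:P]alg_polyC zcontentsZ (zcontents_monic (monic1 _)) mulr1 => cU.
by rewrite alg_polyC poly_unitE size_polyC c0 coefC eqxx cU.
Qed.

(** A proper factorization contains a linear factor whose leading coefficient is
    prime to p, and such a factor has a root modulo p. *)
Lemma rootless_modp_irreducible (p : nat) (Q : {poly int}) : prime p ->
  size Q = 4%N -> zcontents Q = 1 -> ~~ (p %| Q`_3)%Z ->
  (forall n, ~~ (p %| Q.[n])%Z) -> irreducible_cubic Q.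
Proof.
move=> pr_p sQ cQ Q3 Qn.
have half (A B : {poly int}) : Q = A * B -> (size A <= size B)%N -> A \is a GRing.unit.
  move=> E sAB.
  have A0 : A != 0 by apply: contraTneq (cubic_neq0 sQ) => A0; rewrite E A0 mul0r eqxx.
  have B0 : B != 0 by apply: contraTneq (cubic_neq0 sQ) => B0; rewrite E B0 mulr0 eqxx.
  have sE : (size A + size B).-1 = 4%N by rewrite -size_mul // -E.
  have : size A = 1%N \/ size A = 2%N.
    move: A0; rewrite -size_poly_gt0; move: (size A) (size B) sE sAB => m n; lia.
  case=> sA.
    by apply: unit_contents1 => //; apply/unitrPr; exists (zcontents B); rewrite -zcontentsM -E.
  have lE : Q`_3 = A`_1 * lead_coef B.
    by have := lead_coefM A B; rewrite -E !lead_coefE sQ sA.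
  have a1p : ~~ (p %| A`_1)%Z by apply: contra Q3 => h; rewrite lE dvdz_mulr.
  have [n hn] := dvdz_root_linear A`_0 pr_p a1p.
  have := Qn n; rewrite E hornerM dvdz_mulr //.
  by rewrite horner_coef sA big_ord_recl big_ord1 /= expr0 mulr1 expr1.
split=> //; split; first exact: cubic_neq0.
  by rewrite poly_unitE sQ.
move=> A B E; case: (leqP (size A) (size B)) => [|/ltnW] h; first by left; exact: half E h.
by right; apply: half h; rewrite mulrC.
Qed.

End CubicsModp.

Section Combination.

Definition cubic_poly (c0 c1 c2 c3 : int) : {poly int} :=
  c0%:P + c1%:P * 'X + c2%:P * 'X^2 + c3%:P * 'X^3.

Lemma coef_cubic_poly c0 c1 c2 c3 :
  ((cubic_poly c0 c1 c2 c3)`_0 = c0) * ((cubic_poly c0 c1 c2 c3)`_1 = c1) *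
  ((cubic_poly c0 c1 c2 c3)`_2 = c2) * ((cubic_poly c0 c1 c2 c3)`_3 = c3).
Proof.
by rewrite /cubic_poly !coefD !coefCM !coefXn !coefC !coefX /= ?mulr0 ?mulr1 ?addr0 ?add0r.
Qed.

Lemma size_cubic_poly c0 c1 c2 c3 : c3 != 0 -> size (cubic_poly c0 c1 c2 c3) = 4%N.
Proof.
move=> c30; apply/anti_leq/andP; split; last first.
  by rewrite ltnNge; apply: contra c30 => /leq_sizeP/(_ 3%N (leqnn _)); rewrite coef_cubic_poly => ->.
apply/leq_sizeP => -[|[|[|[|i]]]] // _.
by rewrite /cubic_poly !coefD !coefCM !coefXn !coefC !coefX /= ?mulr0 ?addr0.
Qed.

Lemma horner_cubic_poly c0 c1 c2 c3 n :
  (cubic_poly c0 c1 c2 c3).[n] = c0 + c1 * n + c2 * n ^+ 2 + c3 * n ^+ 3.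
Proof. by rewrite /cubic_poly !hornerE. Qed.

Lemma dvdz_prime_mul (p : nat) (x y : int) : prime p ->
  (p %| x * y)%Z = (p %| x)%Z || (p %| y)%Z.
Proof. by move=> pr_p; rewrite !dvdzE abszM Euclid_dvdM. Qed.

Variables (p : nat) (w0 w1 w2 v0 v1 v2 p0 q0 p1 q1 t : int).
Hypothesis pr_p : prime p.
Hypothesis res_p : ~~ (p %| quad_res w0 w1 w2 v0 v1 v2)%Z.
Hypothesis unimod : (p0 * q1 - p1 * q0) ^+ 2 = 1.

Definition combination (u v b0 b1 : int) : {poly int} :=
  let a0 := u * p0 + v * p1 in let a1 := u * q0 + v * q1 in
  cubic_poly (a0 * w0 + b0 * v0) (a0 * w1 + a1 * w0 + b0 * v1 + b1 * v0)
    (a0 * w2 + a1 * w1 + b0 * v2 + b1 * v1) (a1 * w2 + b1 * v2).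

(** Modulo p every cubic is a combination, since the resultant is a unit; the
    combination is made congruent to a multiple of a cubic without roots. *)
Lemma exists_irreducible_combination : exists u v b0 b1 : int,
  [/\ 0 <= u < p, 0 <= v < p, 0 <= b0 - p%:Z * t < p, 0 <= b1 < p &
      combination u v b0 b1 != 0 /\
      irreducible_cubic (zprimitive (combination u v b0 b1))].
Proof.
have [e he] := exists_rootless_cubic pr_p.
have p_gt0 : 0 < p%:Z by rewrite ltz_nat prime_gt0.
have p_neq0 : p%:Z != 0 by rewrite lt0r_neq0.
pose D := quad_res w0 w1 w2 v0 v1 v2.
pose a0 := cA0 w0 w1 w2 v0 v1 v2 (- e) (- 1) 0 1.
pose a1 := cA1 w0 w1 w2 v0 v1 v2 (- e) (- 1) 0 1.
pose b0 := cB0 w0 w1 w2 v0 v1 v2 (- e) (- 1) 0 1.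
pose b1 := cB1 w0 w1 w2 v0 v1 v2 (- e) (- 1) 0 1.
have E0 : a0 * w0 + b0 * v0 = D * - e.
  by rewrite /D /a0 /b0 /quad_res /cA0 /cB0 /det4 /det3; ring.
have E1 : a0 * w1 + a1 * w0 + b0 * v1 + b1 * v0 = D * - 1.
  by rewrite /D /a0 /a1 /b0 /b1 /quad_res /cA0 /cA1 /cB0 /cB1 /det4 /det3; ring.
have E2 : a0 * w2 + a1 * w1 + b0 * v2 + b1 * v1 = 0.
  by rewrite /D /a0 /a1 /b0 /b1 /quad_res /cA0 /cA1 /cB0 /cB1 /det4 /det3; ring.
have E3 : a1 * w2 + b1 * v2 = D.
  by rewrite /D /a1 /b1 /quad_res /cA1 /cB1 /det4 /det3; ring.
clearbody a0 a1 b0 b1.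
(* d is 1 or -1, hence is its own inverse *)
pose d := p0 * q1 - p1 * q0.
pose u := d * (a0 * q1 - a1 * p1); pose v := d * (p0 * a1 - q0 * a0).
have A0 : u * p0 + v * p1 = a0.
  by rewrite -[RHS]mul1r -unimod /u /v /d; ring.
have A1 : u * q0 + v * q1 = a1.
  by rewrite -[RHS]mul1r -unimod /u /v /d; ring.
clearbody u v.
have M x : 0 <= (x %% p)%Z < p by rewrite modz_ge0 // ltz_mod.
exists (u %% p)%Z, (v %% p)%Z, ((b0 %% p)%Z + p%:Z * t), (b1 %% p)%Z.
set Q1 := combination _ _ _ _.
have [g0 [g1 [g2 [g3 Q1E]]]] : exists g0 g1 g2 g3,
    Q1 = cubic_poly (D * - e + p%:Z * g0) (D * - 1 + p%:Z * g1) (p%:Z * g2) (D + p%:Z * g3).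
  have H x : (x %% p)%Z = x - (x %/ p)%Z * p by rewrite {2}(divz_eq x p); ring.
  rewrite /Q1 /combination !H.
  pose u' := (u %/ p)%Z; pose v' := (v %/ p)%Z; pose b0' := (b0 %/ p)%Z - t.
  pose b1' := (b1 %/ p)%Z.
  pose a0' := u' * p0 + v' * p1; pose a1' := u' * q0 + v' * q1.
  exists (- (a0' * w0 + b0' * v0)), (- (a0' * w1 + a1' * w0 + b0' * v1 + b1' * v0)),
    (- (a0' * w2 + a1' * w1 + b0' * v2 + b1' * v1)), (- (a1' * w2 + b1' * v2)).
  congr cubic_poly; [rewrite -E0|rewrite -E1|rewrite -[RHS]add0r -E2|rewrite -E3];
    rewrite /a0' /a1' /u' /v' /b0' /b1' -?A0 -?A1; ring.
have lead_p : ~~ (p %| Q1`_3)%Z.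
  rewrite Q1E coef_cubic_poly; apply: contra res_p => h.
  by rewrite -/D -(rpredDr _ (dvdz_mulr g3 (dvdzz p))).
have Q1n n : ~~ (p %| Q1.[n])%Z.
  have : ~~ (p %| D * (n ^+ 3 - n - e))%Z by rewrite dvdz_prime_mul // negb_or res_p he.
  apply: contra; rewrite Q1E horner_cubic_poly => h.
  have -> : D * (n ^+ 3 - n - e) = D * - e + p%:Z * g0 + (D * -1 + p%:Z * g1) * n +
     p%:Z * g2 * n ^+ 2 + (D + p%:Z * g3) * n ^+ 3 -
     p%:Z * (g0 + g1 * n + g2 * n ^+ 2 + g3 * n ^+ 3) by ring.
  by rewrite rpredB // dvdz_mulr.
have sQ1 : size Q1 = 4%N.
  have : Q1`_3 != 0 by apply: contraNneq lead_p => ->; exact: dvdz0.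
  by rewrite Q1E coef_cubic_poly; exact: size_cubic_poly.
have Q1_neq0 := cubic_neq0 sQ1.
split; rewrite ?M // ?addrK ?M //; split=> //.
have E (Q := zprimitive Q1) : Q1 = zcontents Q1 *: Q := zpolyEprim Q1.
apply: (rootless_modp_irreducible pr_p).
- by rewrite size_zprimitive.
- by rewrite zcontents_primitive Q1_neq0.
- by apply: contra lead_p => h; rewrite E coefZ dvdz_mull.
- by move=> n; apply: contra (Q1n n) => h; rewrite E hornerZ dvdz_mull.
Qed.

End Combination.

(** * Size of the constructed cubics *)

Section CombinationBounds.
Variables (R : realType) (C K P Z Y x y u : R).
Hypotheses (C1 : 1 <= C) (K0 : 0 < K) (P1 : 1 <= P) (Z1 : 1 <= Z) (Y0 : 0 < Y).
Hypotheses (x1 : 1 <= x) (xy : x <= y) (Zyu : Z * y <= u) (YX : Y * x = Z * y).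

Lemma combination_coef_le (a0 a1 b0 b1 c0 c1 d0 d1 : R) :
  `|a0| <= 2 * P * Y -> `|a1| <= 2 * P * Y -> `|b0| <= 3 * P * Z -> `|b1| <= 3 * P * Z ->
  `|c0| <= C * x -> `|c1| <= C * x -> `|d0| <= C * y -> `|d1| <= C * y ->
  `|a0 * c0 + a1 * c1 + b0 * d0 + b1 * d1| <= 10 * P * C * (Z * y).
Proof.
have A (s t : R) : `|s| <= 2 * P * Y -> `|t| <= C * x -> `|s * t| <= 2 * P * C * (Z * y).
  move=> hs ht; rewrite normrM.
  have -> : 2 * P * C * (Z * y) = 2 * P * Y * (C * x) by rewrite -YX; ring.
  exact: ler_pM.
have B (s t : R) : `|s| <= 3 * P * Z -> `|t| <= C * y -> `|s * t| <= 3 * P * C * (Z * y).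
  move=> hs ht; rewrite normrM.
  have -> : 3 * P * C * (Z * y) = 3 * P * Z * (C * y) by ring.
  exact: ler_pM.
move=> ha0 ha1 hb0 hb1 hc0 hc1 hd0 hd1.
have := A _ _ ha0 hc0; have := A _ _ ha1 hc1; have := B _ _ hb0 hd0; have := B _ _ hb1 hd1.
move: (a0 * c0) (a1 * c1) (b0 * d0) (b1 * d1) => e f g h.
have := ler_normD (e + f + g) h; have := ler_normD (e + f) g; have := ler_normD e f.
lra.
Qed.

Lemma combination_value_le (A B W V : R) :
  `|A| <= 2 * P * (K / Y) -> `|B| <= 4 * P * Z ->
  x * y ^+ 2 * `|W| <= C -> y * u ^+ 2 * `|V| <= C ->
  `|A * W + B * V| * (Z * y ^+ 3) <= (2 * K + 4) * P * C.
Proof.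
have [hC1 hK0 hP1 hZ1] := And4 C1 K0 P1 Z1.
have [hY0 hx1 hxy hZyu] := And4 Y0 x1 xy Zyu.
move=> hA hB hW hV.
have y0 : 0 < y by lra.
have u0 : 0 < u by apply: lt_le_trans Zyu; nra.
have hA' : `|A| * Y <= 2 * P * K by rewrite -ler_pdivlMr // -[leRHS]mulrA.
have e1 : `|A * W| * (Z * y ^+ 3) <= 2 * P * K * C.
  rewrite normrM (_ : _ * (Z * y ^+ 3) = (`|A| * Y) * (x * y ^+ 2 * `|W|)).
    by apply: ler_pM => //; rewrite ?mulr_ge0 ?exprn_ge0 //; lra.
  rewrite (_ : Z * y ^+ 3 = Y * x * y ^+ 2); first by ring.
  by rewrite YX; ring.
have Zy0 : 0 <= Z * y by rewrite mulr_ge0; lra.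
have e2 : `|B * V| * (Z * y ^+ 3) <= 4 * P * C.
  have h1 : `|B| * (Z * y ^+ 3) * `|V| <= 4 * P * Z * (Z * y ^+ 3) * `|V|.
    by rewrite ler_wpM2r // ler_wpM2r // mulr_ge0 ?exprn_ge0 //; lra.
  have h2 : 4 * P * (y * (Z * y) ^+ 2 * `|V|) <= 4 * P * (y * u ^+ 2 * `|V|).
    apply: ler_wpM2l; first by lra.
    apply: ler_wpM2r => //; apply: ler_wpM2l; first exact: ltW.
    by rewrite ler_pXn2r ?nnegrE // ltW.
  have h3 : 4 * P * (y * u ^+ 2 * `|V|) <= 4 * P * C by apply: ler_wpM2l => //; lra.
  rewrite normrM mulrAC; apply: le_trans h1 _.
  rewrite (_ : 4 * P * Z * (Z * y ^+ 3) * `|V| = 4 * P * (y * (Z * y) ^+ 2 * `|V|)); last by ring.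
  exact: le_trans h2 h3.
have h : `|A * W + B * V| * (Z * y ^+ 3) <= (`|A * W| + `|B * V|) * (Z * y ^+ 3).
  by apply: ler_wpM2r; [rewrite mulr_ge0 ?exprn_ge0 //; lra|exact: ler_normD].
apply: le_trans h _; rewrite mulrDl; lra.
Qed.

(** The term B V' dominates: B is of size P Z, and the other three terms are at most
    a multiple of P Z x, which is small against P Z y. *)
Lemma combination_deriv_ge (A a1 B b1 W W' V V' : R) :
  2 * C ^+ 2 * (3 + 6 * K) * x <= y ->
  `|A| <= 2 * P * (K / Y) -> `|a1| <= 2 * P * Y -> P * Z <= B -> `|b1| <= P ->
  x * y ^+ 2 * `|W| <= C -> y * u ^+ 2 * `|V| <= C -> `|W'| <= 3 * C * x ->
  y <= C * `|V'| ->
  P * (Z * y) <= 2 * C * `|a1 * W + A * W' + b1 * V + B * V'|.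
Proof.
have [hC1 hK0 hP1 hZ1] := And4 C1 K0 P1 Z1.
have [hY0 hx1 hxy hZyu] := And4 Y0 x1 xy Zyu.
move=> gap hA ha1 hB hb1 hW hV hW' hV'.
have y1 : 1 <= y by lra.
have u1 : 1 <= u by apply: le_trans Zyu; nra.
have Zx : 1 <= Z * x by nra.
have W0 := normr_ge0 W; have V0 := normr_ge0 V.
have YZ : Z <= Y.
  by have x0 : 0 < x by [lra]; rewrite -(ler_pM2r x0) YX ler_wpM2l //; lra.
have YW : Y * `|W| <= Z * C.
  have h : (Y * x) * (y * `|W|) * x <= Z * C.
    rewrite YX (_ : _ * x = Z * (x * y ^+ 2 * `|W|)); last by ring.
    by apply: ler_wpM2l => //; lra.
  apply: le_trans h; rewrite (_ : _ * x = Y * `|W| * (x * y * x)); last by ring.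
  by rewrite ler_peMr ?mulr_ge0 ?mulr_ege1 // ltW.
have V1 : `|V| <= C.
  by apply: le_trans hV; rewrite ler_peMl // expr2 !mulr_ege1.
have e1 : `|a1 * W| <= 2 * (P * C * (Z * x)).
  rewrite normrM; apply: (@le_trans _ _ (2 * P * (Y * `|W|))).
    by rewrite mulrA ler_wpM2r.
  apply: (@le_trans _ _ (2 * P * (Z * C))); first by apply: ler_wpM2l => //; lra.
  rewrite (_ : 2 * (P * C * (Z * x)) = 2 * P * (Z * C) * x); last by ring.
  by rewrite ler_peMr // !mulr_ge0 //; lra.
have e2 : `|A * W'| <= 6 * K * (P * C * (Z * x)).
  have KY : K / Y <= K by rewrite ler_pdivrMr // ler_peMr //; lra.
  have hA' : `|A| <= 2 * P * K by apply: le_trans hA _; rewrite ler_wpM2l //; lra.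
  rewrite normrM; apply: le_trans (ler_pM _ _ hA' hW') _ => //.
  rewrite (_ : 6 * K * (P * C * (Z * x)) = 2 * P * K * (3 * C * x) * Z); last by ring.
  by rewrite ler_peMr // !mulr_ge0 //; lra.
have e3 : `|b1 * V| <= P * C * (Z * x).
  rewrite normrM; apply: le_trans (ler_pM _ _ hb1 V1) _ => //.
  by rewrite ler_peMr // mulr_ge0; lra.
have e4 : P * Z * y <= C * `|B * V'|.
  have PZ : 0 <= P * Z by rewrite mulr_ge0; lra.
  rewrite normrM mulrCA (ger0_norm (le_trans PZ hB)).
  by apply: ler_pM => //; lra.
have e5 : 2 * C * ((3 + 6 * K) * (P * C * (Z * x))) <= P * Z * y.
  rewrite (_ : 2 * C * _ = P * Z * (2 * C ^+ 2 * (3 + 6 * K) * x)); last by ring.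
  by apply: ler_wpM2l => //; rewrite mulr_ge0; lra.
have e6 : `|B * V'| <= `|a1 * W + A * W' + b1 * V + B * V'| + (3 + 6 * K) * (P * C * (Z * x)).
  move: e1 e2 e3; move: (P * C * (Z * x)) (a1 * W) (A * W') (b1 * V) (B * V') => s a b c d.
  move=> h1 h2 h3; have -> : d = (a + b + c + d) - (a + b + c) by ring.
  have := ler_normB (a + b + c + d) (a + b + c).
  have := ler_normD (a + b) c; have := ler_normD a b.
  have -> : a + b + c + (a + b + c + d - (a + b + c)) = a + b + c + d by ring.
  by rewrite mulrDl -mulrA; move: h1 h2 h3; rewrite -mulrA; lra.
have e7 : 2 * C * `|B * V'| <= 2 * C * (`|a1 * W + A * W' + b1 * V + B * V'| +
     (3 + 6 * K) * (P * C * (Z * x))) by apply: ler_wpM2l => //; lra.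
move: e7 e5 e4; set a := `|_ + _|; lra.
Qed.

End CombinationBounds.

Section ChainCubics.
Variables (R : realType) (z C : R) (X : nat -> R) (w0 w1 w2 : nat -> int) (rho : int).
Hypothesis chain : quad_chain z C X w0 w1 w2 rho.
Variable K : R.
Hypothesis z_forms : forall Y : R, 1 <= Y -> exists p0 q0 p1 q1 : int,
  [/\ (p0 * q1 - p1 * q0) ^+ 2 = 1,
      `|p0%:~R| <= Y /\ `|q0%:~R| <= Y, `|p1%:~R| <= Y /\ `|q1%:~R| <= Y,
      `|p0%:~R + q0%:~R * z| <= K / Y & `|p1%:~R + q1%:~R * z| <= K / Y].

Lemma evalZ'_cubic (Q : {poly int}) : size Q = 4%N -> evalZ' Q z =
  (Q`_1)%:~R + 2 * (Q`_2)%:~R * z + 3 * (Q`_3)%:~R * z ^+ 2.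
Proof.
move=> sQ; rewrite /evalZ' /evalZ (@horner_coef_wide _ 3); last first.
  apply: leq_trans (size_poly _ _) _; rewrite -ltnS -[leqRHS]sQ.
  exact/lt_size_deriv/cubic_neq0.
rewrite !big_ord_recl big_ord0 !coef_map /= /bump /= !coef_deriv !rmorphMn /=.
by rewrite !addn0 !addn1; ring.
Qed.

Let X0 n : 0 < X n. Proof. exact: lt_le_trans ltr01 (qc_X1 chain n). Qed.
Let C0 : 0 < C. Proof. exact: lt_le_trans ltr01 (qc_C chain). Qed.

Lemma shifted_coef_le (P Z B Bz B1 Pt : R) :
  0 <= B - Pt -> B - Pt <= P -> 0 <= B1 -> B1 <= P -> 0 <= Bz -> Bz <= P ->
  P * Z <= Pt -> Pt <= P * (2 * Z) -> P <= P * Z ->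
  [/\ `|B| <= 3 * P * Z, `|B1| <= 3 * P * Z, P * Z <= B + Bz & `|B + Bz| <= 4 * P * Z].
Proof. by move=> *; split; rewrite ?ger0_norm; lra. Qed.

Lemma combination_bounds n (Z : R) (p u v b0 b1 p0 q0 p1 q1 t : int) :
  1 <= Z -> Z * X n.+1 <= X n.+2 -> 0 < K -> 0 < p ->
  2 * C ^+ 2 * (3 + 6 * K) * X n <= X n.+1 ->
  Z <= t%:~R <= 2 * Z ->
  let Y := Z * X n.+1 / X n in
  `|p0%:~R| <= Y /\ `|q0%:~R| <= Y -> `|p1%:~R| <= Y /\ `|q1%:~R| <= Y ->
  `|p0%:~R + q0%:~R * z| <= K / Y -> `|p1%:~R + q1%:~R * z| <= K / Y ->
  0 <= u < p -> 0 <= v < p -> 0 <= b0 - p * t < p -> 0 <= b1 < p ->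
  let Q := combination (w0 n) (w1 n) (w2 n) (w0 n.+1) (w1 n.+1) (w2 n.+1) p0 q0 p1 q1
             u v b0 b1 in
  size Q = 4%N ->
  [/\ forall i, `|(Q`_i)%:~R| <= 10 * p%:~R * C * (Z * X n.+1),
      `|evalZ Q z| * (Z * X n.+1 ^+ 3) <= (2 * K + 4) * p%:~R * C &
      p%:~R * (Z * X n.+1) <= 2 * C * `|evalZ' Q z| ].
Proof.
move=> Z1 ZX K0 p_gt0 gap tZ Y [hp0 hq0] [hp1 hq1] hl0 hl1 hu hv hb0 hb1 Q sQ.
have Y0 : 0 < Y by rewrite /Y divr_gt0 // mulr_gt0 // (lt_le_trans ltr01 Z1).
have YX : Y * X n = Z * X n.+1 by rewrite /Y divfK // lt0r_neq0.
clearbody Y.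
pose P : R := p%:~R; have P1 : 1 <= P by rewrite /P ler1z -gtz0_ge1.
have IR (x : int) : 0 <= x < p -> 0 <= (x%:~R : R) <= P.
  by move=> /andP[h1 h2]; rewrite ler0z h1 ler_int ltW.
have {hu} /andP[u0 uP] := IR _ hu; have {hv} /andP[v0 vP] := IR _ hv.
have {hb1} /andP[b10 b1P] := IR _ hb1.
have {hb0} := IR _ hb0; rewrite rmorphB rmorphM /= -/P => /andP[b00 b0P].
have N0 : `|u%:~R : R| <= P by rewrite ger0_norm.
have N1 : `|v%:~R : R| <= P by rewrite ger0_norm.
pose a0 := u * p0 + v * p1; pose a1 := u * q0 + v * q1.
have lin (x y e : R) : `|x| <= e -> `|y| <= e -> `|u%:~R * x + v%:~R * y| <= 2 * P * e.
  move=> hx hy; apply: le_trans (ler_normD _ _) _; rewrite !normrM -mulrA mulr_natl mulr2n.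
  by apply: lerD; apply: ler_pM.
have ha0 : `|a0%:~R| <= 2 * P * Y by rewrite rmorphD !rmorphM /=; exact: lin.
have ha1 : `|a1%:~R| <= 2 * P * Y by rewrite rmorphD !rmorphM /=; exact: lin.
have haz : `|a0%:~R + a1%:~R * z| <= 2 * P * (K / Y).
  rewrite (_ : _ + _ = u%:~R * (p0%:~R + q0%:~R * z) + v%:~R * (p1%:~R + q1%:~R * z)).
    exact: lin.
  by rewrite /a0 /a1; ring.
have [/andP[z0 z1] C1] := (qc_z chain, qc_C chain).
have [b1z0 b1z1] : 0 <= b1%:~R * z /\ b1%:~R * z <= P.
  by split; [exact: mulr_ge0|apply: le_trans b1P; rewrite ler_piMr].
have [hB0 hB1 hBz hBz4] : [/\ `|b0%:~R| <= 3 * P * Z, `|b1%:~R| <= 3 * P * Z,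
    P * Z <= b0%:~R + b1%:~R * z & `|b0%:~R + b1%:~R * z| <= 4 * P * Z].
  have [tP tP2] : P * Z <= P * t%:~R /\ P * t%:~R <= P * (2 * Z).
    have P0 : 0 <= P by exact: le_trans ler01 P1.
    by case/andP: tZ => t1 t2; split; apply: ler_wpM2l.
  have PZ : P <= P * Z by rewrite ler_peMr // (le_trans ler01 P1).
  exact: (shifted_coef_le b00 b0P b10 b1P b1z0 b1z1 tP tP2 PZ).
have c_irr := (qc_coef chain n, qc_coef chain n.+1).
case: c_irr => -[cw0 cw1 cw2] [cv0 cv1 cv2].
have sw := qc_small chain n; have sv := qc_small chain n.+1; have dv := qc_deriv chain n.+1.
have [x1 xy] := (qc_X1 chain n, qc_Xmono chain n).
have dw : `|(w1 n)%:~R + 2 * (w2 n)%:~R * z| <= 3 * C * X n.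
  apply: le_trans (ler_normD _ _) _; rewrite !normrM normr_nat (ger0_norm z0).
  have : 2 * `|(w2 n)%:~R| * z <= 2 * (C * X n).
    have : `|(w2 n)%:~R| * z <= `|(w2 n)%:~R : R| by rewrite ler_piMr.
    by move: cw2; lra.
  by move: cw1; lra.
have QE : Q = cubic_poly (a0 * w0 n + b0 * w0 n.+1)
    (a0 * w1 n + a1 * w0 n + b0 * w1 n.+1 + b1 * w0 n.+1)
    (a0 * w2 n + a1 * w1 n + b0 * w2 n.+1 + b1 * w1 n.+1) (a1 * w2 n + b1 * w2 n.+1).
  by [].
split.
- have coefP := combination_coef_le (C := C) (P := P) YX.
  have E0 : `|0 : R| <= C * X n by rewrite normr0 mulr_ge0 // (le_trans ler01).
  have F0 : `|0 : R| <= C * X n.+1 by apply: le_trans E0 _; rewrite ler_wpM2l // (le_trans ler01).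
  case=> [|[|[|[|i]]]]; rewrite ?QE ?coef_cubic_poly -/P.
  + have := coefP _ _ _ _ _ _ _ _ ha0 ha0 hB0 hB0 cw0 E0 cv0 F0.
    by rewrite !mulr0 !addr0 => h; rewrite rmorphD !rmorphM /=; exact: h.
  + have := coefP _ _ _ _ _ _ _ _ ha0 ha1 hB0 hB1 cw1 cw0 cv1 cv0.
    by move=> h; rewrite !rmorphD !rmorphM /=; exact: h.
  + have := coefP _ _ _ _ _ _ _ _ ha0 ha1 hB0 hB1 cw2 cw1 cv2 cv1.
    by move=> h; rewrite !rmorphD !rmorphM /=; exact: h.
  + have := coefP _ _ _ _ _ _ _ _ ha1 ha1 hB1 hB1 cw2 E0 cv2 F0.
    by rewrite !mulr0 !addr0 => h; rewrite rmorphD !rmorphM /=; exact: h.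
  + rewrite -QE nth_default ?sQ // normr0 !mulr_ge0 ?ler0n // ?(ltW (X0 _)) ?(le_trans ler01) //.
- rewrite (evalZ_cubic _ sQ) QE !coef_cubic_poly.
  have := combination_value_le C1 K0 P1 Z1 Y0 x1 xy ZX YX haz hBz4 sw sv.
  apply: le_trans; rewrite le_eqVlt; apply/orP; left; apply/eqP.
  congr (`|_| * _).
  ring.
- rewrite (evalZ'_cubic sQ) QE !coef_cubic_poly.
  have b1P' : `|b1%:~R : R| <= P by rewrite ger0_norm.
  apply: le_trans (combination_deriv_ge C1 K0 P1 Z1 Y0 x1 xy ZX YX gap haz ha1 hBz b1P' sw sv dw dv) _.
  rewrite le_eqVlt; apply/orP; left; apply/eqP.
  by congr (_ * `|_|); ring.
Qed.

(** Any prime larger than the absolute value of rho will do. *)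
Lemma exists_prime_unit : exists2 p : nat, prime p & ~~ (p %| rho)%Z.
Proof.
have [p pgt pr_p] := prime_above `|rho|%N; exists p => //.
rewrite dvdzE /= gtnNdvd // absz_gt0; exact: (qc_rho chain).
Qed.

Hypothesis K_gt0 : 0 < K.

Lemma height_attained (Q : {poly int}) : Q != 0 ->
  exists i, (poly_height Q)%:R = `|(Q`_i)%:~R : R|.
Proof.
move=> Q0; have sQ : (0 < size Q)%N by rewrite size_poly_gt0.
have [] := @bigop.eq_bigmax 'I_(size Q) (fun i => `|(Q`_i)%R|%N); first by rewrite card_ord.
move=> i Ei; exists i; rewrite /poly_height Ei pmulrn abszE; exact: intr_norm.
Qed.

(** Z is the ratio between the height aimed at and X n.+1.  The last bound makes
    Q'(z) as large as it can be, which is what is needed to pass from small values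
    of Q to roots close to z. *)
Lemma chain_cubics : exists c C' : R, [/\ 0 < c, 1 <= C' & exists N, forall n (Z : R),
  (N <= n)%N -> 1 <= Z -> Z * X n.+1 <= X n.+2 ->
  exists Q : {poly int}, [/\ irreducible_cubic Q /\ zcontents Q = 1,
    (poly_height Q)%:R <= C' * (Z * X n.+1),
    `|evalZ Q z| * (Z * X n.+1 ^+ 3) <= C' &
    c * (poly_height Q)%:R <= `|evalZ' Q z| ]].
Proof.
have [p pr_p rho_p] := exists_prime_unit.
pose P : R := p%:R; have P1 : 1 <= P by rewrite ler1n prime_gt0.
have [N hN] := qc_Xgap chain (2 * C ^+ 2 * (3 + 6 * K)).
have C1 := qc_C chain; have KK := K_gt0.
have PC : 1 <= P * C by rewrite mulr_ege1.
have KPC : 0 <= K * (P * C) by rewrite mulr_ge0 ?ltW //; exact: lt_le_trans PC.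
exists (20 * C ^+ 2)^-1, (10 * P * C + (2 * K + 4) * P * C); split.
- by rewrite invr_gt0 mulr_gt0 ?ltr0n ?exprn_gt0.
- by move: PC KPC; lra.
exists N => n Z Nn Z1 ZX.
have [x0 y0] : 0 < X n /\ 0 < X n.+1 by [].
have Y1 : 1 <= Z * X n.+1 / X n.
  rewrite ler_pdivlMr // mul1r; apply: le_trans (qc_Xmono chain n) _.
  by rewrite ler_peMl // ltW.
have [p0 [q0 [p1 [q1 [unimod h0 h1 hl0 hl1]]]]] := z_forms Y1.
pose t : int := (Num.truncn Z).+1.
have tZ : Z <= t%:~R <= 2 * Z.
  rewrite -pmulrn (ltW (truncnS_gt Z)) /= -natr1.
  have : (Num.truncn Z)%:R <= Z by rewrite truncn_le (le_trans ler01).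
  by move: Z1; lra.
have res_p : ~~ (p %| quad_res (w0 n) (w1 n) (w2 n) (w0 n.+1) (w1 n.+1) (w2 n.+1))%Z.
  apply: contra rho_p => h.
  have : (p %| rho ^+ 2)%Z by rewrite -(qc_res chain n) expr2 dvdz_mulr.
  by rewrite expr2 dvdz_prime_mul // orbb.
have [u [v [b0 [b1 [hu hv hb0 hb1 [Q1n0 irr]]]]]] :=
  exists_irreducible_combination t pr_p res_p unimod.
have p_gt0 : 0 < p%:Z by rewrite ltz_nat prime_gt0.
have sQ1 : size (combination (w0 n) (w1 n) (w2 n) (w0 n.+1) (w1 n.+1) (w2 n.+1)
    p0 q0 p1 q1 u v b0 b1) = 4%N by rewrite -size_zprimitive; case: irr.
have [] := combination_bounds Z1 ZX K_gt0 p_gt0 (hN n Nn) tZ h0 h1 hl0 hl1 hu hv hb0 hb1 sQ1.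
move: Q1n0 irr {sQ1}; set Q1 := combination _ _ _ _ _ _ _ _ _ _ _ _ _ _.
rewrite -!pmulrn -/P => Q1n0 irr B1 B2 B3.
set d := zcontents Q1; have d1 : 1 <= `|d%:~R : R|.
  by apply: norm_int_ge1; rewrite zcontents_eq0.
have QE : Q1 = d *: zprimitive Q1 := zpolyEprim Q1.
have dR : d%:~R *: map_poly intr (zprimitive Q1) = map_poly intr Q1 :> {poly R}.
  by rewrite [in RHS]QE map_polyZ.
pose Q := zprimitive Q1; rewrite -/Q in irr QE.
have v1 : `|evalZ Q1 z| = `|d%:~R| * `|evalZ Q z|.
  by rewrite QE /evalZ map_polyZ hornerZ normrM.
have v2 : `|evalZ' Q1 z| = `|d%:~R| * `|evalZ' Q z|.
  by rewrite QE /evalZ' derivZ /evalZ map_polyZ hornerZ normrM.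
have hQ : `|d%:~R| * (poly_height Q)%:R <= 10 * P * C * (Z * X n.+1).
  have [i ->] : exists i, (poly_height Q)%:R = `|(Q`_i)%:~R : R|.
    by apply: height_attained; rewrite zprimitive_eq0.
  by rewrite -normrM -rmorphM /= -coefZ -QE.
have ZX0 : 0 <= Z * X n.+1 by rewrite mulr_ge0 ?(le_trans ler01 Z1) // ltW.
have [CC P0] : 0 <= C /\ 0 <= P by split; apply: le_trans ler01 _.
exists Q; split.
- by split=> //; rewrite zcontents_primitive Q1n0.
- apply: (@le_trans _ _ (10 * P * C * (Z * X n.+1))).
    by apply: le_trans hQ; rewrite ler_peMl.
  by apply: ler_wpM2r => //; rewrite lerDl !mulr_ge0 // addr_ge0 // mulr_ge0 // ltW.
- apply: (@le_trans _ _ ((2 * K + 4) * P * C)).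
    apply: le_trans B2; rewrite v1 -mulrA ler_peMl //.
    by rewrite mulr_ge0 // mulr_ge0 ?(le_trans ler01 Z1) // exprn_ge0 // ltW.
  by rewrite lerDr !mulr_ge0.
- have d0 : 0 < `|d%:~R : R| by exact: lt_le_trans ltr01 d1.
  rewrite mulrC ler_pdivrMr ?mulr_gt0 ?ltr0n ?exprn_gt0 // -(ler_pM2l d0).
  apply: le_trans hQ _; rewrite [leRHS]mulrA -v2.
  have -> : 10 * P * C * (Z * X n.+1) = 10 * C * (P * (Z * X n.+1)) by ring.
  have -> : `|evalZ' Q1 z| * (20 * C ^+ 2) = 10 * C * (2 * C * `|evalZ' Q1 z|) by ring.
  by apply: ler_wpM2l => //; rewrite mulr_ge0.
Qed.

End ChainCubics.

(** * The chain of quadratics of a Sturmian word *)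

Section SturmianChain.
Variables (R : realType) (a b : nat) (s : nat -> nat).
Hypothesis a_gt0 : (0 < a)%N.
Hypothesis b_gt0 : (0 < b)%N.
Hypothesis a_neq_b : a <> b.
Hypothesis s_gt0 : forall k : nat, (0 < k)%N -> (0 < s k)%N.

Let m n := sturm_word a b s n.+1.
Let K := maxn a b.
Let zeta : R := sturm_zeta R a b s.

(** Index n stands for the word m_{n+1}: m_0 need not be a prefix of the limit word. *)
Definition sturm_X (n : nat) : R := ent R (sturm_word a b s n.+1) 0 0.
Definition sturm_w0 n : int := word_mx (sturm_word a b s n.+1) 1 0.
Definition sturm_w1 n : int :=
  word_mx (sturm_word a b s n.+1) 1 1 - word_mx (sturm_word a b s n.+1) 0 0.
Definition sturm_w2 n : int := - word_mx (sturm_word a b s n.+1) 0 1.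
Let X := sturm_X.

Let m_ge1 n : all (leq 1) (m n). Proof. exact: all_sturm_word. Qed.
Let m_leK n : all (geq K) (m n).
Proof. by apply: all_sturm_word; rewrite /K /= ?leq_maxl ?leq_maxr. Qed.

Lemma sturm_limit_gt0 i : (0 < sturm_limit a b s i)%N.
Proof. exact: (@sturm_limit_letter a b s s_gt0 (leq 1) i a_gt0 b_gt0). Qed.

Lemma sturm_limit_le i : (sturm_limit a b s i <= maxn a b)%N.
Proof.
exact: (@sturm_limit_letter a b s s_gt0 (geq (maxn a b)) i (leq_maxl a b) (leq_maxr a b)).
Qed.

Lemma sturm_prefix n : cf_prefix zeta (mkseq (sturm_limit a b s) n).
Proof. exact: (inf_cfrac_prefix R sturm_limit_gt0). Qed.

Let X_ge1 n : 1 <= X n. Proof. by case: (ent_bounds R (m_ge1 n)). Qed.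

Lemma sturm_X_ge n : n.+1%:R <= X n.
Proof.
rewrite /X /sturm_X -(mkseq_sturm_limit a b s_gt0) //.
apply: le_trans (ent_mkseq_ge R sturm_limit_gt0 _).
by rewrite ler_nat size_sturm_word.
Qed.

Lemma ent_power u v n : all (leq 1) u -> all (leq 1) v ->
  ent R u 0 0 ^+ n * ent R v 0 0 <= ent R (flatten (nseq n u) ++ v) 0 0 <=
  2 ^+ n * (ent R u 0 0 ^+ n * ent R v 0 0).
Proof.
move=> hu hv; elim: n => [|n /andP[IH1 IH2]] /=; first by rewrite !expr0 !mul1r lexx.
have hn : all (leq 1) (flatten (nseq n u) ++ v) by rewrite all_cat hv andbT all_flatten_nseq.
have u0 : 0 <= ent R u 0 0 by case: (ent_bounds R hu) => h _ _ _ _; exact: le_trans h.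
rewrite -catA; have /andP[h1 h2] := ent_cat00 R hu hn.
apply/andP; split.
  by apply: le_trans h1; rewrite exprS -mulrA ler_wpM2l.
apply: le_trans h2 _; rewrite [2 ^+ _]exprS -mulrA ler_wpM2l // exprS -mulrA [leRHS]mulrCA.
exact: ler_wpM2l.
Qed.

Lemma sturm_X_rec n : X n.+1 ^+ s n.+3 * X n <= X n.+2 <=
  2 ^+ s n.+3 * (X n.+1 ^+ s n.+3 * X n).
Proof. exact: ent_power (m_ge1 n.+1) (m_ge1 n). Qed.

Lemma sturm_X_mul n : X n.+1 * X n <= X n.+2.
Proof.
case/andP: (sturm_X_rec n) => h _; apply: le_trans h; rewrite ler_wpM2r //.
  exact: le_trans ler01 (X_ge1 n).
have := s_gt0 (ltn0Sn n.+2); case: (s _) => // k _.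
by rewrite exprS ler_peMr ?exprn_ege1 // (le_trans ler01 (X_ge1 _)).
Qed.

Let m_neq0 n : m n != [::].
Proof. by have := size_sturm_word a b s_gt0 n.+1; rewrite /m; case: (sturm_word _ _ _ _). Qed.

Lemma sturm_X_mono n : X n <= X n.+1.
Proof.
have /prefixP[v E] := @sturm_word_prefix a b s s_gt0 n.+1 n.+2 isT (leqnSn _).
have hv : all (leq 1) v by have := m_ge1 n.+1; rewrite /m E all_cat => /andP[].
rewrite /X /sturm_X E; case/andP: (ent_cat00 R (m_ge1 n) hv) => h _.
apply: le_trans h; rewrite ler_peMr //; first exact: le_trans ler01 (X_ge1 n).
by case: (ent_bounds R hv).
Qed.

(** The resultant is, up to sign, the determinant of the commutator of the two
    matrices; that commutator is V times the antidiagonal matrix with entries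
    f - e and e - f, where V is the matrix of the common part v of the two products. *)
Lemma sturm_res n :
  quad_res (sturm_w0 n) (sturm_w1 n) (sturm_w2 n)
    (sturm_w0 n.+1) (sturm_w1 n.+1) (sturm_w2 n.+1) ^+ 2 = ((a%:Z - b%:Z) ^+ 2) ^+ 2.
Proof.
have [v [e [f [E1 E2 ef]]]] := sturm_word_swap a b s n.+1.
have -> : (a%:Z - b%:Z) ^+ 2 = (e%:Z - f%:Z) ^+ 2.
  by case: ef => -[-> ->] //; ring.
rewrite /sturm_w0 /sturm_w1 /sturm_w2.
move: (sturm_word a b s n.+1) (sturm_word a b s n.+2) E1 E2 => x y.
move=> /(congr1 word_mx) + /(congr1 word_mx); rewrite !word_mx_cat.
set M := word_mx x; set N := word_mx y.
set V := word_mx v => E1 E2.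
have EF k l : word_mx [:: k; l] = letter_mx k * letter_mx l.
  by rewrite /word_mx big_cons big_seq1.
have C i j : (M * N) i j - (N * M) i j =
   (if j == 0 then V i 1 else - V i 0) * (e%:Z - f%:Z).
  rewrite E1 E2 !EF !mx22E !mxE /=; case: j => -[|[|j]] //= lt_j.
    by ring.
  by ring.
have D : (V 0 0 * V 1 1 - V 0 1 * V 1 0) ^+ 2 = 1.
  apply: (@intr_inj R); rewrite rmorphXn rmorphB !rmorphM /= -!/(ent R _ _ _) ent_det.
  by rewrite -exprM mulnC exprM sqrrN expr1n expr1n.
have c00 := C 0 0; have c01 := C 0 1; have c10 := C 1 0; have c11 := C 1 1.
rewrite /= !mx22E in c00 c01 c10 c11.
transitivity (((M 0 0 * N 0 0 + M 0 1 * N 1 0 - (N 0 0 * M 0 0 + N 0 1 * M 1 0)) *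
  (M 1 0 * N 0 1 + M 1 1 * N 1 1 - (N 1 0 * M 0 1 + N 1 1 * M 1 1)) -
  (M 0 0 * N 0 1 + M 0 1 * N 1 1 - (N 0 0 * M 0 1 + N 0 1 * M 1 1)) *
  (M 1 0 * N 0 0 + M 1 1 * N 1 0 - (N 1 0 * M 0 0 + N 1 1 * M 1 0))) ^+ 2).
  by rewrite /quad_res /det4 /det3; ring.
rewrite c00 c01 c10 c11 -[RHS]mul1r -[X in _ = X * _]D; ring.
Qed.

Let K1 : 1 <= K%:R :> R. Proof. by rewrite ler1n (leq_trans a_gt0) // leq_maxl. Qed.

Let zeta_bounds : K.+1%:R^-1 <= zeta <= 1.
Proof. exact: (cf_prefix_bounds sturm_limit_gt0 sturm_limit_le sturm_prefix). Qed.

(** Up to the factors mu and mu', the vector (1, zeta) is V P and its image under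
    the matrix of m_{n+1} is V Q, with bounded vectors P and Q: W_n(zeta) is the
    determinant of these two vectors, and V has determinant 1 or -1. *)
Lemma sturm_small n : X n * X n.+1 ^+ 2 *
  `|(sturm_w0 n)%:~R + (sturm_w1 n)%:~R * zeta + (sturm_w2 n)%:~R * zeta ^+ 2| <=
  2 * (K%:R ^+ 2 + K%:R + 1) * (K%:R + 1).
Proof.
have [v [e [f [E1 E2 ef]]]] := sturm_word_swap a b s n.+1.
have [hu hv] := (m_ge1 n.+1, m_ge1 n).
have Kl c : c = a \/ c = b -> c%:R <= K%:R :> R.
  by case=> ->; rewrite ler_nat ?leq_maxl ?leq_maxr.
have eK : e%:R <= K%:R :> R by apply: Kl; case: ef => -[-> _]; [left|right].
have fK : f%:R <= K%:R :> R by apply: Kl; case: ef => -[_ ->]; [right|left].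
have : cf_prefix zeta (m n.+1 ++ m n).
  have /prefixP[t Et] := sturm_word_prefix2 a b s_gt0 n.
  apply: (@inf_cfrac_prefix_of R _ sturm_limit_gt0 _ t (size (sturm_word a b s n.+3))).
  by rewrite mkseq_sturm_limit.
case/(cf_prefix_split hu hv) => xi [eta [/andP[xi0 xi1] /andP[eta0 eta1] h1 h2 h3]].
case: (ent_bounds R hu) => u1 /andP[u2 u3] _ _ _.
case: (ent_bounds R hv) => v1 /andP[v2 v3] _ _ _.
have /andP[z0 z1] := zeta_bounds.
have Dv := ent_det_norm R v.
have hG i j : ent R (m n.+1 ++ m n) i j = ent R v i 0 * ent R [:: e; f] 0 j + ent R v i 1 * ent R [:: e; f] 1 j.
  by rewrite E1 ent_cat.
have hF i j : ent R (m n ++ m n.+1) i j = ent R v i 0 * ent R [:: f; e] 0 j + ent R v i 1 * ent R [:: f; e] 1 j.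
  by rewrite E2 ent_cat.
have hG00 : X n.+1 * X n <= ent R (m n.+1 ++ m n) 0 0 + ent R (m n.+1 ++ m n) 0 1 * xi.
  have /andP[g1 _] := ent_cat00 R hu hv; apply: le_trans g1 _.
  rewrite lerDl mulr_ge0 //; have : all (leq 1) (m n.+1 ++ m n) by rewrite all_cat hu hv.
  by case/(ent_bounds R) => _ /andP[].
have hU : X n.+1 <= ent R (m n.+1) 0 0 + ent R (m n.+1) 0 1 * eta.
  by rewrite lerDl mulr_ge0.
set W := _ + _ + _.
pose mu := ent R (m n.+1 ++ m n) 0 0 + ent R (m n.+1 ++ m n) 0 1 * xi.
pose mu' := ent R (m n.+1) 0 0 + ent R (m n.+1) 0 1 * eta.
pose P0 : R := e%:R * f%:R + 1 + e%:R * xi; pose P1 : R := f%:R + xi.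
pose Q0 : R := e%:R * f%:R + 1 + f%:R * eta; pose Q1 : R := e%:R + eta.
have EF0 : mu = ent R v 0 0 * P0 + ent R v 0 1 * P1.
  by rewrite /mu !hG !ent_cons !ent_nil /P0 /P1; ring.
have EF1 : mu * zeta = ent R v 1 0 * P0 + ent R v 1 1 * P1.
  by rewrite /mu h1 !hG !ent_cons !ent_nil /P0 /P1; ring.
have FE0 : ent R (m n) 0 0 * mu' + ent R (m n) 0 1 * (mu' * zeta) = ent R v 0 0 * Q0 + ent R v 0 1 * Q1.
  rewrite /mu' h3; transitivity (ent R (m n ++ m n.+1) 0 0 + ent R (m n ++ m n.+1) 0 1 * eta).
    by rewrite !ent_cat; ring.
  by rewrite !hF !ent_cons !ent_nil /Q0 /Q1; ring.
have FE1 : ent R (m n) 1 0 * mu' + ent R (m n) 1 1 * (mu' * zeta) = ent R v 1 0 * Q0 + ent R v 1 1 * Q1.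
  rewrite /mu' h3; transitivity (ent R (m n ++ m n.+1) 1 0 + ent R (m n ++ m n.+1) 1 1 * eta).
    by rewrite !ent_cat; ring.
  by rewrite !hF !ent_cons !ent_nil /Q0 /Q1; ring.
have WE : mu * mu' * W = (ent R v 0 0 * ent R v 1 1 - ent R v 0 1 * ent R v 1 0) * (P0 * Q1 - P1 * Q0).
  transitivity (mu * (ent R v 1 0 * Q0 + ent R v 1 1 * Q1) -
                (mu * zeta) * (ent R v 0 0 * Q0 + ent R v 0 1 * Q1)).
    rewrite -FE0 -FE1 /W /sturm_w0 /sturm_w1 /sturm_w2 rmorphB rmorphN /= -!/(ent R _ _ _).
    by rewrite /m; ring.
  by rewrite EF1 EF0; ring.
have x0 : 0 <= X n by apply: le_trans ler01 (X_ge1 n).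
have y0 : 0 <= X n.+1 by apply: le_trans ler01 (X_ge1 n.+1).
have xy0 : 0 <= X n.+1 * X n by rewrite mulr_ge0.
have mu0 : 0 <= mu by exact: le_trans hG00.
have mu'0 : 0 <= mu' by exact: le_trans hU.
apply: (@le_trans _ _ (mu * mu' * `|W|)).
  rewrite (_ : X n * X n.+1 ^+ 2 = X n.+1 * X n * X n.+1); last by ring.
  by rewrite ler_wpM2r // ler_pM.
rewrite -[mu * mu']ger0_norm ?mulr_ge0 // -normrM WE normrM Dv mul1r.
have [e0 f0] : 0 <= e%:R :> R /\ 0 <= f%:R :> R by [].
have k1 := K1; have k0 : 0 <= K%:R :> R by [].
have B0 : 0 <= P0 <= K%:R ^+ 2 + K%:R + 1.
  rewrite /P0 !addr_ge0 ?mulr_ge0 //=.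
  have : e%:R * f%:R <= K%:R * K%:R :> R by rewrite ler_pM.
  have : e%:R * xi <= K%:R by apply: le_trans eK; rewrite ler_piMr.
  by rewrite expr2; lra.
have B1 : 0 <= Q0 <= K%:R ^+ 2 + K%:R + 1.
  rewrite /Q0 !addr_ge0 ?mulr_ge0 //=.
  have : e%:R * f%:R <= K%:R * K%:R :> R by rewrite ler_pM.
  have : f%:R * eta <= K%:R by apply: le_trans fK; rewrite ler_piMr.
  by rewrite expr2; lra.
have B2 : 0 <= P1 <= K%:R + 1 by rewrite /P1 addr_ge0 //= lerD.
have B3 : 0 <= Q1 <= K%:R + 1 by rewrite /Q1 addr_ge0 //= lerD.
apply: le_trans (ler_normB _ _) _; rewrite !normrM.
case/andP: B0 => ? ?; case/andP: B1 => ? ?; case/andP: B2 => ? ?; case/andP: B3 => ? ?.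
rewrite !ger0_norm // -mulrA mulr_natl mulr2n [P1 * Q0]mulrC.
by apply: lerD; apply: ler_pM.
Qed.

Lemma sturm_quad_chain : exists C,
  quad_chain zeta C X sturm_w0 sturm_w1 sturm_w2 ((a%:Z - b%:Z) ^+ 2).
Proof.
have k1 := K1.
have q0 : 0 <= K%:R ^+ 2 :> R by [].
pose C : R := 2 * (K%:R ^+ 2 + K%:R + 1) * (K%:R + 1); exists C.
have C1 : K%:R + 1 <= C.
  by rewrite /C -[leLHS]mul1r ler_wpM2r //; lra.
have CK2 : (K%:R + 1) ^+ 2 <= C.
  by rewrite /C expr2 ler_wpM2r //; lra.
have C1' : 1 <= C by lra.
have /andP[z0 z1] := zeta_bounds.
have K0 : 0 < K.+1%:R :> R by [].
have z0' : 0 <= zeta by apply: le_trans z0; rewrite invr_ge0.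
have Xpos n : 0 <= X n by apply: le_trans ler01 (X_ge1 n).
have y_ge n : X n <= (K%:R + 1) * ent R (m n) 0 1.
  by rewrite natr1; exact: (ent_last R (m_ge1 n) (m_leK n) (m_neq0 n)).
split=> //.
- by rewrite z0'.
- exact: sturm_X_mono.
- move=> B; exists (Num.truncn `|B|).+1 => -[//|n] hn.
  apply: le_trans (sturm_X_mul n); rewrite mulrC ler_wpM2l //.
  apply: le_trans (ler_norm B) _; apply: le_trans (sturm_X_ge n).
  by apply: le_trans (ltW (truncnS_gt _)) _; rewrite ler_nat.
- move=> n; case: (ent_bounds R (m_ge1 n)) => h1 /andP[h2 h3] /andP[h4 h5] /andP[h6 h7] _.
  have CX : X n <= C * X n by rewrite ler_peMl.
  rewrite /sturm_w0 /sturm_w1 /sturm_w2 rmorphB rmorphN normrN /= -!/(ent R _ _ _).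
  rewrite !(ger0_norm h2) !(ger0_norm h4); split; [exact: le_trans CX|idtac|exact: le_trans CX].
  apply: le_trans CX; rewrite distrC ger0_norm ?subr_ge0 //.
  by rewrite lerBlDr lerDl.
- move=> n; rewrite /sturm_w2 oppr_eq0; apply/eqP => y0.
  by have := y_ge n; rewrite /ent /m y0 mulr0; have := X_ge1 n; lra.
- exact: sturm_small.
- move=> n; case: (ent_bounds R (m_ge1 n)) => h1 /andP[h2 h3] /andP[h4 h5] /andP[h6 h7] _.
  rewrite /sturm_w1 /sturm_w2 rmorphB rmorphN /= -!/(ent R _ _ _) -/(m n).
  set x := ent R (m n) 0 0; set y := ent R (m n) 0 1; set t := ent R (m n) 1 1.
  have e0 : y * zeta <= `|t - x + 2 * (- y) * zeta|.
    rewrite -normrN; apply: le_trans (ler_norm _).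
    have : 0 <= y * zeta by rewrite mulr_ge0.
    by move: h7; rewrite -/t -/x; lra.
  apply: le_trans (y_ge n) _; rewrite -/y.
  apply: (@le_trans _ _ (C * (y * zeta))); last by rewrite ler_wpM2l // (le_trans ler01).
  have : (K%:R + 1) * y <= (K%:R + 1) ^+ 2 * (y * zeta).
    rewrite expr2 -mulrA ler_wpM2l //.
    rewrite mulrCA ler_peMr //.
    by rewrite -(@ler_pM2l _ K.+1%:R^-1) ?invr_gt0 // mulr1 natr1 mulKf // lt0r_neq0.
  move=> h; apply: le_trans h _; rewrite ler_wpM2r // mulr_ge0 //.
- by rewrite sqrf_eq0 subr_eq0; apply/eqP => -[].
- exact: sturm_res.
Qed.

End SturmianChain.

(** * Growth of the chain and the constant sigma *)

(** Two sequences that satisfy the recursion x' = 1 / (q + x), the first one up to a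
    relative error th, approach each other: two steps of the exact recursion at
    least halve the distance. *)
Section ContinuedFractionContraction.
Variables (R : realType) (q : nat -> R) (th r rh : nat -> R).
Hypothesis q_ge1 : forall n, 1 <= q n.
Hypothesis th_ge0 : forall n, 0 <= th n.
Hypothesis th_to0 : forall e : R, 0 < e -> exists N, forall n, (N <= n)%N -> th n <= e.
Hypothesis r01 : forall n, 0 <= r n <= 1.
Hypothesis rh01 : forall n, 0 <= rh n <= 1.
Hypothesis r_rec : forall n, r n.+1 * (q n * (1 + th n) + r n) = 1.
Hypothesis rh_rec : forall n, rh n.+1 * (q n + rh n) = 1.

Let d n := `|r n - rh n|.

Let d_rec n : d n.+1 <= th n + rh n.+1 * d n.
Proof.
have [/andP[a0 a1] /andP[b0 b1]] := (r01 n, rh01 n).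
have [/andP[c0 c1] /andP[e0 e1]] := (r01 n.+1, rh01 n.+1).
have q1 := q_ge1 n; have t0 := th_ge0 n; have d0 := normr_ge0 (r n - rh n).
have Er := r_rec n; have Eh := rh_rec n.
have E : rh n.+1 - r n.+1 = r n.+1 * q n * (rh n.+1 * th n) + r n.+1 * (rh n.+1 * (r n - rh n)).
  transitivity (rh n.+1 * (r n.+1 * (q n * (1 + th n) + r n)) - r n.+1 * (rh n.+1 * (q n + rh n))).
    by rewrite Er Eh !mulr1.
  by ring.
have rq : r n.+1 * q n <= 1.
  rewrite -Er ler_wpM2l //; have : 0 <= q n * th n by rewrite mulr_ge0 // (le_trans ler01).
  by lra.
rewrite /d distrC E; apply: le_trans (ler_normD _ _) (lerD _ _).
  have rq0 : 0 <= r n.+1 * q n by rewrite mulr_ge0 // (le_trans ler01).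
  rewrite normrM ger0_norm // ger0_norm; last by rewrite mulr_ge0.
  apply: (@le_trans _ _ (rh n.+1 * th n)); first by rewrite ler_piMl // mulr_ge0.
  by rewrite ler_piMl.
rewrite !normrM (ger0_norm c0) (ger0_norm e0).
by rewrite ler_piMl // mulr_ge0.
Qed.

Let rh_half n : rh n.+2 * rh n.+1 <= 2^-1.
Proof.
have /andP[c0 c1] := rh01 n.+2; have /andP[e0 e1] := rh01 n.+1.
have q1 := q_ge1 n.+1; have Eh := rh_rec n.+1.
have : rh n.+2 * (rh n.+1 + rh n.+1) <= rh n.+2 * (q n.+1 + rh n.+1).
  by rewrite ler_wpM2l // lerD2r; lra.
by rewrite Eh mulrDr; lra.
Qed.

Let d_rec2 n e : th n <= e -> th n.+1 <= e -> d n.+2 <= 2 * e + 2^-1 * d n.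
Proof.
move=> t0 t1; have h1 := d_rec n.+1; have h0 := d_rec n; have hh := rh_half n.
have /andP[c0 c1] := rh01 n.+2; have dn := normr_ge0 (r n - rh n); rewrite -/(d n) in dn.
have h2 : rh n.+2 * d n.+1 <= rh n.+2 * (th n + rh n.+1 * d n) by rewrite ler_wpM2l.
have h3 : rh n.+2 * th n <= e by apply: le_trans t0; rewrite ler_piMl.
have h4 : rh n.+2 * rh n.+1 * d n <= 2^-1 * d n by rewrite ler_wpM2r.
by move: h2; rewrite mulrDr mulrA; lra.
Qed.

Lemma cf_contraction (e : R) : 0 < e -> exists N, forall n, (N <= n)%N -> `|r n - rh n| <= e.
Proof.
move=> e0; have e8 : 0 < e / 8 by rewrite divr_gt0 ?ltr0n.
have [N hN] := th_to0 e8.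
have d1 n : d n <= 1.
  rewrite /d ler_norml; have [/andP[a0 a1] /andP[b0 b1]] := (r01 n, rh01 n).
  by apply/andP; split; lra.
have step j n : (N <= n)%N -> d (n + j.*2) <= e / 2 + 2^-1 ^+ j.
  move=> Nn; elim: j => [|j IH]; first by rewrite addn0 expr0; have := d1 n; lra.
  rewrite doubleS !addnS; have Nj : (N <= n + j.*2)%N by rewrite (leq_trans Nn) // leq_addr.
  have := @d_rec2 (n + j.*2) (e / 8) (hN _ Nj) (hN _ (leqW Nj)).
  by rewrite exprS; lra.
have [J hJ] : exists J, 2^-1 ^+ J <= e / 2.
  exists (Num.truncn (2 / e)).+1.
  have h : 2 / e <= 2 ^+ (Num.truncn (2 / e)).+1.
    apply: le_trans (ltW (truncnS_gt _)) _.
    by rewrite -natrX ler_nat ltnW // ltn_expl.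
  have e2 : 0 < 2 / e by rewrite divr_gt0.
  by rewrite exprVn -[e / 2]invrK lef_pV2 ?posrE ?invr_gt0 ?exprn_gt0 ?divr_gt0 // invf_div.
exists (N + J.*2)%N => n hn.
have -> : n = (n - J.*2 + J.*2)%N by rewrite subnK // (leq_trans _ hn) // leq_addl.
apply: le_trans (step J _ _) _; last by lra.
have Jn : (J.*2 <= n)%N by apply: leq_trans hn; exact: leq_addl.
by rewrite -(leq_add2r J.*2) subnK.
Qed.

End ContinuedFractionContraction.

Section LiminfBounds.
Variables (R : realType) (u : nat -> R).
Hypothesis u01 : forall n, 0 <= u n <= 1.

Let bnd : bounded_fun u.
Proof.
exists 1; split; first exact: num_real.
move=> x x1 n _ /=; have /andP[h0 h1] := u01 n.
by rewrite ger0_norm // (le_trans h1) // ltW.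
Qed.

Let sdrop_lb n : has_lbound (sdrop u n).
Proof. by exists 0 => _ [k _ <-]; case/andP: (u01 k). Qed.

Let infs_ub : has_sup (range (infs u)).
Proof.
split; first by exists (infs u 0%N), 0%N.
exact: bounded_fun_has_ubound_infs bnd.
Qed.

Lemma limn_inf_ge (e : R) : 0 < e -> exists N, forall n, (N <= n)%N -> limn_inf u - e <= u n.
Proof.
move=> e0; rewrite limn_infE //.
have [_ [N _ <-] hN] := sup_adherent e0 infs_ub.
exists N => n Nn; apply: le_trans (ltW hN) _.
by apply: (ge_inf (sdrop_lb N)); exists n.
Qed.

Lemma limn_inf_le (e : R) N : 0 < e -> exists2 n, (N <= n)%N & u n <= limn_inf u + e.
Proof.
move=> e0; rewrite limn_infE //.
have hi : has_inf (sdrop u N) by split => //; exists (u N); exists N => /=.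
have [_ [n /= Nn <-] hn] := inf_adherent e0 hi.
exists n => //; apply: le_trans (ltW hn) _; rewrite lerD2r.
by apply: (sup_upper_bound infs_ub); exists N.
Qed.

End LiminfBounds.

Section SturmianRatio.
Variables (R : realType) (a b : nat) (s : nat -> nat).
Hypothesis a_gt0 : (0 < a)%N.
Hypothesis b_gt0 : (0 < b)%N.
Hypothesis s_gt0 : forall k : nat, (0 < k)%N -> (0 < s k)%N.

Let X : nat -> R := sturm_X R a b s.
Let sigma : R := sturm_sigma R s.

Definition rev_cfrac (k : nat) : R := cfrac R (0%N :: rev [seq s i | i <- iota 1 k]).

Lemma rev_cfracS k : rev_cfrac k.+1 = ((s k.+1)%:R + rev_cfrac k)^-1.
Proof.
rewrite /rev_cfrac -(addn1 k) iotaD map_cat cats1 rev_rcons /= add1n addn1.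
by rewrite !add0r.
Qed.

Lemma rev_cfrac01 k : 0 <= rev_cfrac k <= 1.
Proof.
elim: k => [|k /andP[IH0 IH1]]; first by rewrite /rev_cfrac /= invr0 addr0 lexx ler01.
have s1 : 1 <= (s k.+1)%:R :> R by rewrite ler1n s_gt0.
by rewrite rev_cfracS invr_ge0 addr_ge0 //= invf_le1; lra.
Qed.

Lemma rev_cfrac_rec k : rev_cfrac k.+1 * ((s k.+1)%:R + rev_cfrac k) = 1.
Proof.
have s1 : 1 <= (s k.+1)%:R :> R by rewrite ler1n s_gt0.
have /andP[h0 _] := rev_cfrac01 k.
by rewrite rev_cfracS mulVf //; apply/lt0r_neq0; lra.
Qed.

Lemma sturm_sigma_ge0 : 0 <= sigma.
Proof.
apply/ler_addgt0Pr => e e0.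
have [n _ h] := limn_inf_le rev_cfrac01 0 e0; apply: le_trans h.
by case/andP: (rev_cfrac01 n).
Qed.

Let L n := ln (X n).

Let Xn n : n.+1%:R <= X n. Proof. exact: sturm_X_ge. Qed.
Let X_gt0 n : 0 < X n. Proof. exact: lt_le_trans (ltr0Sn _ _) (Xn n). Qed.
Let L_ge0 n : 0 <= L n.
Proof. by apply: ln_ge0; apply: le_trans (Xn n); rewrite ler1n. Qed.
Let LS_gt0 n : 0 < L n.+1.
Proof. by apply: ln_gt0; apply: lt_le_trans (Xn n.+1); rewrite ltr1n. Qed.
Let L_mono n : L n <= L n.+1.
Proof. by rewrite ler_ln ?posrE //; exact: sturm_X_mono. Qed.

Let L_rec n : (s n.+3)%:R * L n.+1 + L n <= L n.+2 <=
              (s n.+3)%:R * ln 2 + ((s n.+3)%:R * L n.+1 + L n).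
Proof.
have /andP[h1 h2] : X n.+1 ^+ s n.+3 * X n <= X n.+2 <=
  2 ^+ s n.+3 * (X n.+1 ^+ s n.+3 * X n) by exact: sturm_X_rec.
have p1 : 0 < X n.+1 ^+ s n.+3 by rewrite exprn_gt0.
have E : ln (X n.+1 ^+ s n.+3 * X n) = (s n.+3)%:R * L n.+1 + L n.
  by rewrite lnM ?posrE // lnXn // mulr_natl.
have E2 : ln (2 ^+ s n.+3 : R) = (s n.+3)%:R * ln 2 by rewrite lnXn // mulr_natl.
have p2 : 0 < (2 : R) ^+ s n.+3 by rewrite exprn_gt0.
have p3 : 0 < X n.+1 ^+ s n.+3 * X n by rewrite mulr_gt0.
rewrite -E -E2 -lnM ?posrE // !ler_ln ?posrE ?h1 ?h2 //.
by rewrite mulr_gt0.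
Qed.

(** Taking logarithms in the recursion for X turns it into the recursion for the
    continued fractions, with the relative error ln 2 / L n.+1. *)
Lemma sturm_ratio (e : R) : 0 < e -> exists N, forall n, (N <= n)%N ->
  `|L n / L n.+1 - rev_cfrac n.+2| <= e.
Proof.
pose q n : R := (s n.+3)%:R.
pose th n := (L n.+2 - (q n * L n.+1 + L n)) / (q n * L n.+1).
have q1 n : 1 <= q n by rewrite /q ler1n s_gt0.
have q0 n : 0 < q n by apply: lt_le_trans (q1 n).
apply: (@cf_contraction R q th (fun n => L n / L n.+1) (fun n => rev_cfrac n.+2)) => //.
- move=> n; have /andP[h _] := L_rec n.
  by rewrite /th divr_ge0 ?subr_ge0 // mulr_ge0 // ltW.
- move=> d d0; exists (Num.truncn (expR (ln 2 / d))).+1 => n hn.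
  have hL : ln 2 / d <= L n.+1.
    rewrite -ler_expR /L lnK ?posrE //; apply: le_trans (Xn n.+1).
    apply: le_trans (ltW (truncnS_gt _)) _.
    by rewrite ler_nat (leq_trans hn) // -addn2 leq_addr.
  have /andP[_ h] := L_rec n.
  rewrite /th ler_pdivrMr ?mulr_gt0 // lerBlDr (le_trans h) // lerD2r.
  have -> : d * (q n * L n.+1) = q n * (d * L n.+1) by ring.
  by apply: ler_wpM2l; [exact: ltW (q0 n)|rewrite mulrC -ler_pdivrMr].
- by move=> n; rewrite divr_ge0 //= ler_pdivrMr // mul1r.
- by move=> n; exact: rev_cfrac01.
- move=> n; rewrite /th; field.
  by rewrite !lt0r_neq0 //; exact: q0.
- by move=> n; exact: rev_cfrac_rec.
Qed.

Let powR_le (x y t : R) : 0 < x -> 0 < y -> t * ln x <= ln y -> x `^ t <= y.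
Proof. by move=> x0 y0 h; rewrite -ler_ln ?posrE ?powR_gt0 // ln_powR. Qed.

Let le_powR (x y t : R) : 0 < x -> 0 < y -> ln y <= t * ln x -> y <= x `^ t.
Proof. by move=> x0 y0 h; rewrite -ler_ln ?posrE ?powR_gt0 // ln_powR. Qed.

Lemma sturm_X_ge_sigma (e : R) : 0 < e -> exists N, forall n, (N <= n)%N ->
  X n.+1 `^ (sigma - e) <= X n.
Proof.
move=> e0; have e2 : 0 < e / 2 by rewrite divr_gt0.
have [N1 h1] := sturm_ratio e2; have [N2 h2] := limn_inf_ge rev_cfrac01 e2.
exists (maxn N1 N2) => n; rewrite geq_max => /andP[n1 n2].
apply: powR_le => //; rewrite -/(L _) -/(L _) -ler_pdivlMr //.
have := h1 n n1; rewrite ler_norml => /andP[h _].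
have := h2 n.+2 (leq_trans n2 (leqW (leqnSn n))); rewrite -/(sturm_sigma R s) -/sigma.
lra.
Qed.

Lemma sturm_X_le_sigma (e : R) (N : nat) : 0 < e -> exists2 n, (N <= n)%N &
  X n <= X n.+1 `^ (sigma + e).
Proof.
move=> e0; have e2 : 0 < e / 2 by rewrite divr_gt0.
have [N1 h1] := sturm_ratio e2.
have [k kN hk] := limn_inf_le rev_cfrac01 (maxn N1 N).+2 e2.
case: k kN hk => [|[|n]] //; rewrite !ltnS geq_max => /andP[n1 n2] hk; exists n => //.
apply: le_powR => //; rewrite -/(L _) -/(L _) -ler_pdivrMr //.
have := h1 n n1; rewrite ler_norml => /andP[_ h].
move: hk; rewrite -/(sturm_sigma R s) -/sigma; lra.
Qed.

End SturmianRatio.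

(** * Cubic numbers and their minimal polynomials *)

Section MinimalPolynomial.
Variable F : numFieldType.
Implicit Types (x : F) (P Q : {poly int}).

Lemma rootZ_size_gt1 x P : P != 0 -> root (map_poly intr P) x -> (1 < size P)%N.
Proof.
move=> P0 rP; rewrite ltnNge; apply/negP => /size1_polyC Pc.
move: rP P0; rewrite Pc map_polyC /= rootC intr_eq0 => /eqP ->.
by rewrite eqxx.
Qed.

(** The pseudo-remainder of Q modulo an annihilating polynomial M of least degree
    vanishes, so M divides a multiple of Q. *)
Lemma irreducible_cubic_minpoly x Q : irreducible_cubic Q -> zcontents Q = 1 ->
  root (map_poly intr Q) x -> is_minpolyZ x Q.
Proof.
move=> irr cQ rQ; split => // P P0 rP; rewrite (irr.2) leqNgt; apply/negP => sP.
have ex : exists n, `[< exists P, [/\ P != 0, root (map_poly intr P) x & size P = n] >].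
  by exists (size P); apply/asboolP; exists P.
case: (ex_minnP ex) => n /asboolP[M [M0 rM sM]] nmin.
have sM4 : (size M < 4)%N.
  by rewrite sM; apply: leq_ltn_trans sP; apply: nmin; apply/asboolP; exists P.
have E := Pdiv.Idomain.divp_eq Q M.
set l := lead_coef M ^+ _ in E.
have l0 : l != 0 by rewrite expf_neq0 // lead_coef_eq0.
have r0 : Q %% M = 0.
  apply/eqP; apply: contraT => r0.
  have : (size (Q %% M)%R < size M)%N by rewrite Pdiv.Idomain.ltn_modp.
  rewrite sM ltnNge nmin //; apply/asboolP; exists (Q %% M); split => //.
  have -> : Q %% M = l *: Q - (Q %/ M) * M by rewrite E addrC addKr.
  rewrite rmorphB /= map_polyZ rmorphM /= rootE !hornerE.
  by rewrite (rootP rQ) (rootP rM) !mulr0 subrr.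
rewrite r0 addr0 in E.
by apply: (irreducible_cubic_factor irr _ l0 E); rewrite sM4 (rootZ_size_gt1 M0 rM).
Qed.

Lemma minpolyZ_unique x P Q : is_minpolyZ x P -> is_minpolyZ x Q -> P = Q.
Proof.
move=> [cP rP minP] [cQ rQ minQ].
have nz A : zcontents A = 1 -> A != 0.
  by move=> cA; rewrite -zcontents_eq0 cA.
have [P0 Q0] := (nz _ cP, nz _ cQ).
have sPQ : size P = size Q by apply/anti_leq; rewrite minP // minQ.
have D0 : lead_coef Q *: P - lead_coef P *: Q = 0.
  apply/eqP; apply: contraT => D0.
  have rD : root (map_poly intr (lead_coef Q *: P - lead_coef P *: Q)) x.
    rewrite rmorphB /= !map_polyZ rootE !hornerE.
    by rewrite (rootP rP) (rootP rQ) !mulr0 subrr.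
  have := minP _ D0 rD; rewrite leqNgt => /negP[].
  have s0 : (0 < size P)%N by rewrite size_poly_gt0.
  rewrite -(prednK s0) ltnS; apply/leq_sizeP => j hj.
  rewrite coefB !coefZ; move: hj; rewrite leq_eqVlt => /orP[/eqP <-|hj].
    by rewrite lead_coefE -sPQ -lead_coefE mulrC subrr.
  by rewrite !nth_default ?mulr0 ?subrr // -?sPQ -(prednK s0).
move/eqP: D0; rewrite subr_eq0 => /eqP D.
have lPQ : lead_coef Q = lead_coef P.
  by have := congr1 zcontents D; rewrite !zcontentsZ cP cQ !mulr1.
have lQ : lead_coef Q != 0 by rewrite lead_coef_eq0.
apply/polyP => i; apply: (mulfI lQ).
by rewrite -coefZ D coefZ lPQ.
Qed.

Lemma minpolyZE x P : is_minpolyZ x P -> minpolyZ x = P.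
Proof.
move=> hP; rewrite /minpolyZ; case: xgetP => [Q _ hQ|/(_ P)//].
exact: minpolyZ_unique hQ hP.
Qed.

Lemma cubic_minpoly x : cubic x ->
  irreducible_cubic (minpolyZ x) /\ root (map_poly intr (minpolyZ x)) x.
Proof.
case=> P /[dup] /minpolyZE -> [cP rP minP] sP; split => //; split => //; split.
- exact: cubic_neq0.
- by rewrite poly_unitE sP.
have half A B : P = A * B -> root (map_poly intr A) x -> B \is a GRing.unit.
  move=> E rA.
  have A0 : A != 0 by apply: contraTneq (cubic_neq0 sP) => A0; rewrite E A0 mul0r eqxx.
  have B0 : B != 0 by apply: contraTneq (cubic_neq0 sP) => B0; rewrite E B0 mulr0 eqxx.
  have sE : (size A + size B).-1 = 4%N by rewrite -size_mul // -E.
  have sA : (4 <= size A)%N by rewrite -sP; exact: minP.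
  apply: unit_contents1; last first.
    by apply/unitrPr; exists (zcontents A); rewrite mulrC -zcontentsM -E.
  by move: B0; rewrite -size_poly_gt0; move: (size A) (size B) sE sA => m n; lia.
move=> A B E; move: rP; rewrite E rmorphM rootM => /orP[] r; [right|left].
  exact: half E r.
by apply: (half B A) => //; rewrite mulrC.
Qed.

End MinimalPolynomial.

Section ComplexRoots.
Variable R : realType.
Local Notation C := R[i].

(** The norm of R[i] takes its values in R[i]; its real part carries all of it. *)
Definition cnorm (x : C) : R := complex.Re `|x|.

Lemma cnormE x : `|x| = real_complex R (cnorm x).
Proof. by rewrite /cnorm RRe_real // ger0_real. Qed.

Lemma cnormM x y : cnorm (x * y) = cnorm x * cnorm y.
Proof. by apply: (@complexI R); rewrite rmorphM /= -!cnormE normrM. Qed.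

Lemma cnormD x y : cnorm (x + y) <= cnorm x + cnorm y.
Proof. by rewrite -lecR rmorphD /= -!cnormE ler_normD. Qed.

Lemma cnorm_ge0 x : 0 <= cnorm x.
Proof. by rewrite -ler0c -cnormE. Qed.

Lemma cnorm_real (x : R) : cnorm (real_complex R x) = `|x|.
Proof.
apply: (@complexI R); rewrite -cnormE normc_def /= expr0n /= addr0 sqrtr_sqr.
by [].
Qed.

Lemma distE (z : R) (x : C) : dist z x = cnorm (real_complex R z - x).
Proof. by []. Qed.

Lemma evalZ_complex (Q : {poly int}) (z : R) :
  (map_poly intr Q).[real_complex R z] = real_complex R (evalZ Q z).
Proof.
rewrite /evalZ -horner_map /= -map_poly_comp; congr (_.[_]).
by apply: eq_map_poly => n /=; rewrite rmorph_int.
Qed.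

(** 11 = 1 + 3 + 7, where 1, 3 and 7 bound the quotients (z^i - x^i) / (z - x) for
    i = 1, 2, 3 as long as |z| <= 1 and |x| <= 2. *)
Lemma evalZ_le_dist (Q : {poly int}) (z : R) (x : C) : size Q = 4%N ->
  root (map_poly intr Q) x -> 0 <= z <= 1 -> dist z x <= 1 ->
  `|evalZ Q z| <= 11 * (poly_height Q)%:R * dist z x.
Proof.
move=> sQ rQ /andP[z0 z1] dx; rewrite distE in dx *.
set w := real_complex R z in dx *.
have w1 : cnorm w <= 1 by rewrite cnorm_real ger0_norm.
have x2 : cnorm x <= 2.
  have -> : x = w + -1 * (w - x) by ring.
  apply: le_trans (cnormD _ _) _; rewrite cnormM.
  have -> : cnorm (-1) = 1 by rewrite -(rmorphN1 (real_complex R)) cnorm_real normrN1.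
  by rewrite mul1r (_ : 2 = 1 + 1) ?lerD.
rewrite -(cnorm_real (evalZ Q z)) -evalZ_complex -/w.
have QE y : (map_poly intr Q).[y : C] = (Q`_0)%:~R + (Q`_1)%:~R * y + (Q`_2)%:~R * y ^+ 2 + (Q`_3)%:~R * y ^+ 3.
  rewrite {1}(cubicE sQ) !rmorphD !rmorphM /= ?map_polyXn ?map_polyX.
  by rewrite !map_polyC !hornerE; ring.
have -> : (map_poly intr Q).[w] = (w - x) * ((Q`_1)%:~R + (Q`_2)%:~R * (w + x) +
     (Q`_3)%:~R * (w * w + w * x + x * x)).
  rewrite -[LHS]subr0 -(rootP rQ) !QE; ring.
rewrite cnormM mulrC ler_wpM2r ?cnorm_ge0 //.
set H : R := (poly_height Q)%:R.
have hQ i : cnorm (Q`_i)%:~R <= H.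
  rewrite -(rmorph_int (real_complex R)) cnorm_real.
  exact: coef_height_real.
have M p q e f : cnorm p <= e -> cnorm q <= f -> cnorm (p * q) <= e * f.
  by move=> hp hq; rewrite cnormM ler_pM // cnorm_ge0.
have A p q e f : cnorm p <= e -> cnorm q <= f -> cnorm (p + q) <= e + f.
  by move=> hp hq; apply: le_trans (cnormD _ _) (lerD hp hq).
have -> : 11 * H = H + H * (1 + 2) + H * (1 * 1 + 1 * 2 + 2 * 2) by ring.
have h1 : cnorm ((Q`_2)%:~R * (w + x)) <= H * (1 + 2) by apply: (M) => //; apply: (A).
have h2 : cnorm (w * w + w * x + x * x) <= 1 * 1 + 1 * 2 + 2 * 2.
  by apply: (A); [apply: (A)|]; apply: (M).
by apply: (A); [apply: (A)|apply: (M)].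
Qed.

(** Q'/Q is the sum of the 1 / (z - x_i), so the closest of the three roots does it. *)
Lemma cubic_close_root (Q : {poly int}) (z : R) : size Q = 4%N -> evalZ' Q z != 0 ->
  exists2 x : C, root (map_poly intr Q) x & dist z x * `|evalZ' Q z| <= 3 * `|evalZ Q z|.
Proof.
move=> sQ dQ; have [r Er] := closed_field_poly_normal (map_poly intr Q : {poly C}).
set l := lead_coef _ in Er.
have sr : size r = 3%N.
  have : size (map_poly intr Q : {poly C}) = 4%N by rewrite size_map_inj_poly //; exact: intr_inj.
  rewrite Er size_scale ?size_prod_XsubC; first by case.
  rewrite /l lead_coef_eq0 -size_poly_gt0 size_map_inj_poly ?sQ //; exact: intr_inj.
case: r Er sr => [|x1 [|x2 [|x3 [|]]]] // Er _.
set w := real_complex R z.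
have rx x : x \in [:: x1; x2; x3] -> root (map_poly intr Q) x.
  move=> xr; rewrite Er; apply/rootP; rewrite hornerZ.
  by have := root_prod_XsubC [:: x1; x2; x3] x; rewrite xr => /rootP ->; rewrite mulr0.
have vE : `|evalZ Q z| = cnorm l * (cnorm (w - x1) * cnorm (w - x2) * cnorm (w - x3)).
  rewrite -(cnorm_real (evalZ Q z)) -evalZ_complex Er !big_cons big_nil.
  by rewrite mulr1 !hornerE !cnormM -/w /= ?mulrA.
have dE : `|evalZ' Q z| <= cnorm l * (cnorm (w - x2) * cnorm (w - x3) +
   cnorm (w - x1) * cnorm (w - x3) + cnorm (w - x1) * cnorm (w - x2)).
  rewrite -(cnorm_real (evalZ' Q z)) /evalZ' -evalZ_complex -deriv_map Er !big_cons big_nil.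
  rewrite mulr1 derivZ !derivM !derivXsubC !hornerE /= -/w.
  have -> : (w - x2) * (w - x3) + (w - x1) * (w - x3 + w - x2) =
     (w - x2) * (w - x3) + (w - x1) * (w - x3) + (w - x1) * (w - x2) by ring.
  rewrite cnormM ler_wpM2l ?cnorm_ge0 // -!cnormM.
  by apply: le_trans (cnormD _ _) _; rewrite lerD2r cnormD.
have key (L d e1 e2 v v' : R) : 0 <= L -> 0 <= d -> d <= e1 -> d <= e2 ->
    v = L * (d * e1 * e2) -> v' <= L * (e1 * e2 + d * e2 + d * e1) -> d * v' <= 3 * v.
  move=> L0 d0 h1 h2 -> hv'.
  have e10 := le_trans d0 h1; have e20 := le_trans d0 h2.
  apply: le_trans (ler_wpM2l d0 hv') _.
  have a1 : d * (d * e2) <= d * (e1 * e2) by rewrite ler_wpM2l // ler_wpM2r.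
  have a2 : d * (d * e1) <= d * (e1 * e2) by rewrite ler_wpM2l // mulrC ler_wpM2l.
  have -> : d * (L * (e1 * e2 + d * e2 + d * e1)) = L * (d * (e1 * e2) + d * (d * e2) + d * (d * e1)) by ring.
  have -> : 3 * (L * (d * e1 * e2)) = L * (3 * (d * (e1 * e2))) by ring.
  by apply: ler_wpM2l => //; lra.
have := cnorm_ge0 (w - x1); have := cnorm_ge0 (w - x2); have := cnorm_ge0 (w - x3).
have := cnorm_ge0 l; move: vE dE; set L := cnorm l.
set d1 := cnorm (w - x1); set d2 := cnorm (w - x2); set d3 := cnorm (w - x3).
move=> vE dE L0 h3 h2 h1.
have [d12|/ltW d21] := leP d1 d2.
  have [d13|/ltW d31] := leP d1 d3.
    exists x1; first by apply: rx; rewrite mem_head.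
    exact: (@key L d1 d2 d3).
  exists x3; first by apply: rx; rewrite !inE eqxx !orbT.
  apply: (@key L d3 d1 d2) => //; first exact: le_trans d12.
    by rewrite vE; ring.
  by rewrite (le_trans dE) // le_eqVlt; apply/orP; left; apply/eqP; ring.
have [d23|/ltW d32] := leP d2 d3.
  exists x2; first by apply: rx; rewrite !inE eqxx !orbT.
  apply: (@key L d2 d1 d3) => //; first by rewrite vE; ring.
  by rewrite (le_trans dE) // le_eqVlt; apply/orP; left; apply/eqP; ring.
exists x3; first by apply: rx; rewrite !inE eqxx !orbT.
apply: (@key L d3 d1 d2) => //; first exact: le_trans d21.
  by rewrite vE; ring.
by rewrite (le_trans dE) // le_eqVlt; apply/orP; left; apply/eqP; ring.
Qed.

End ComplexRoots.

(** * Powers and finiteness *)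

Section Powers.
Variable R : realType.
Implicit Types x e M r t : R.

Lemma powR_add x r t : 0 < x -> x `^ (r + t) = x `^ r * x `^ t.
Proof. by move=> x0; rewrite powRD // lt0r_neq0 // implybT. Qed.

Lemma powR_eventually_ge M e : 0 < e ->
  exists2 B : R, 1 <= B & forall x, B <= x -> M <= x `^ e.
Proof.
move=> e0; exists (Num.max 1 (`|M| `^ e^-1)); first by rewrite le_max lexx.
move=> x; rewrite ge_max => /andP[x1 xM].
apply: le_trans (ler_norm M) _.
have -> : `|M| = (`|M| `^ e^-1) `^ e by rewrite -powRrM mulVf ?lt0r_neq0 // powRr1.
by apply: ge0_ler_powR; rewrite ?nnegrE ?powR_ge0 ?(ltW e0) ?(le_trans ler01 x1).
Qed.

End Powers.

Section FiniteSets.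
Variable R : realType.

(** These polynomials are parametrized by the quadruples of integers in [-N, N]. *)
Lemma finite_cubics (B : R) :
  finite_set [set Q : {poly int} | irreducible_cubic Q /\ (poly_height Q)%:R <= B].
Proof.
pose N := (Num.truncn `|B|).+1.
pose f (t : 'I_(2 * N).+1 * 'I_(2 * N).+1 * 'I_(2 * N).+1 * 'I_(2 * N).+1) : {poly int} :=
  cubic_poly ((t.1.1.1 : nat)%:Z - N%:Z) ((t.1.1.2 : nat)%:Z - N%:Z)
             ((t.1.2 : nat)%:Z - N%:Z) ((t.2 : nat)%:Z - N%:Z).
have fin : finite_set (f @` setT).
  apply: finite_image. exact: finite_finset.
apply: (sub_finite_set _ fin).
move=> Q /= [[_ sQ] hQ].
have cN i : (`|(Q`_i)%R| <= N)%N.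
  apply: leq_trans (coef_height Q i) _; rewrite -(ler_nat R).
  apply: le_trans hQ (le_trans (ler_norm B) _); exact/ltW/truncnS_gt.
have hi i : (absz (Q`_i + N%:Z)%R < (2 * N).+1)%N by move: (cN i); move: (Q`_i) => c; lia.
pose g i := Ordinal (hi i).
exists (g 0%N, g 1%N, g 2%N, g 3%N) => //.
have E i : ((g i : nat)%:Z - N%:Z) = Q`_i.
  have q0 : 0 <= Q`_i + N%:Z by move: (cN i); move: (Q`_i) => c; lia.
  by rewrite /g /= gez0_abs // addrK.
by rewrite /f /= !E /cubic_poly -cubicE.
Qed.

Lemma finite_roots (Q : {poly int}) : Q != 0 ->
  finite_set [set x : R[i] | root (map_poly intr Q) x].
Proof.
move=> Q0; have [r Er] := closed_field_poly_normal (map_poly intr Q : {poly R[i]}).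
apply: (@sub_finite_set _ _ [set` r]); last exact: finite_seq.
move=> x /=; rewrite Er rootZ ?root_prod_XsubC //.
by rewrite lead_coef_eq0 map_poly_eq0_id0 // intr_eq0 lead_coef_eq0.
Qed.

Lemma finite_cubic_numbers (B : R) :
  finite_set [set x : R[i] | cubic x /\ (alg_height x)%:R <= B].
Proof.
pose F (Q : {poly int}) := [set x : R[i] | root (map_poly intr Q) x].
apply: (@sub_finite_set _ _ (\bigcup_(Q in
  [set Q : {poly int} | irreducible_cubic Q /\ (poly_height Q)%:R <= B]) F Q)).
  by move=> x [/cubic_minpoly [irr rx] hx]; exists (minpolyZ x).
apply: bigcup_finite; first exact: finite_cubics.
by move=> Q [[[Q0 _ _] _] _]; exact: finite_roots.
Qed.

End FiniteSets.

(** * Exponents of cubic approximation *)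

(** From here on only the growth of X, the two lower bounds and the supply of good
    cubics matter. *)
Section CubicExponents.
Variables (R : realType) (z sigma : R) (X : nat -> R).
Hypothesis z01 : 0 <= z <= 1.
Hypothesis sigma_ge0 : 0 <= sigma.
Hypothesis X_ge1 : forall n, 1 <= X n.
Hypothesis X_mono : forall n, X n <= X n.+1.
Hypothesis X_unbounded : forall B : R, exists N, forall n, (N <= n)%N -> B <= X n.
Hypothesis X_ge_sigma : forall e : R, 0 < e -> exists N, forall n, (N <= n)%N ->
  X n.+1 `^ (sigma - e) <= X n.
Hypothesis X_le_sigma : forall (e : R) (N : nat), 0 < e -> exists2 n, (N <= n)%N &
  X n <= X n.+1 `^ (sigma + e).

Local Notation H Q := ((poly_height Q)%:R : R).
Local Notation Ha x := ((alg_height x)%:R : R).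

Variable c1 : R.
Hypothesis c1_gt0 : 0 < c1.
Hypothesis lower : forall Q, irreducible_cubic Q -> c1 <= `|evalZ Q z| * H Q ^+ 3.

Variable c3 : R.
Hypothesis c3_gt0 : 0 < c3.
Hypothesis lower_uniform : forall Q n, irreducible_cubic Q -> H Q < c3 * X n.+1 ->
    c3 <= `|evalZ Q z| * X n ^+ 2 * X n.+1.

Variables (c C : R) (N0 : nat).
Hypothesis c_gt0 : 0 < c.
Hypothesis C_ge1 : 1 <= C.
Hypothesis cubics : forall n (Z : R), (N0 <= n)%N -> 1 <= Z -> Z * X n.+1 <= X n.+2 ->
  exists Q : {poly int}, [/\ irreducible_cubic Q /\ zcontents Q = 1,
    H Q <= C * (Z * X n.+1), `|evalZ Q z| * (Z * X n.+1 ^+ 3) <= C &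
    c * H Q <= `|evalZ' Q z| ].

Variable eps : R.
Hypothesis eps_gt0 : 0 < eps.

Lemma H_ge1 Q : irreducible_cubic Q -> 1 <= H Q.
Proof. by move=> [[Q0 _ _] _]; rewrite ler1n height_gt0. Qed.

Lemma cubic_of_polynomial Q : irreducible_cubic Q -> zcontents Q = 1 ->
  c * H Q <= `|evalZ' Q z| ->
  exists x : R[i], [/\ cubic x, Ha x = H Q & dist z x * (c * H Q) <= 3 * `|evalZ Q z|].
Proof.
move=> irr cQ dQ; have [_ sQ] := irr.
have HQ : 0 < c * H Q by rewrite mulr_gt0 // (lt_le_trans ltr01 (H_ge1 irr)).
have d0 : evalZ' Q z != 0 by rewrite -normr_gt0 (lt_le_trans HQ).
have [x rx hx] := cubic_close_root sQ d0.
have mx := irreducible_cubic_minpoly irr cQ rx.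
exists x; split.
- by exists Q.
- by rewrite /alg_height (minpolyZE mx).
- by apply: le_trans hx; rewrite ler_wpM2l // distE cnorm_ge0.
Qed.

Lemma polynomial_of_cubic (x : R[i]) : cubic x -> dist z x <= 1 ->
  exists Q, [/\ irreducible_cubic Q, H Q = Ha x & `|evalZ Q z| <= 11 * Ha x * dist z x].
Proof.
move=> /cubic_minpoly [irr rx] dx; exists (minpolyZ x); split => //.
by apply: evalZ_le_dist => //; case: irr.
Qed.

(** A constant K is allowed for the application to algebraic numbers, where passing
    from x to its minimal polynomial costs a factor. *)
Lemma bounded_height_of_small (K : R) : exists B, forall Q, irreducible_cubic Q ->
  `|evalZ Q z| <= K * H Q `^ (- 3 - eps) -> H Q <= B.
Proof.
have [B B1 hB] := powR_eventually_ge ((K + 1) / c1) eps_gt0.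
exists B => Q irr hQ; rewrite leNgt; apply/negP => /ltW /hB.
have H1 := H_ge1 irr; have H0 : 0 < H Q by apply: lt_le_trans H1.
apply/negP; rewrite -ltNge ltr_pdivlMr //.
have Hp := powR_gt0 eps H0.
have E : H Q `^ (- 3 - eps) * H Q ^+ 3 * H Q `^ eps = 1.
  rewrite -(powR_mulrn _ (ltW H0)) -!powR_add // (_ : - 3 - eps + 3%:R + eps = 0) ?powRr0 //.
  by ring.
have : H Q `^ eps * c1 <= H Q `^ eps * (K * H Q `^ (- 3 - eps) * H Q ^+ 3).
  rewrite ler_pM2l //; apply: le_trans (lower irr) _.
  by apply: ler_wpM2r => //; rewrite exprn_ge0 // ltW.
have -> : H Q `^ eps * (K * H Q `^ (- 3 - eps) * H Q ^+ 3) =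
   K * (H Q `^ (- 3 - eps) * H Q ^+ 3 * H Q `^ eps) by ring.
by rewrite E mulr1 => h; apply: le_lt_trans h _; rewrite ltrDl.
Qed.

Lemma finitely_many_small :
  finite_set [set Q : {poly int} | irreducible_cubic Q /\ `|evalZ Q z| <= H Q `^ (- 3 - eps)] /\
  finite_set [set x : R[i] | cubic x /\ dist z x <= Ha x `^ (- 4 - eps)].
Proof.
split.
  have [B hB] := bounded_height_of_small 1; apply: sub_finite_set (finite_cubics B).
  by move=> Q /= [irr hQ]; split => //; apply: hB => //; rewrite mul1r.
have [B hB] := bounded_height_of_small 11; apply: sub_finite_set (finite_cubic_numbers B).
move=> x /= [cx hx]; split => //.
have /H_ge1 H1 : irreducible_cubic (minpolyZ x) by case: (cubic_minpoly cx).
rewrite -/(alg_height x) in H1.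
have dx : dist z x <= 1.
  apply: le_trans hx _; rewrite -[leRHS](powRr0 (Ha x)); apply: (ler_powR H1).
  by have e0 := eps_gt0; lra.
have [Q [irr HQ hQ]] := polynomial_of_cubic cx dx.
rewrite -HQ; apply: hB => //; apply: le_trans hQ _; rewrite HQ -mulrA.
rewrite ler_pM2l //.
have H0 : 0 < Ha x by apply: lt_le_trans H1.
have -> : - 3 - eps = 1 + (- 4 - eps) by ring.
by rewrite (powR_add 1 _ H0) (powRr1 (ltW H0)) ler_pM2l.
Qed.

(** Cubics with Z = 1 have height and value of the order of X n.+1 and its inverse
    cube; their height tends to infinity by the lower bound. *)
Lemma arbitrarily_large_small (N : R) :
  (exists Q : {poly int}, [/\ irreducible_cubic Q, N <= H Q &
     `|evalZ Q z| <= H Q `^ (- 3 + eps)]) /\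
  (exists x : R[i], [/\ cubic x, N <= Ha x & dist z x <= Ha x `^ (- 4 + eps)]).
Proof.
(* the two terms absorb the constants for polynomials and for numbers *)
pose T := C ^+ 4 + 3 * C ^+ 4 / c.
have C0 : 0 < C by apply: lt_le_trans C_ge1.
have C4 : 0 < C ^+ 4 by rewrite exprn_gt0.
have T2 : 0 < 3 * C ^+ 4 / c by rewrite divr_gt0 // mulr_gt0.
have [B B1 hB] := powR_eventually_ge T eps_gt0.
pose M := `|N| + B.
have M1 : 1 <= M by rewrite /M; apply: le_trans B1 _; rewrite lerDr.
have [n1 hn1] := X_unbounded (1 + M ^+ 3 * C / c1).
pose n := maxn N0 n1.
have [Q [[irr cQ] hH hv hd]] := cubics (leq_maxl N0 n1) (lexx 1) (eq_ind_r (fun t => t <= X n.+2) (X_mono n.+1) (mul1r _)).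
rewrite -/n !mul1r in hH hv.
have H1 := H_ge1 irr; have H0 : 0 < H Q by apply: lt_le_trans H1.
have x1 := X_ge1 n.+1; have x0 : 0 < X n.+1 by apply: lt_le_trans x1.
have xM : M ^+ 3 * C / c1 < X n.+1.
  apply: lt_le_trans (hn1 _ (leqW (leq_maxr N0 n1))).
  by rewrite ltrDr ltr01.
have vH : `|evalZ Q z| * H Q ^+ 3 <= C ^+ 4.
  have h : H Q ^+ 3 <= (C * X n.+1) ^+ 3.
    by rewrite ler_pXn2r ?nnegrE ?mulr_ge0 // ltW.
  have h' : `|evalZ Q z| * H Q ^+ 3 <= `|evalZ Q z| * (C * X n.+1) ^+ 3.
    by rewrite ler_wpM2l.
  apply: le_trans h' _; rewrite exprMn mulrCA (exprSr C 3).
  by apply: ler_wpM2l => //; rewrite exprn_ge0 // ltW.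
have HM : M <= H Q.
  have h : c1 * X n.+1 ^+ 3 <= C * H Q ^+ 3.
    have : c1 * X n.+1 ^+ 3 <= `|evalZ Q z| * H Q ^+ 3 * X n.+1 ^+ 3.
      by apply: ler_wpM2r; [rewrite exprn_ge0 // ltW|exact: lower].
    move=> hh; apply: le_trans hh _; rewrite mulrAC.
    by apply: ler_wpM2r; rewrite ?exprn_ge0 ?(ltW H0).
  rewrite leNgt; apply/negP => hM.
  have h2 : H Q ^+ 3 <= M ^+ 3.
    by rewrite ler_pXn2r ?nnegrE ?ltW // (lt_trans H0).
  have h3 : X n.+1 <= X n.+1 ^+ 3.
    by rewrite exprS ler_peMr ?(ltW x0) // exprn_ege1.
  move: xM; rewrite ltr_pdivrMr //; apply/negP; rewrite -leNgt.
  apply: (@le_trans _ _ (c1 * X n.+1 ^+ 3)); first by rewrite mulrC ler_wpM2l // ltW.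
  by apply: le_trans h _; rewrite mulrC ler_wpM2r // ltW.
have NQ : N <= H Q.
  by apply: le_trans HM; rewrite /M; apply: le_trans (ler_norm N) _; rewrite lerDl (le_trans ler01).
have TQ : T <= H Q `^ eps.
  by apply: hB; apply: le_trans HM; rewrite /M lerDr.
have E (k : nat) : H Q ^+ k * H Q `^ (- k%:R + eps) = H Q `^ eps.
  by rewrite -(powR_mulrn _ (ltW H0)) -powR_add // addrA subrr add0r.
split.
  exists Q; split => //; have p3 : 0 < H Q ^+ 3 by rewrite exprn_gt0.
  rewrite -(ler_pM2l p3) mulrC; apply: le_trans vH _; rewrite E.
  by apply: le_trans TQ; rewrite /T lerDl ltW.
have [x [cx HxE hx]] := cubic_of_polynomial irr cQ hd.
exists x; split => //; rewrite HxE //.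
have p4 : 0 < H Q ^+ 4 by rewrite exprn_gt0.
rewrite -(ler_pM2l p4) E; apply: le_trans TQ.
apply: (@le_trans _ _ (3 * C ^+ 4 / c)); last by rewrite /T lerDr ltW.
rewrite ler_pdivlMr //.
have -> : H Q ^+ 4 * dist z x * c = H Q ^+ 3 * (dist z x * (c * H Q)) by ring.
have p3 : 0 <= H Q ^+ 3 by rewrite exprn_ge0 // ltW.
apply: le_trans (ler_wpM2l p3 hx) _.
by rewrite mulrCA ler_pM2l // mulrC.
Qed.

(** Y is a fixed multiple of X n.+1 for some n with X n <= X n.+1 ^ (sigma + e). *)
Lemma no_uniform_solution (K X0 : R) : exists2 Y : R, X0 <= Y & 1 <= Y /\
  ~ exists Q : {poly int}, [/\ irreducible_cubic Q, H Q <= Y &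
          `|evalZ Q z| <= K * Y `^ (- 2 * sigma - 1 - eps)].
Proof.
(* Y will be X n.+1 / k; the 2 makes H Q < c3 * X n.+1 strict for H Q <= Y *)
pose k := 2 / c3; have k0 : 0 < k by rewrite divr_gt0.
pose e := eps / 4; have e0 : 0 < e by rewrite divr_gt0.
pose al := 2 * (sigma + e) + 1.
have e2 : 0 < eps / 2 by rewrite divr_gt0.
have [B B1 hB] := powR_eventually_ge ((`|K| + 1) * k `^ al / c3 + 1) e2.
have [N hN] := X_unbounded ((B + `|X0|) * k).
have [n Nn hn] := X_le_sigma N e0.
pose Y := X n.+1 / k.
have YB : B + `|X0| <= Y by rewrite /Y ler_pdivlMr // hN // leqW.
have Y1 : 1 <= Y by apply: le_trans B1 (le_trans _ YB); rewrite lerDl.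
have Y0 : 0 < Y by apply: lt_le_trans Y1.
have XY : X n.+1 = Y * k by rewrite /Y divfK // lt0r_neq0.
exists Y.
  by apply: le_trans YB; apply: le_trans (ler_norm X0) _; rewrite lerDr (le_trans ler01).
split=> // -[Q [irr HQ hQ]].
have x0 : 0 < X n.+1 by apply: lt_le_trans (X_ge1 n.+1).
have : c3 <= `|evalZ Q z| * X n ^+ 2 * X n.+1.
  apply: lower_uniform => //; apply: le_lt_trans HQ _.
  rewrite XY mulrCA /k [c3 * _]mulrC divfK ?lt0r_neq0 //.
  by have yy := Y0; lra.
have hX : X n ^+ 2 * X n.+1 <= X n.+1 `^ al.
  have -> : al = (sigma + e) + (sigma + e) + 1 by rewrite /al; ring.
  rewrite (powR_add _ 1 x0) (powR_add (sigma + e) (sigma + e) x0) (powRr1 (ltW x0)) expr2 ler_wpM2r ?(ltW x0) //.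
  have xn0 : 0 <= X n by apply: le_trans ler01 (X_ge1 n).
  by apply: ler_pM.
have KY : `|evalZ Q z| <= (`|K| + 1) * Y `^ (- 2 * sigma - 1 - eps).
  apply: le_trans hQ _; rewrite ler_wpM2r ?powR_ge0 //.
  by apply: le_trans (ler_norm K) _; rewrite lerDl.
have h : `|evalZ Q z| * X n ^+ 2 * X n.+1 <=
    (`|K| + 1) * Y `^ (- 2 * sigma - 1 - eps) * X n.+1 `^ al.
  rewrite -mulrA; apply: ler_pM => //.
  by rewrite mulr_ge0 ?exprn_ge0 ?(le_trans ler01 (X_ge1 _)).
move=> /le_trans/(_ h); rewrite XY (powRM _ (ltW Y0) (ltW k0)).
have -> : (`|K| + 1) * Y `^ (- 2 * sigma - 1 - eps) * (Y `^ al * k `^ al) =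
   (`|K| + 1) * k `^ al * (Y `^ (- 2 * sigma - 1 - eps) * Y `^ al) by ring.
rewrite -powR_add // (_ : - 2 * sigma - 1 - eps + al = - (eps / 2)); last first.
  by rewrite /al /e; field.
rewrite powRN => h4.
have Yp : 0 < Y `^ (eps / 2) by apply: powR_gt0.
have h5 : (`|K| + 1) * k `^ al / c3 + 1 <= Y `^ (eps / 2).
  by apply: hB; apply: le_trans YB; rewrite lerDl.
have : Y `^ (eps / 2) <= (`|K| + 1) * k `^ al / c3.
  by rewrite ler_pdivlMr // mulrC -ler_pdivlMr.
by apply/negP; rewrite -ltNge; apply: lt_le_trans h5; rewrite ltrDl.
Qed.

Lemma uniform_lower_bound :
  (forall X0 : R, exists2 Y : R, X0 <= Y &
      ~ exists Q : {poly int}, [/\ irreducible_cubic Q, H Q <= Y &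
          `|evalZ Q z| <= Y `^ (- 2 * sigma - 1 - eps)]) /\
  (forall X0 : R, exists2 Y : R, X0 <= Y &
      ~ exists x : R[i], [/\ cubic x, Ha x <= Y &
          dist z x <= (Ha x)^-1 * Y `^ (- 2 * sigma - 1 - eps)]).
Proof.
split=> X0.
  have [Y XY [_ hY]] := no_uniform_solution 1 X0; exists Y => // -[Q [irr HQ hQ]].
  by apply: hY; exists Q; rewrite mul1r.
have [Y XY [Y1 hY]] := no_uniform_solution 11 X0; exists Y => // -[x [cx Hx hx]].
have /H_ge1 H1 : irreducible_cubic (minpolyZ x) by case: (cubic_minpoly cx).
rewrite -/(alg_height x) in H1.
have H0 : 0 < Ha x by apply: lt_le_trans H1.
have Yp : Y `^ (- 2 * sigma - 1 - eps) <= 1.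
  rewrite -[leRHS](powRr0 Y); apply: (ler_powR Y1).
  by have [s0 e0] := (sigma_ge0, eps_gt0); lra.
have dx : dist z x <= 1.
  apply: le_trans hx _; apply: mulr_ile1; rewrite ?powR_ge0 ?invr_ge0 ?(ltW H0) //.
  by rewrite invf_le1.
have [Q [irr HQ hQ]] := polynomial_of_cubic cx dx.
apply: hY; exists Q; split => //; first by rewrite HQ.
apply: le_trans hQ _; rewrite -mulrA ler_pM2l //.
by rewrite mulrC -ler_pdivlMr // mulrC.
Qed.

(** For C X n.+1 <= Y < C X n.+2, a cubic with Z X n.+1 = Y / C has height at most Y
    and its value is at most a multiple of 1 / (Y X n.+1 ^ 2), where X n.+1 is at
    least (Y / C) ^ (sigma - e). *)
Lemma uniform_upper_bound : exists X0 : R, forall Y : R, X0 <= Y ->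
   (exists Q : {poly int}, [/\ irreducible_cubic Q, H Q <= Y &
      `|evalZ Q z| <= Y `^ (- 2 * sigma - 1 + eps)]) /\
   (exists x : R[i], [/\ cubic x, Ha x <= Y &
      dist z x <= (Ha x)^-1 * Y `^ (- 2 * sigma - 1 + eps)]).
Proof.
have C0 : 0 < C by apply: lt_le_trans C_ge1.
pose e := eps / 4; have e0 : 0 < e by rewrite divr_gt0.
have e2 : 0 < eps / 2 by rewrite divr_gt0.
have [N1 hN1] := X_ge_sigma e0.
pose K := C ^+ 2 * C `^ (2 * (sigma - e)).
have K0 : 0 < K by rewrite mulr_gt0 ?exprn_gt0 ?powR_gt0.
have K3 : 0 < 3 * K / c by rewrite divr_gt0 // mulr_gt0.
have [B B1 hB] := powR_eventually_ge (K + 3 * K / c) e2.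
pose M := maxn N0 N1.
exists (B + C * X M.+1) => Y hY.
have CX n : 0 < C * X n by rewrite mulr_gt0 // (lt_le_trans ltr01).
have YB : B <= Y by apply: le_trans hY; rewrite lerDl ltW.
have Y0 : 0 < Y by apply: lt_le_trans YB; apply: lt_le_trans B1.
have [n [Mn Y1 Y2]] : exists n, [/\ (M <= n)%N, C * X n.+1 <= Y & Y < C * X n.+2].
  have ex : exists j, Y < C * X (M + j).+2.
    have [N hN] := X_unbounded (Y / C + 1); exists N.
    have := hN (M + N).+2; rewrite -addnS -addnS => h.
    rewrite mulrC -ltr_pdivrMr //; apply: lt_le_trans (h _); first by rewrite ltrDl.
    by rewrite (leq_trans (leq_addl M N)) // leq_add2l !leqW.
  case: (ex_minnP ex) => -[|j] hj jmin.
    exists M; split => //; last by rewrite addn0 in hj.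
    by apply: le_trans hY; rewrite lerDr (le_trans ler01).
  exists (M + j.+1)%N; split => //; first exact: leq_addr.
  by rewrite addnS leNgt; apply/negP => /jmin; rewrite ltnn.
pose Z := Y / (C * X n.+1).
have Z1 : 1 <= Z by rewrite /Z ler_pdivlMr // mul1r.
have ZX : Z * X n.+1 = Y / C.
  by rewrite /Z; field; rewrite !lt0r_neq0 // (lt_le_trans ltr01).
have Z2 : Z * X n.+1 <= X n.+2 by rewrite ZX ler_pdivrMr // mulrC ltW.
have [Q [[irr cQ] hH hv hd]] := cubics (leq_trans (leq_maxl N0 N1) Mn) Z1 Z2.
have H1 := H_ge1 irr; have H0 : 0 < H Q by apply: lt_le_trans H1.
have HY : H Q <= Y by rewrite ZX mulrCA divff ?mulr1 ?lt0r_neq0 // in hH.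
have x1 := X_ge1 n.+1; have x0 : 0 < X n.+1 by apply: lt_le_trans x1.
have YC1 : 1 <= Y / C.
  by rewrite ler_pdivlMr // mul1r; apply: le_trans Y1; rewrite ler_peMr // ltW.
have YC0 : 0 < Y / C by apply: lt_le_trans YC1.
have hX : (Y / C) `^ (sigma - e) <= X n.+1.
  (* the exponent is negative when sigma = 0 *)
  have [se|se] := leP 0 (sigma - e).
    apply: le_trans (hN1 _ (leq_trans (leq_maxr N0 N1) (leqW Mn))).
    apply: ge0_ler_powR => //; [exact: ltW|exact: le_trans ler01 (X_ge1 _)|].
    by rewrite ler_pdivrMr // mulrC ltW.
  apply: le_trans x1; rewrite -[leRHS](powRr0 (Y / C)); apply: (ler_powR YC1).
  exact: ltW.
have val : `|evalZ Q z| <= K * Y `^ (- 2 * sigma - 1 + eps / 2).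
  have h1 : `|evalZ Q z| * (Y / C * (Y / C) `^ (2 * (sigma - e))) <= C.
    apply: le_trans hv; rewrite ler_wpM2l //.
    have -> : Z * X n.+1 ^+ 3 = Y / C * X n.+1 ^+ 2 by rewrite -ZX; ring.
    rewrite ler_pM2l // (_ : 2 * (sigma - e) = (sigma - e) + (sigma - e)); last by ring.
    by rewrite (powR_add (sigma - e) (sigma - e) YC0) expr2 ler_pM // powR_ge0.
  have E : (Y / C * (Y / C) `^ (2 * (sigma - e))) * (K * Y `^ (- 2 * sigma - 1 + eps / 2)) = C.
    have Ya : Y `^ (2 * (sigma - e)) = (Y / C) `^ (2 * (sigma - e)) * C `^ (2 * (sigma - e)).
      by rewrite -(powRM _ (ltW YC0) (ltW C0)) divfK // lt0r_neq0.
    transitivity (C * (Y * Y `^ (2 * (sigma - e)) * Y `^ (- 2 * sigma - 1 + eps / 2))).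
      by rewrite Ya /K; field; rewrite lt0r_neq0.
    rewrite -[in X in X * _ * _](powRr1 (ltW Y0)) -!(powR_add _ _ Y0).
    rewrite (_ : 1 + _ + _ = 0) ?powRr0 ?mulr1 //.
    by rewrite /e; field.
  have p0 : 0 < Y / C * (Y / C) `^ (2 * (sigma - e)) by rewrite mulr_gt0 // powR_gt0.
  by rewrite -(ler_pM2l p0) E mulrC.
have KY : K + 3 * K / c <= Y `^ (eps / 2) by exact: hB.
have Ye : Y `^ (eps / 2) * Y `^ (- 2 * sigma - 1 + eps / 2) = Y `^ (- 2 * sigma - 1 + eps).
  by rewrite -powR_add //; congr (_ `^ _); field.
have P0 : 0 < Y `^ (- 2 * sigma - 1 + eps / 2) by rewrite powR_gt0.
split.
  exists Q; split => //; apply: le_trans val _; rewrite -Ye ler_pM2r //.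
  by apply: le_trans KY; rewrite lerDl ltW.
have [x [cx HxE hx]] := cubic_of_polynomial irr cQ hd.
exists x; split; rewrite ?HxE // [leRHS]mulrC ler_pdivlMr //.
apply: (@le_trans _ _ (3 * K / c * Y `^ (- 2 * sigma - 1 + eps / 2))); last first.
  by rewrite -Ye ler_pM2r //; apply: le_trans KY; rewrite lerDr ltW.
rewrite mulrAC ler_pdivlMr // -mulrA [H Q * c]mulrC; apply: le_trans hx _.
by rewrite -mulrA ler_pM2l.
Qed.

End CubicExponents.

(** * The theorem on Sturmian continued fractions *)

Unset Implicit Arguments.

Theorem theorem2p2 (R : realType) (a b : nat) (s : nat -> nat) (eps : R)
    (a_gt0 : (0 < a)%N) (b_gt0 : (0 < b)%N) (a_neq_b : a <> b)
    (s_gt0 : forall k : nat, (0 < k)%N -> (0 < s k)%N)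
    (eps_gt0 : 0 < eps) :
  let zeta : R := sturm_zeta R a b s in
  let sigma : R := sturm_sigma R s in
  let H (Q : {poly int}) : R := (poly_height Q)%:R in
  let Ha (alpha : R[i]) : R := (alg_height alpha)%:R in
  (finite_set [set Q : {poly int} | irreducible_cubic Q /\
                 `|evalZ Q zeta| <= H Q `^ (- 3 - eps)] /\
   finite_set [set alpha : R[i] | cubic alpha /\
                 dist zeta alpha <= Ha alpha `^ (- 4 - eps)]) /\
  (forall N : R,
     (exists Q : {poly int}, [/\ irreducible_cubic Q, N <= H Q &
        `|evalZ Q zeta| <= H Q `^ (- 3 + eps)]) /\
     (exists alpha : R[i], [/\ cubic alpha, N <= Ha alpha &
        dist zeta alpha <= Ha alpha `^ (- 4 + eps)])) /\
  ((forall X0 : R, exists2 X : R, X0 <= X &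
      ~ exists Q : {poly int}, [/\ irreducible_cubic Q, H Q <= X &
          `|evalZ Q zeta| <= X `^ (- 2 * sigma - 1 - eps)]) /\
   (forall X0 : R, exists2 X : R, X0 <= X &
      ~ exists alpha : R[i], [/\ cubic alpha, Ha alpha <= X &
          dist zeta alpha <= (Ha alpha)^-1 * X `^ (- 2 * sigma - 1 - eps)])) /\
  (exists X0 : R, forall X : R, X0 <= X ->
     (exists Q : {poly int}, [/\ irreducible_cubic Q, H Q <= X &
        `|evalZ Q zeta| <= X `^ (- 2 * sigma - 1 + eps)]) /\
     (exists alpha : R[i], [/\ cubic alpha, Ha alpha <= X &
        dist zeta alpha <= (Ha alpha)^-1 * X `^ (- 2 * sigma - 1 + eps)])).
Proof.
set zeta := sturm_zeta R a b s; set sigma := sturm_sigma R s; move=> H Ha.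
have [C chain] := sturm_quad_chain R a_gt0 b_gt0 a_neq_b s_gt0.
have w_gt0 := sturm_limit_gt0 a_gt0 b_gt0 s_gt0.
have w_le := sturm_limit_le a b s_gt0.
have pre := sturm_prefix R a_gt0 b_gt0 s_gt0.
have [c0 c0_gt0 bad] := badly_approximable w_gt0 w_le pre.
have [c1 c1_gt0 low1] := chain_lower_cubic chain c0_gt0 bad.
have [c3 c3_gt0 low3] := chain_lower_uniform chain.
have [c [C' [c_gt0 C'_ge1 [N hN]]]] :=
  chain_cubics chain (good_forms w_gt0 w_le pre) (ltr0Sn R (maxn a b)).
have X_ge1 := qc_X1 chain; have X_mono := qc_Xmono chain.
have X_inf := chain_X_unbounded chain.
split; first exact: (finitely_many_small (qc_z chain) c1_gt0 low1 eps_gt0).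
split.
  exact: (arbitrarily_large_small X_ge1 X_mono X_inf c1_gt0 low1 c_gt0 C'_ge1 hN eps_gt0).
split.
  exact: (uniform_lower_bound (qc_z chain) (sturm_sigma_ge0 R s_gt0) X_ge1 X_inf
    (sturm_X_le_sigma a_gt0 b_gt0 s_gt0) c3_gt0 low3 eps_gt0).
exact: (uniform_upper_bound X_ge1 X_inf (sturm_X_ge_sigma a_gt0 b_gt0 s_gt0)
  c_gt0 C'_ge1 hN eps_gt0).
Qed.
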